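(* The $\Gamma$-limit of the functionals $F_\varepsilon$ as $\varepsilon\to 0^+$ with respect to weak convergence in $W^{1,2}(\Omega_1;\mathbb{R}^3)\times L^2(\mathbb{R}^3;\mathbb{R}^3)$ exists and is given by $$F_0[m,h]=\begin{cases}\displaystyle\int_{\Omega_1}\alpha|\nabla' m|^2+\varphi(m)\,dx+\frac12\int_{\mathbb{R}^3}|h|^2\,dx,&\text{if }(m,h)\in\mathcal{U}_0,\\ \infty,&\text{otherwise,}\end{cases}$$ where $\mathcal{U}_0$ is the set of all $(m,h)\in W^{1,2}(\Omega_1;\mathbb{R}^3)\times L^2(\mathbb{R}^3;\mathbb{R}^3)$ such that $$\partial_3(m_3+h_3)=0,\quad \partial_3h_2=0,\quad \partial_3h_1=0,\quad \partial_1h_2-\partial_2h_1=0\quad\text{in }\mathbb{R}^3,$$ $\partial_3m=0$ in $\Omega_1$, and $|m|=m_s$ a.e. in $\Omega_1$. Moreover, compactness holds in the weak topology of $W^{1,2}(\Omega_1;\mathbb{R}^3)\times L^2(\mathbb{R}^3;\mathbb{R}^3)$: if $\varepsilon_j\to0^+$ and $F_{\varepsilon_j}[m_{\varepsilon_j},h_{\varepsilon_j}]\le C<\infty$ for all $j\in\mathbb{N}$, then a subsequence of $(m_{\varepsilon_j},h_{\varepsilon_j})_j$ converges weakly in $W^{1,2}(\Omega_1;\mathbb{R}^3)\times L^2(\mathbb{R}^3;\mathbb{R}^3)$.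
   Context: Let $\omega\subset\mathbb{R}^2$ be a bounded domain with $|\omega|=1$, and $\Omega_1=\omega\times(0,1)\subset\mathbb{R}^3$. Let $\alpha>0$, $m_s>0$, and let $\varphi:\mathbb{R}^3\to[0,\infty)$ be continuous and even. Write $\nabla'=(\partial_1,\partial_2)^T$ and, for $\varepsilon>0$, $\nabla_\varepsilon=(\partial_1,\partial_2,\frac1\varepsilon\partial_3)^T$, $\mathrm{div}_\varepsilon=\nabla_\varepsilon\cdot$, $\mathrm{curl}_\varepsilon=\nabla_\varepsilon\times$. All differential operators and derivatives are understood in the sense of distributions; in equations on $\mathbb{R}^3$ a function $m:\Omega_1\to\mathbb{R}^3$ is identified with its extension by zero to $\mathbb{R}^3$. For $\varepsilon>0$ let $\mathcal{U}_\varepsilon$ be the set of all $(m,h)\in W^{1,2}(\Omega_1;\mathbb{R}^3)\times L^2(\mathbb{R}^3;\mathbb{R}^3)$ with $\mathrm{div}_\varepsilon(m+h)=0$ and $\mathrm{curl}_\varepsilon h=0$ in $\mathbb{R}^3$, and $|m|=m_s$ a.e. in $\Omega_1$. Define on $W^{1,2}(\Omega_1;\mathbb{R}^3)\times L^2(\mathbb{R}^3;\mathbb{R}^3)$ $$F_\varepsilon[m,h]=\int_{\Omega_1}\alpha|\nabla_\varepsilon m|^2+\varphi(m)\,dx+\frac12\int_{\mathbb{R}^3}|h|^2\,dx\ \text{ if }(m,h)\in\mathcal{U}_\varepsilon,\qquad F_\varepsilon[m,h]=\infty\ \text{ otherwise.}$$ That $F_0$ is the $\Gamma$-limit of $F_\varepsilon$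 with respect to weak convergence means, for all sequences $\varepsilon_j\to0^+$ and all $(m,h)$ in $W^{1,2}(\Omega_1;\mathbb{R}^3)\times L^2(\mathbb{R}^3;\mathbb{R}^3)$: (1) whenever $m_j\rightharpoonup m$ in $W^{1,2}(\Omega_1;\mathbb{R}^3)$ and $h_j\rightharpoonup h$ in $L^2(\mathbb{R}^3;\mathbb{R}^3)$, then $\liminf_{j\to\infty}F_{\varepsilon_j}[m_j,h_j]\ge F_0[m,h]$; (2) there exist $m_j\rightharpoonup m$ in $W^{1,2}(\Omega_1;\mathbb{R}^3)$ and $h_j\rightharpoonup h$ in $L^2(\mathbb{R}^3;\mathbb{R}^3)$ with $\lim_{j\to\infty}F_{\varepsilon_j}[m_j,h_j]=F_0[m,h]$. *)

(* Defs.v *)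
From HB Require Import structures.
From mathcomp Require Export all_boot all_order all_algebra.
From mathcomp Require Export all_classical all_reals all_analysis.
Export Order.TTheory GRing.Theory Num.Theory.
Export numFieldNormedType.Exports.

Set Implicit Arguments.
Unset Strict Implicit.
Unset Printing Implicit Defensive.

Local Open Scope classical_set_scope.
Local Open Scope ring_scope.

(* One type serves for the points of R^3 and for vector values. Its canonical
   norm is the sup norm; the Euclidean norm is [enorm]. *)
Notation R3 R := (R * R * R)%type.

Definition i1 : 'I_3 := @Ordinal 3 0 isT.
Definition i2 : 'I_3 := @Ordinal 3 1 isT.
Definition i3 : 'I_3 := @Ordinal 3 2 isT.

Section Space.
Context {R : realType}.
Implicit Types (U : set (R3 R)) (f g : R3 R -> R) (u v : R3 R -> R3 R).

Definition coord (i : 'I_3) (x : R3 R) : R := [:: x.1.1; x.1.2; x.2]`_i.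

Definition evec (i : 'I_3) : R3 R :=
  ((i == i1)%:R, (i == i2)%:R, (i == i3)%:R).

Definition enorm (x : R3 R) : R := Num.sqrt (\sum_(i < 3) coord i x ^+ 2).

Definition component v (i : 'I_3) : R3 R -> R := fun x => coord i (v x).

(* Lebesgue measure on the Borel sets of R^2 and R^3. *)
Definition leb2 :
    set (measurableTypeR R * measurableTypeR R)%type -> \bar R :=
  (@lebesgue_measure R \x @lebesgue_measure R)%E.
HB.instance Definition _ := Measure.on leb2.

Definition leb3 :
    set (measurableTypeR R * measurableTypeR R * measurableTypeR R)%type ->
    \bar R :=
  (leb2 \x @lebesgue_measure R)%E.
HB.instance Definition _ := Measure.on leb3.

Fixpoint iter_partial (s : seq 'I_3) f : R3 R -> R :=
  if s is i :: s' then fun x => 'D_(evec i) (iter_partial s' f) x else f.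

Definition smooth f := forall s : seq 'I_3,
  continuous (iter_partial s f) /\
  forall i x, derivable (iter_partial s f) x (evec i).

(* The test functions C_c^oo(U). *)
Definition test_function U : set (R3 R -> R) := [set f |
  [/\ smooth f, compact (closure [set x | f x != 0])
    & closure [set x | f x != 0] `<=` U]].

(* Distributions on U are handled as functionals on functions, of which only
   the values on [test_function U] matter; see [eq_distr]. *)
Definition distr := (R3 R -> R) -> R.

Definition regular_distr U f : distr :=
  fun eta => \int[leb3]_(x in U) (f x * eta x).

Definition distr_partial (i : 'I_3) (T : distr) : distr :=
  fun eta => - T (fun x => 'D_(evec i) eta x).

(* The distribution d_i f on U. *)
Definition fun_partial U (i : 'I_3) f : distr :=
  distr_partial i (regular_distr U f).

Definition eq_distr U (S T : distr) :=
  forall eta, test_function U eta -> S eta = T eta.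

(* The factor of the i-th partial derivative in nabla_eps. *)
Definition scale (eps : R) (i : 'I_3) : R := if i == i3 then eps^-1 else 1.

Definition partial_eps (eps : R) (i : 'I_3) v (k : 'I_3) : distr :=
  fun eta => scale eps i * fun_partial setT i (component v k) eta.

Definition div_eps (eps : R) v : distr :=
  fun eta => \sum_(i < 3) partial_eps eps i v i eta.

Definition curl_eps (eps : R) v (k : 'I_3) : distr := fun eta =>
  let d i j := partial_eps eps i v j eta in
  [:: d i2 i3 - d i3 i2; d i3 i1 - d i1 i3; d i1 i2 - d i2 i1]`_k.

(* A function on U is represented by a total function on R^3, whose values
   outside U are irrelevant; [f \_ U] is its extension by zero. *)
Definition L2 U : set (R3 R -> R) := [set f | (f \_ U) \in Lfun leb3 2%:E].

Definition L2vec U : set (R3 R -> R3 R) :=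
  [set v | forall k, L2 U (component v k)].

Definition L2norm U v : \bar R :=
  ((\int[leb3]_(x in U) (enorm (v x) ^+ 2)%:E) `^ 2^-1)%E.

Definition is_weak_partial U (i : 'I_3) f g :=
  eq_distr U (fun_partial U i f) (regular_distr U g).

Definition W12 U : set (R3 R -> R3 R) := [set v | L2vec U v /\
  forall i k, exists2 g, L2 U g & is_weak_partial U i (component v k) g].

(* A chosen L^2 representative of the weak derivative, which is unique up to
   null sets. *)
Definition weak_partial U (i : 'I_3) f : R3 R -> R :=
  get [set g | L2 U g /\ is_weak_partial U i f g].

(* |(w_1 d_1 v, w_2 d_2 v, w_3 d_3 v)|^2 in the Frobenius norm. *)
Definition grad_sq (w : 'I_3 -> R) U v (x : R3 R) : R :=
  \sum_(i < 3) \sum_(k < 3) (w i * weak_partial U i (component v k) x) ^+ 2.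

Definition W12norm U v : \bar R :=
  ((\int[leb3]_(x in U) (enorm (v x) ^+ 2 + grad_sq (fun=> 1) U v x)%:E)
     `^ 2^-1)%E.

End Space.

(* Weak convergence in the space V seminormed by N (finite on V): every bounded
   linear functional on V converges. Functions are not quotiented by a.e.
   equality, but boundedness makes a functional insensitive to it. *)
Definition weakly_cvg {R : realType} {X : lmodType R} (V : set X)
    (N : X -> \bar R) (u : nat -> X) (l : X) :=
  [/\ forall j, V (u j), V l
    & forall ell : X -> R,
        (forall a x y, V x -> V y -> ell (a *: x + y) = a * ell x + ell y) ->
        (exists C : R, forall x, V x -> (`|ell x|%:E <= C%:E * N x)%E) ->
        ell (u j) @[j --> \oo] --> ell l].

Section ThinFilm.
Context {R : realType}.
Implicit Types (omega : set (R * R)) (m h : R3 R -> R3 R).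
Implicit Types (F : (R3 R -> R3 R) -> (R3 R -> R3 R) -> \bar R).

Definition Omega1 omega : set (R3 R) := omega `*` `]0, 1[%classic.

Definition unit_domain omega :=
  [/\ open omega, connected omega, bounded_set omega & leb2 omega = 1%E].

Definition in_W12_L2 omega m h := W12 (Omega1 omega) m /\ L2vec setT h.

(* Weak convergence in W^{1,2}(Omega_1; R^3) x L^2(R^3; R^3). *)
Definition weakly_cvg_pair omega (m_ h_ : nat -> R3 R -> R3 R) m h :=
  weakly_cvg (W12 (Omega1 omega)) (W12norm (Omega1 omega)) m_ m /\
  weakly_cvg (L2vec setT) (L2norm setT) h_ h.

Definition saturated omega (ms : R) m :=
  {ae leb3, forall x, Omega1 omega x -> enorm (m x) = ms}.

Definition U_eps omega (ms eps : R) m h :=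
  [/\ in_W12_L2 omega m h,
      eq_distr setT (div_eps eps (m \_ (Omega1 omega) + h)) (fun=> 0),
      forall k, eq_distr setT (curl_eps eps h k) (fun=> 0)
    & saturated omega ms m].

Definition U_0 omega (ms : R) m h :=
  [/\ in_W12_L2 omega m h,
      [/\ eq_distr setT
            (fun_partial setT i3 (component (m \_ (Omega1 omega) + h) i3))
            (fun=> 0),
          eq_distr setT (fun_partial setT i3 (component h i2)) (fun=> 0),
          eq_distr setT (fun_partial setT i3 (component h i1)) (fun=> 0)
        & eq_distr setT
            (fun eta => fun_partial setT i1 (component h i2) eta
                      - fun_partial setT i2 (component h i1) eta) (fun=> 0)],
      forall k, eq_distr (Omega1 omega)
        (fun_partial (Omega1 omega) i3 (component m k)) (fun=> 0)
    & saturated omega ms m].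

Definition energy omega (alpha : R) (phi : R3 R -> R) (w : 'I_3 -> R) m h :=
  (\int[leb3]_(x in Omega1 omega)
      (alpha * grad_sq w (Omega1 omega) m x + phi (m x))%:E
   + 2^-1%:E * \int[leb3]_x (enorm (h x) ^+ 2)%:E)%E.

Definition F_eps omega (alpha ms : R) (phi : R3 R -> R) (eps : R) m h :=
  if `[< U_eps omega ms eps m h >]
  then energy omega alpha phi (scale eps) m h else +oo%E.

(* The weights (1, 1, 0) turn the gradient into nabla'. *)
Definition F_0 omega (alpha ms : R) (phi : R3 R -> R) m h :=
  if `[< U_0 omega ms m h >]
  then energy omega alpha phi (fun i => (i != i3)%:R) m h else +oo%E.

Definition to_zero_pos (eps_ : nat -> R) :=
  (forall j, 0 < eps_ j) /\ eps_ j @[j --> \oo] --> (0 : R).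

Definition is_gamma_limit omega
    (F : R -> (R3 R -> R3 R) -> (R3 R -> R3 R) -> \bar R)
    (F0 : (R3 R -> R3 R) -> (R3 R -> R3 R) -> \bar R) :=
  forall eps_ m h, to_zero_pos eps_ -> in_W12_L2 omega m h ->
    (forall m_ h_ : nat -> R3 R -> R3 R,
       weakly_cvg_pair omega m_ h_ m h ->
       (F0 m h <= limn_einf (fun j => F (eps_ j) (m_ j) (h_ j)))%E) /\
    (exists m_ h_ : nat -> R3 R -> R3 R,
       weakly_cvg_pair omega m_ h_ m h /\
       F (eps_ j) (m_ j) (h_ j) @[j --> \oo] --> F0 m h).

End ThinFilm.

(* Main.v *)
Require Import Defs.
From mathcomp Require Import measurable_realfun lra ring.

(** Compactness. On saturated magnetizations the energy bounds [m] in [W^{1,2}]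
    and [h] in [L^2], uniformly in [eps] ([energy_bounds]). Both spaces are
    complete for a semi-inner product ([semi_hilbert_W12],
    [semi_hilbert_L2vec]), and bounded sequences in such spaces have weakly
    convergent subsequences ([sh_weak_compact]).

    Lower bound ([F_0_le], [liminf_inequality]). Along a sequence of bounded
    energy the term [eps^-2 |d_3 m|^2] forces [d_3 m = 0] in the limit. In the
    rescaled equations of magnetostatics the derivative across the film carries
    the factor [eps^-1]; multiplied by [eps], these equations become the limit
    equations ([limit_equations_cvg]). The constraint [|m| = ms] survives because
    [m_j] converges in square mean on every box inside the domain, by Rellich's
    theorem ([rellich_box], [saturated_weak_limit]). As [|m_j| = |m| = ms], the
    norms of [m_j] in [L^2] all agree with that of [m], so that the weak
    convergence in [L^2] is strong and the anisotropy energy converges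
    ([anisotropy_cvg]). The remaining terms of the energy are squares of norms,
    which are lower semicontinuous.

    Upper bound ([recovery_sequence]). Take [m_j = m], for which the gradient and
    anisotropy energies do not depend on [eps] because [d_3 m = 0], and let [h_j]
    be the field that [m] generates at [eps_j]. This field is minus the projection
    of [m] onto the fields without rescaled curl: since rescaled gradients are
    such fields ([curl_grad]), orthogonality to them is the divergence equation
    ([stray_field]). The [h_j] are bounded, and their weak limits solve the limit
    equations with the given [m]. Those determine the field, for a
    square-integrable function on [R^3] that does not depend on [x_3] vanishes
    ([partial_eq0]): [h_1 = h_2 = 0] and [h_3 = - m_3]. Hence the whole sequence
    converges weakly to [h]. By the projection property [|h_j|^2] is minus the
    inner product of [m] and [h_j], so that it converges to [|h|^2].

    Statements on functions are reduced to integrals over boxes. The test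
    functions are products of functions of one variable, among them
    approximations of the indicators of boxes, and a function whose integrals
    over boxes vanish is zero ([box_ae0]). The difference of the integrals over a
    box and its translate is controlled by a partial derivative
    ([translate_estimate]). Applied to the two halves of a box this bounds the
    coefficient of a Haar function, and repeated bisection yields the Poincare
    inequality ([poincare]) and then Rellich's theorem; applied to a long row of
    boxes it yields [partial_eq0]. *)

Set Implicit Arguments.
Unset Strict Implicit.
Unset Printing Implicit Defensive.

Local Open Scope classical_set_scope.
Local Open Scope ring_scope.

(** * Complete semi-inner-product spaces *)

Lemma sqrtr_le (R : realType) (a b : R) : 0 <= b -> a <= b ^+ 2 ->
  Num.sqrt a <= b.
Proof.
by move=> b0 ab; rewrite -[leRHS](ger0_norm b0) -[leRHS]sqrtr_sqr ler_wsqrtr.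
Qed.

Section SemiHilbert.
Context {R : realType} {X : lmodType R}.
Implicit Types (V W : set X) (B : X -> X -> R).

(** The form [B] may vanish on nonzero vectors, so that a space of functions
    needs no quotient by almost-everywhere equality. *)
Record semi_hilbert V B : Prop := SemiHilbert {
  sh_mem0 : V 0;
  sh_memL : forall a x y, V x -> V y -> V (a *: x + y);
  sh_sym : forall x y, V x -> V y -> B x y = B y x;
  sh_lin : forall a x y z, V x -> V y -> V z ->
    B (a *: x + y) z = a * B x z + B y z;
  sh_ge0 : forall x, V x -> 0 <= B x x;
  sh_complete : forall u : nat -> X, (forall n, V (u n)) ->
    (forall e, 0 < e -> exists N, forall m n, (N <= m)%N -> (N <= n)%N ->
      B (u m - u n) (u m - u n) < e) ->
    exists2 l, V l & B (u n - l) (u n - l) @[n --> \oo] --> 0 }.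

Variables (V : set X) (B : X -> X -> R) (VB : semi_hilbert V B).

Lemma sh_memD x y : V x -> V y -> V (x + y).
Proof. by move=> Vx Vy; rewrite -[x]scale1r; exact: (sh_memL VB). Qed.

Lemma sh_memZ a x : V x -> V (a *: x).
Proof. by move=> Vx; rewrite -[_ *: _]addr0; apply: (sh_memL VB) => //; exact: (sh_mem0 VB). Qed.

Lemma sh_memN x : V x -> V (- x).
Proof. by move=> Vx; rewrite -scaleN1r; exact: sh_memZ. Qed.

Lemma sh_memB x y : V x -> V y -> V (x - y).
Proof. by move=> Vx Vy; apply: sh_memD => //; exact: sh_memN. Qed.

Lemma sh_linr a x y z : V x -> V y -> V z ->
  B z (a *: x + y) = a * B z x + B z y.
Proof.
move=> Vx Vy Vz; have Vl := sh_memL VB a Vx Vy.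
by rewrite (sh_sym VB)// (sh_lin VB)// (sh_sym VB Vx Vz) (sh_sym VB Vy Vz).
Qed.

Lemma sh_Dl x y z : V x -> V y -> V z -> B (x + y) z = B x z + B y z.
Proof. by move=> Vx Vy Vz; rewrite -[x]scale1r (sh_lin VB)// mul1r scale1r. Qed.

Lemma sh_Bl x y z : V x -> V y -> V z -> B (x - y) z = B x z - B y z.
Proof.
by move=> Vx Vy Vz; rewrite addrC -scaleN1r (sh_lin VB)// mulN1r addrC.
Qed.

Lemma sh_Zl a x z : V x -> V z -> B (a *: x) z = a * B x z.
Proof.
move=> Vx Vz; have V0 := sh_mem0 VB.
have := sh_lin VB a Vx V0 Vz; have := sh_lin VB 1 V0 V0 Vz.
by rewrite scale1r !addr0 mul1r => E ->; lra.
Qed.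

Lemma sh_Br x y z : V x -> V y -> V z -> B z (x - y) = B z x - B z y.
Proof.
move=> Vx Vy Vz; rewrite (sh_sym VB) ?sh_Bl// ?(sh_sym VB Vz)//.
exact: sh_memB.
Qed.

Lemma sh_Zr a x z : V x -> V z -> B z (a *: x) = a * B z x.
Proof.
move=> Vx Vz; rewrite (sh_sym VB) ?sh_Zl// ?(sh_sym VB Vz)//.
exact: sh_memZ.
Qed.

Lemma sh_sqL a x y : V x -> V y ->
  B (a *: x + y) (a *: x + y) = a ^+ 2 * B x x + 2 * a * B x y + B y y.
Proof.
move=> Vx Vy; have Vl := sh_memL VB a Vx Vy.
by rewrite (sh_lin VB)// !sh_linr// (sh_sym VB Vy Vx); ring.
Qed.

Lemma sh_sqB x y : V x -> V y ->
  B (x - y) (x - y) = B x x - 2 * B x y + B y y.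
Proof.
move=> Vx Vy; rewrite addrC -scaleN1r sh_sqL// (sh_sym VB Vx Vy); ring.
Qed.

Lemma sh_CS x y : V x -> V y -> B x y ^+ 2 <= B x x * B y y.
Proof.
move=> Vx Vy.
have Q a : 0 <= a ^+ 2 * B x x + 2 * a * B x y + B y y.
  by rewrite -sh_sqL//; apply: (sh_ge0 VB); exact: (sh_memL VB).
have := sh_ge0 VB Vx; rewrite le_eqVlt => /predU1P[x0|xgt0].
  rewrite -x0 mul0r; have [->|n0] := eqVneq (B x y) 0; first by rewrite expr0n.
  (* for a null vector [x] the quadratic is affine, hence negative somewhere *)
  have := Q (- (B y y + 1) / (2 * B x y)).
  rewrite -x0 mulr0 add0r [X in X + _](_ : _ = - (B y y + 1)); first by lra.
  by field.
(* the minimum of the quadratic *)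
have := Q (- B x y / B x x).
rewrite [X in 0 <= X](_ : _ = B y y - B x y ^+ 2 / B x x); last first.
  by field; rewrite gt_eqF.
by rewrite subr_ge0 ler_pdivrMr// mulrC.
Qed.

Lemma sh_CS_sqrt x y : V x -> V y ->
  `|B x y| <= Num.sqrt (B x x) * Num.sqrt (B y y).
Proof.
move=> Vx Vy; rewrite -sqrtrM ?(sh_ge0 VB)// -sqrtr_sqr.
by apply: ler_wsqrtr; exact: sh_CS.
Qed.

Lemma sh_cvg_l (u : nat -> X) l y : (forall n, V (u n)) -> V l -> V y ->
  B (u n - l) (u n - l) @[n --> \oo] --> 0 -> B (u n) y @[n --> \oo] --> B l y.
Proof.
move=> Vu Vl Vy ul; apply/cvgrPdist_le => e e0.
have d0 : 0 < e ^+ 2 / (B y y + 1).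
  by rewrite divr_gt0 ?exprn_gt0// ltr_wpDl// (sh_ge0 VB).
move/cvgrPdist_le : ul => /(_ _ d0); apply: filterS => n.
have Vd := sh_memB (Vu n) Vl.
rewrite sub0r normrN ger0_norm ?(sh_ge0 VB)// => h.
rewrite distrC -sh_Bl// -(@ler_pXn2r _ 2) ?nnegrE// ?(ltW e0)//.
rewrite real_normK ?num_real//; apply: (le_trans (sh_CS Vd Vy)).
have By := sh_ge0 VB Vy.
apply: (le_trans (ler_wpM2r By h)).
rewrite -mulrA ler_piMr ?exprn_ge0 ?(ltW e0)//.
by rewrite mulrC ler_pdivrMr ?mul1r; lra.
Qed.

(** A sequence that minimizes the distance is Cauchy by the parallelogram
    identity; its limit is the orthogonal projection. *)
Lemma sh_proj W x : W `<=` V -> W 0 ->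
  (forall a y z, W y -> W z -> W (a *: y + z)) ->
  (forall (u : nat -> X) l, (forall n, W (u n)) -> V l ->
    B (u n - l) (u n - l) @[n --> \oo] --> 0 -> W l) ->
  V x -> exists2 p, W p & forall w, W w -> B (x - p) w = 0.
Proof.
move=> WV W0 WL Wcl Vx.
pose D := [set B (x - w) (x - w) | w in W].
have D0 : has_inf D.
  split; first by exists (B (x - 0) (x - 0)), 0.
  exists 0 => _ [w Ww <-]; apply: (sh_ge0 VB); apply: sh_memB => //; exact: WV.
have lbD w : W w -> inf D <= B (x - w) (x - w).
  by move=> Ww; apply: ge_inf; [exact: D0.2 | exists w].
have /choice[u uP] : forall n : nat, exists w,
    W w /\ B (x - w) (x - w) < inf D + n.+1%:R^-1.
  move=> n; have n0 : 0 < n.+1%:R^-1 :> R by rewrite invr_gt0.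
  have [_ [w Ww <-] h] := inf_adherent n0 D0.
  by exists w.
have Wu n : W (u n) by case: (uP n).
have Vu n : V (u n) by exact: WV.
have Vxu n : V (x - u n) by exact: sh_memB.
have para m n : B (u m - u n) (u m - u n) <= 2 * (m.+1%:R^-1 + n.+1%:R^-1).
  have Wh : W (2^-1 *: u m + 2^-1 *: u n).
    apply: (WL) => //; rewrite -[_ *: _]addr0; exact: (WL).
  have := lbD _ Wh.
  have -> : x - (2^-1 *: u m + 2^-1 *: u n) =
            2^-1 *: (x - u m) + 2^-1 *: (x - u n).
    rewrite [RHS]addrC !scalerBr [RHS]addrACA -scalerDl -opprD [X in _ - X]addrC.
    by rewrite (_ : 2^-1 + 2^-1 = 1 :> R) ?scale1r; [|lra].
  rewrite sh_sqL//; last exact: sh_memZ.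
  rewrite !sh_Zr// ?sh_Zl//; last exact: sh_memZ.
  have -> : u m - u n = (x - u n) - (x - u m) by rewrite opprB [RHS]addrC addrA subrK.
  rewrite (sh_sqB (Vxu n) (Vxu m)).
  have [_ hm] := uP m; have [_ hn] := uP n.
  rewrite (sh_sym VB (Vxu m) (Vxu n)) => hmid.
  move: (m.+1%:R^-1) (n.+1%:R^-1) hm hn => a b hm hn; lra.
have inv_small (e : R) : 0 < e -> exists N, forall m, (N <= m)%N -> m.+1%:R^-1 < e.
  move=> e0; have := @cvg_harmonic R => /cvgrPdist_lt /(_ _ e0)[N _ hN].
  exists N => m Nm; have := hN m Nm.
  by rewrite /= sub0r normrN ger0_norm// invr_ge0.
have [l Vl ul] : exists2 l, V l & B (u n - l) (u n - l) @[n --> \oo] --> 0.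
  apply: (sh_complete VB) => // e e0.
  have [N hN] := inv_small (e / 4) ltac:(lra).
  exists N => m n /hN hm /hN hn; apply: (le_lt_trans (para m n)).
  move: (m.+1%:R^-1) (n.+1%:R^-1) hm hn => a b hm hn; lra.
have Wl : W l by exact: (Wcl u).
exists l => // w Ww; have Vw := WV _ Ww; have Vxl := sh_memB Vx Vl.
have dl : B (x - l) (x - l) <= inf D.
  (* pass to the limit in B (x - u n) (x - l) *)
  have c1 : B (x - u n) (x - l) @[n --> \oo] --> B (x - l) (x - l).
    have -> : (fun n => B (x - u n) (x - l)) = (fun n => B x (x - l) - B (u n) (x - l)).
      by apply/funext => n; rewrite sh_Bl.
    by rewrite sh_Bl//; apply: cvgB; [exact: cvg_cst | exact: sh_cvg_l].
  have c2 : 2^-1 * (inf D + n.+1%:R^-1 + B (x - l) (x - l)) @[n --> \oo] -->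
      2^-1 * (inf D + 0 + B (x - l) (x - l)).
    apply: cvgM; first exact: cvg_cst.
    apply: cvgD; last exact: cvg_cst.
    by apply: cvgD; [exact: cvg_cst | exact: cvg_harmonic].
  have := ler_cvg_to c1 c2; rewrite addr0 => h.
  have {}h : B (x - l) (x - l) <= 2^-1 * (inf D + B (x - l) (x - l)).
    apply: h; near=> n; have [_ hn] := uP n.
    have : 0 <= B ((x - u n) - (x - l)) ((x - u n) - (x - l)).
      by apply: (sh_ge0 VB); exact: sh_memB.
    rewrite (sh_sqB (Vxu n) Vxl); move: (n.+1%:R^-1) hn => a hn; lra.
  lra.
have Q a : 0 <= a ^+ 2 * B w w - 2 * a * B (x - l) w.
  have /lbD : W (a *: w + l) by exact: WL.
  have -> : x - (a *: w + l) = (- a) *: w + (x - l).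
    by rewrite scaleNr opprD addrCA.
  rewrite sh_sqL// (sh_sym VB Vw Vxl) => h; have := le_trans dl h; lra.
apply/eqP; apply: contraT => n0.
set b := B (x - l) w in n0 Q *.
have Bw := sh_ge0 VB Vw.
(* the summand 1 covers null vectors [w] *)
have := Q (b / (B w w + 1)).
have -> : (b / (B w w + 1)) ^+ 2 * B w w - 2 * (b / (B w w + 1)) * b =
    - (b ^+ 2 * ((B w w + 2) / (B w w + 1) ^+ 2)).
  by field; rewrite gt_eqF//; lra.
rewrite oppr_ge0 leNgt mulr_gt0// ?exprn_even_gt0//.
by rewrite divr_gt0 ?exprn_gt0//; lra.
Unshelve. all: by end_near. Qed.

(** A vector orthogonal to the kernel of [ell], suitably scaled, represents [ell]. *)
Lemma sh_riesz (ell : X -> R) C :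
  (forall a x y, V x -> V y -> ell (a *: x + y) = a * ell x + ell y) ->
  (forall x, V x -> `|ell x| <= C * Num.sqrt (B x x)) ->
  exists2 y, V y & forall x, V x -> ell x = B x y.
Proof.
move=> lin bd; have V0 := sh_mem0 VB.
have ell0 : ell 0 = 0.
  have := lin 1 _ _ V0 V0; rewrite scale1r addr0 mul1r => E; lra.
have [all0|/existsNP[z /not_implyP[Vz lz]]] :=
    pselect (forall x, V x -> ell x = 0).
  exists 0 => // x Vx; rewrite all0// -(scale0r x) sh_Zr// mul0r//.
pose W := [set x | V x /\ ell x = 0].
have [||||p [Vp lp] hp] := @sh_proj W z _ _ _ _ Vz.
- by move=> x [].
- by split.
- move=> a x y [Vx x0] [Vy y0]; split; first exact: (sh_memL VB).
  by rewrite lin// x0 y0 mulr0 addr0.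
- move=> u l Wu Vl ul; split => //.
  have Vu n : V (u n) by case: (Wu n).
  apply/eqP; rewrite -normr_le0; apply/ler_addgt0Pl => e e0.
  have C0 : 0 < `|C| + 1 by rewrite ltr_wpDl.
  have e1 : 0 < (e / (`|C| + 1)) ^+ 2 by rewrite exprn_gt0 ?divr_gt0.
  move/cvgrPdist_lt : ul => /(_ _ e1)[N _ /(_ N (leqnn N))] /=.
  have Vd := sh_memB (Vu N) Vl.
  rewrite sub0r normrN ger0_norm ?(sh_ge0 VB)// => h.
  have : ell (u N - l) = - ell l.
    rewrite addrC -scaleN1r lin// mulN1r; case: (Wu N) => _ ->; lra.
  move/(congr1 Num.norm); rewrite normrN addr0 => <-.
  apply: (le_trans (bd _ Vd)).
  apply: (le_trans (y := (`|C| + 1) * Num.sqrt (B (u N - l) (u N - l)))).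
    by apply: ler_wpM2r; rewrite ?sqrtr_ge0//; have := ler_norm C; lra.
  rewrite mulrC -ler_pdivlMr//.
  by apply: sqrtr_le; [rewrite divr_ge0 ?ltW | exact: ltW].
pose n := z - p.
have Vn : V n by exact: sh_memB.
have ln : ell n = ell z.
  by rewrite /n addrC -scaleN1r lin// lp; lra.
have qn : 0 < B n n.
  rewrite lt_neqAle (sh_ge0 VB)// andbT; apply/eqP => E.
  have := bd _ Vn; rewrite -E sqrtr0 mulr0 ln normr_le0 => /eqP; exact: lz.
have lz' : ell z != 0 by apply/eqP.
exists ((ell n / B n n) *: n); first exact: sh_memZ.
move=> x Vx; rewrite sh_Zr//.
have := hp (- (ell x / ell n) *: n + x).
rewrite -/n sh_linr// (sh_sym VB Vn Vx) ln => E.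
have -> : B x n = ell x / ell z * B n n.
  apply/eqP; rewrite -subr_eq0; apply/eqP; rewrite -[RHS]E; first by ring.
  split; first exact: (sh_memL VB).
  by rewrite lin// ln mulNr divfK// addNr.
by field; rewrite lz' gt_eqF.
Qed.

Lemma subseq_ge (k : nat -> nat) : {homo k : i j / (i < j)%N} ->
  forall n, (n <= k n)%N.
Proof. by move=> kh; elim=> // n; move/leq_ltn_trans; apply; exact: kh. Qed.

Lemma subseq_cvg (T : Type) (u : nat -> T) (F : set_system T) (k : nat -> nat) :
  {homo k : i j / (i < j)%N} ->
  u n @[n --> \oo] `=>` F -> u (k n) @[n --> \oo] `=>` F.
Proof.
move=> kh ul A /ul[N _ NA]; exists N => // n /= Nn.
by apply: NA => /=; exact: (leq_trans Nn (subseq_ge kh n)).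
Qed.

Lemma diagonal_extraction (v : nat -> nat -> R) (M : nat -> R) :
  (forall i n, `|v i n| <= M i) ->
  exists2 k : nat -> nat, {homo k : i j / (i < j)%N} &
    forall i, cvgn (fun n => v i (k n)).
Proof.
move=> vM.
have step (s : nat -> nat) i : exists t : nat -> nat,
    {homo t : a b / (a < b)%N} /\ cvgn (fun n => v i (s (t n))).
  have : bounded_fun (fun n => v i (s n)).
    exists (M i); split; first exact: num_real.
    by move=> r Mr n _ /=; exact: (le_trans (vM i _) (ltW Mr)).
  move=> /bolzano_weierstrass[t tmono tcv]; exists t; split => //.
  by move=> a b ab; rewrite ltnNge; have := tmono b a; rewrite leEnat => ->; rewrite -ltnNge.
pose t s i := projT1 (cid (step s i)).
have th s i : {homo t s i : a b / (a < b)%N} by rewrite /t; case: cid => ? [].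
have tc s i : cvgn (fun n => v i (s (t s i n))) by rewrite /t; case: cid => ? [].
pose s := fix s i := if i is j.+1 then s j \o t (s j) j else id.
have sh i : {homo s i : a b / (a < b)%N}.
  by elim: i => [|i IH] a b ab //=; apply: IH; exact: th.
(* beyond rank i, the diagonal is extracted from s i *)
have sub i j : exists2 g : nat -> nat, {homo g : a b / (a < b)%N} &
    s (i + j)%N = s i \o g.
  elim: j => [|j [g gh E]]; first by exists id => //; rewrite addn0.
  exists (g \o t (s (i + j)%N) (i + j)%N).
    by move=> a b ab; apply: gh; exact: th.
  by rewrite addnS /= E.
exists (fun n => s n n) => [|i].
  apply: homo_ltn; first exact: ltn_trans.
  by move=> n /=; apply: (sh n); apply: (leq_trans _ (subseq_ge (th _ _) _)).
have /cvg_ex[l vl] := tc (s i) i.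
apply/cvg_ex; exists l => A /vl[N _ NA].
exists (maxn N i.+1) => // n /=; rewrite geq_max => /andP[Nn ni].
have [g gh E] := sub i.+1 (n - i.+1)%N; rewrite subnKC// in E.
rewrite E /=; apply: NA => /=; apply: (leq_trans Nn); exact: subseq_ge.
Qed.

(** The vectors [x] for which [B (u (k n)) x] converges form a closed subspace
    that contains every [u i]; what is orthogonal to it is orthogonal to the
    whole sequence, so this subspace is everything. *)
Lemma sh_weak_compact (u : nat -> X) K : (forall n, V (u n)) ->
  (forall n, B (u n) (u n) <= K) ->
  exists (k : nat -> nat) l, [/\ {homo k : i j / (i < j)%N}, V l &
    forall y, V y -> B (u (k n)) y @[n --> \oo] --> B l y].
Proof.
move=> Vu uK.
have K0 : 0 <= K by apply: le_trans (uK 0); exact: (sh_ge0 VB).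
have bd n y : V y -> `|B (u n) y| <= Num.sqrt K * Num.sqrt (B y y).
  move=> Vy; apply: (le_trans (sh_CS_sqrt (Vu n) Vy)).
  by apply: ler_wpM2r; rewrite ?sqrtr_ge0//; exact: ler_wsqrtr.
have [k kh kc] := @diagonal_extraction (fun i n => B (u n) (u i)) _
  (fun i n => bd n _ (Vu i)).
pose W := [set x | V x /\ cvgn (fun n => B (u (k n)) x)].
have allW x : V x -> W x.
  move=> Vx; have [||||p [Vp pc] hp] := @sh_proj W x _ _ _ _ Vx.
  - by move=> y [].
  - split; first exact: (sh_mem0 VB).
    rewrite (_ : (fun n => _) = fun=> 0); first exact: is_cvg_cst.
    apply/funext => n; rewrite -(scale0r 0) sh_Zr ?mul0r//; exact: (sh_mem0 VB).
  - move=> a y z [Vy yc] [Vz zc]; split; first exact: (sh_memL VB).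
    rewrite (_ : (fun n => _) = fun n => a * B (u (k n)) y + B (u (k n)) z).
      by apply: is_cvgD => //; apply: is_cvgM => //; exact: is_cvg_cst.
    by apply/funext => n; rewrite sh_linr.
  - move=> w l Ww Vl wl; split => //; apply/cauchy_cvgP/cauchy_exP => e e0.
    have Vw n : V (w n) by case: (Ww n).
    pose d := e / 3 / (Num.sqrt K + 1).
    have sK : 0 <= Num.sqrt K by rewrite sqrtr_ge0.
    have d0 : 0 < d by rewrite !divr_gt0//; lra.
    have d20 : 0 < d ^+ 2 by rewrite exprn_gt0.
    move/cvgrPdist_lt : wl => /(_ _ d20)[N _ /(_ N (leqnn N))] /=.
    have Vd := sh_memB (Vw N) Vl.
    rewrite sub0r normrN ger0_norm ?(sh_ge0 VB)// => h.
    have [_ /cvg_ex[c wc]] := Ww N.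
    have near n : `|B (u n) (w N) - B (u n) l| < e / 3.
      rewrite -sh_Br//; apply: (le_lt_trans (bd _ _ Vd)).
      apply: (@le_lt_trans _ _ (Num.sqrt K * d)).
        by apply: ler_wpM2l => //; apply: sqrtr_le; exact: ltW.
      rewrite /d mulrA ltr_pdivrMr; last by lra.
      by rewrite mulrDr mulr1 mulrC ltrDl; lra.
    exists c; have e3 : 0 < e / 3 by lra.
    move/cvgrPdist_lt : wc => /(_ _ e3) [M _ hM]; exists M => // n /= Mn.
    have := hM n Mn => /= h1; have h2 := near (k n).
    rewrite /ball /= /ball_ (_ : c - _ = (c - B (u (k n)) (w N)) + (B (u (k n)) (w N) - B (u
        (k n)) l)).
      by apply: (le_lt_trans (ler_normD _ _)); lra.
    by ring.
  split => //; rewrite (_ : (fun n => _) = fun n => B (u (k n)) p)//.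
  apply/funext => n.
  have := hp (u (k n)) (conj (Vu _) (kc (k n))).
  rewrite sh_Bl// (sh_sym VB Vx (Vu _)) (sh_sym VB Vp (Vu _)) => E; lra.
have [||l Vl hl] := @sh_riesz (fun x => limn (fun n => B (u (k n)) x))
   (Num.sqrt K).
- move=> a x y /allW[Vx xc] /allW[Vy yc].
  rewrite (_ : (fun n => B (u (k n)) (a *: x + y)) =
    fun n => a * B (u (k n)) x + B (u (k n)) y); last first.
    by apply/funext => n; rewrite sh_linr.
  apply: cvg_lim => //; apply: cvgD => //; apply: cvgM => //; exact: cvg_cst.
- move=> x /allW[Vx xc]; rewrite -lim_norm//.
  apply: limr_le; first exact: is_cvg_norm.
  by near=> n; exact: bd.
exists k, l; split => // y Vy; have [_ yc] := allW _ Vy.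
by rewrite (sh_sym VB Vl Vy) -hl.
Unshelve. all: by end_near. Qed.

(** By Riesz representation it suffices to test weak convergence with inner
    products. *)
Lemma sh_weakly_cvgP (N : X -> \bar R) (u : nat -> X) l :
  (forall x, V x -> N x = (Num.sqrt (B x x))%:E) ->
  weakly_cvg V N u l <-> [/\ forall j, V (u j), V l &
    forall y, V y -> B (u j) y @[j --> \oo] --> B l y].
Proof.
move=> NE; split=> [[Vu Vl ul]|[Vu Vl ul]]; split => //.
  move=> y Vy; apply: (ul (fun x => B x y)) => [a x z Vx Vz|].
    by rewrite (sh_lin VB).
  exists (Num.sqrt (B y y)) => x Vx.
  by rewrite NE// -EFinM lee_fin mulrC; exact: sh_CS_sqrt.
move=> ell lin [C bd].
have [||y Vy hy] := @sh_riesz ell C => //.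
  by move=> x Vx; have := bd x Vx; rewrite NE// -EFinM lee_fin.
rewrite hy// (_ : (fun j => _) = fun j => B (u j) y); first exact: ul.
by apply/funext => j; rewrite hy.
Qed.

(** The Radon-Riesz property. *)
Lemma sh_cvg_norm (u : nat -> X) l : (forall n, V (u n)) -> V l ->
  B (u n) l @[n --> \oo] --> B l l ->
  B (u n) (u n) @[n --> \oo] --> B l l ->
  B (u n - l) (u n - l) @[n --> \oo] --> 0.
Proof.
move=> Vu Vl c1 c2.
rewrite (_ : (fun n => _) = fun n => B (u n) (u n) - 2 * B (u n) l + B l l); last first.
  by apply/funext => n; rewrite sh_sqB.
rewrite (_ : nbhs 0 = nbhs (B l l - 2 * B l l + B l l)); last by congr nbhs; ring.
apply: cvgD; last exact: cvg_cst.
by apply: cvgB => //; apply: cvgM => //; exact: cvg_cst.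
Qed.

Lemma sh_sqB_le x y : V x -> V y -> B (x - y) (x - y) <= 2 * B x x + 2 * B y y.
Proof.
move=> Vx Vy; have := sh_ge0 VB (sh_memL VB 1 Vx Vy).
by rewrite sh_sqL// sh_sqB//; lra.
Qed.

(** The nonnegativity of [B (x - y) (x - y)] as a lower bound for [B x x] that
    is affine in [x], hence continuous for weak convergence. *)
Lemma sh_tangent x y : V x -> V y -> 2 * B x y - B y y <= B x x.
Proof. by move=> Vx Vy; have := sh_ge0 VB (sh_memB Vx Vy); rewrite sh_sqB//; lra. Qed.

Lemma sh_cvg_sq (u : nat -> X) l : (forall n, V (u n)) -> V l ->
  B (u n - l) (u n - l) @[n --> \oo] --> 0 -> B (u n) (u n) @[n --> \oo] --> B l l.
Proof.
move=> Vu Vl c0; have c1 := sh_cvg_l Vu Vl Vl c0.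
have -> : (fun n => B (u n) (u n)) = fun n => B (u n - l) (u n - l) + 2 * B (u n) l - B l l.
  by apply/funext => n; rewrite sh_sqB//; ring.
have c2 : B (u n - l) (u n - l) + 2 * B (u n) l - B l l @[n --> \oo] -->
    0 + 2 * B l l - B l l.
  apply: cvgB; last exact: cvg_cst.
  by apply: cvgD => //; apply: cvgM => //; exact: cvg_cst.
by apply: cvg_trans c2 _; rewrite (_ : _ - _ = B l l)//; ring.
Qed.

End SemiHilbert.

(** * Square-integrable functions *)

Lemma limn_einfE (R : realType) (u : (\bar R)^nat) :
  limn_einf u = ereal_sup (range (einfs u)).
Proof. by rewrite limn_einf_lim; apply: cvg_lim => //; exact: cvg_einfs_sup. Qed.

Lemma cvg_sumr (R : realType) (J : Type) (r : seq J) (f : J -> nat -> R)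
    (l : J -> R) : (forall j, f j n @[n --> \oo] --> l j) ->
  \sum_(j <- r) f j n @[n --> \oo] --> \sum_(j <- r) l j.
Proof.
move=> fl; elim: r => [|j r IH].
  rewrite big_nil (_ : (fun n => _) = fun=> 0); first exact: cvg_cst.
  by apply/funext => n; rewrite big_nil.
rewrite big_cons (_ : (fun n => _) = fun n => f j n + \sum_(j <- r) f j n).
  exact: cvgD.
by apply/funext => n; rewrite big_cons.
Qed.

Section SquareIntegrable.
Context d {T : measurableType d} {R : realType}.
Variable mu : {measure set T -> \bar R}.
Implicit Types f g h : T -> R.

Definition sqint : set (T -> R) := [set f : T -> R | measurable_fun setT f /\
  mu.-integrable setT (EFin \o (fun x => f x ^+ 2))].

Definition dot f g : R := \int[mu]_x (f x * g x).

Lemma sqint_Lfun f : sqint f <-> f \in Lfun mu 2%:E.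
Proof.
split=> [[mf if2]|fL]; last first.
  by split; [exact: set_mem (sub_Lfun_mfun fL) | exact: Lfun2_integrable_sqr].
rewrite inE; apply/andP; split; first by rewrite inE.
rewrite inE /finite_norm unlock /=; apply: poweR_lty.
rewrite (_ : (fun x => _) = fun x => (f x ^+ 2)%:E); last first.
  by apply/funext => x; rewrite /= powR_mulrn// real_normK ?num_real.
have /integrableP[_] := if2; rewrite -[X in (X < _)%E -> _]/(\int[mu]_x _)%E.
by under eq_integral do rewrite /= ger0_norm ?sqr_ge0//.
Qed.

Lemma sqint_mul f g : sqint f -> sqint g ->
  mu.-integrable setT (EFin \o (fun x => f x * g x)).
Proof.
move=> [mf if2] [mg ig2].
have := integrableD measurableT if2 ig2; apply: le_integrable => //.
  by apply/measurable_EFinP; exact: measurable_funM.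
move=> x _; rewrite /= lee_fin [leRHS]ger0_norm ?addr_ge0 ?sqr_ge0//.
have := sqr_ge0 (`|f x| - `|g x|); have := sqr_ge0 (`|f x|); have := sqr_ge0 (`|g x|).
rewrite sqrrB !real_normK ?num_real// normrM; lra.
Qed.

Lemma sqint0 : sqint (fun=> 0).
Proof.
split; first exact: measurable_cst.
rewrite (_ : _ \o _ = cst 0%E); first exact: integrable0.
by apply/funext => x; rewrite /= expr0n.
Qed.

Lemma sqintL a f g : sqint f -> sqint g -> sqint (fun x => a * f x + g x).
Proof.
move=> sf sg; have [[mf if2] [mg ig2]] := (sf, sg).
split; first by apply: measurable_funD => //; exact: measurable_funM.
have i1 := integrableD measurableT
  (integrableZl measurableT (a ^+ 2) if2)
  (integrableD measurableT (integrableZl measurableT (2 * a) (sqint_mul sf sg)) ig2).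
apply: eq_integrable i1 => // x _; rewrite /= -!EFinM -!EFinD; congr EFin; ring.
Qed.

Lemma sqintZ a f : sqint f -> sqint (fun x => a * f x).
Proof.
move=> sf; have := sqintL a sf sqint0.
by under eq_fun do rewrite addr0.
Qed.

Lemma sqintD f g : sqint f -> sqint g -> sqint (fun x => f x + g x).
Proof.
move=> sf sg; have := sqintL 1 sf sg.
by under eq_fun do rewrite mul1r.
Qed.

Lemma sqintB f g : sqint f -> sqint g -> sqint (fun x => f x - g x).
Proof.
move=> sf sg; have := sqintL (-1) sg sf.
by under eq_fun do rewrite mulN1r addrC.
Qed.

Lemma dotC f g : dot f g = dot g f.
Proof. by rewrite /dot; under eq_Rintegral do rewrite mulrC. Qed.

Lemma dotL a f g h : sqint f -> sqint g -> sqint h ->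
  dot (fun x => a * f x + g x) h = a * dot f h + dot g h.
Proof.
move=> sf sg sh; rewrite /dot -RintegralZl//; last exact: sqint_mul.
rewrite -RintegralD//; last exact: sqint_mul.
  by apply: eq_Rintegral => x _; rewrite mulrDl mulrA.
by apply: eq_integrable (integrableZl measurableT (a) (sqint_mul sf sh)).
Qed.

Lemma dot0r f : dot f (fun=> 0) = 0.
Proof. by rewrite /dot; under eq_Rintegral do rewrite mulr0; rewrite Rintegral_cst// mul0r. Qed.

Lemma dot_ge0 f : 0 <= dot f f.
Proof. by apply: Rintegral_ge0 => x _; exact: sqr_ge0. Qed.

Lemma dotB f g h : sqint f -> sqint g -> sqint h ->
  dot (fun x => f x - g x) h = dot f h - dot g h.
Proof.
move=> sf sg sh; rewrite /dot -RintegralB//; [|exact: sqint_mul|exact: sqint_mul].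
by apply: eq_Rintegral => x _; rewrite mulrBl.
Qed.

Lemma sqint_dot f : sqint f ->
  (\int[mu]_x (f x ^+ 2)%:E = (dot f f)%:E)%E.
Proof. by move=> sf; rewrite /dot /Rintegral fineK// integrable_fin_num//; exact: sqint_mul. Qed.

Lemma sqint_bounded f K : measurable_fun setT f ->
  (\int[mu]_x (f x ^+ 2)%:E <= K%:E)%E -> sqint f /\ dot f f <= K.
Proof.
move=> mf fK.
have sf : sqint f.
  split => //; apply/integrableP; split.
    by apply/measurable_EFinP; exact: measurable_funX.
  apply: (@le_lt_trans _ _ K%:E); last exact: ltry.
  by under eq_integral do rewrite /= ger0_norm ?sqr_ge0//.
by split=> //; rewrite -lee_fin -sqint_dot.
Qed.

Lemma Rintegral_ae_eq (D : set T) f g : measurable D ->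
  measurable_fun D f -> measurable_fun D g ->
  {ae mu, forall x, D x -> f x = g x} ->
  \int[mu]_(x in D) f x = \int[mu]_(x in D) g x.
Proof.
move=> mD mf mg fg; rewrite /Rintegral; congr fine.
apply: ae_eq_integral => //; [exact/measurable_EFinP|exact/measurable_EFinP|].
by apply: filterS fg => x h /h ->.
Qed.

Lemma dot_ae_eq f f' g : measurable_fun setT f -> measurable_fun setT f' ->
  measurable_fun setT g -> {ae mu, forall x, f x = f' x} ->
  dot f g = dot f' g.
Proof.
move=> mf mf' mg ff'; apply: Rintegral_ae_eq => //; try exact: measurable_funM.
by apply: filterS ff' => x ->.
Qed.

(** The function [\sum_k 4^k (v k.+1 - v k)^2] is integrable, and where it is
    finite the increments are bounded by a multiple of [2^-k]. *)
Lemma ae_cvg_of_fast (v : nat -> T -> R) : (forall k, sqint (v k)) ->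
  (forall k, dot (fun x => v k.+1 x - v k x) (fun x => v k.+1 x - v k x) <=
    8^-1 ^+ k) ->
  {ae mu, forall x, cvgn (fun k => v k x)}.
Proof.
move=> sv vk.
pose S x := (\sum_(0 <= k <oo) (4 ^+ k * (v k.+1 x - v k x) ^+ 2)%:E)%E.
have mt k : measurable_fun setT (fun x => (4 ^+ k * (v k.+1 x - v k x) ^+ 2)%:E).
  apply/measurable_EFinP; apply: measurable_funM => //; apply: measurable_funX.
  by apply: measurable_funB; [case: (sv k.+1) | case: (sv k)].
have t0 k x : (0 <= (4 ^+ k * (v k.+1 x - v k x) ^+ 2)%:E)%E.
  by rewrite lee_fin mulr_ge0 ?sqr_ge0 ?exprn_ge0.
have S0 x : (0 <= S x)%E by apply: nneseries_ge0 => k _ _; exact: t0.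
have mS : measurable_fun setT S.
  by apply: ge0_emeasurable_sum => // k x _ _; exact: t0.
have iS : mu.-integrable setT S.
  apply/integrableP; split => //.
  under eq_integral do rewrite gee0_abs//.
  rewrite integral_nneseries//.
  apply: (@le_lt_trans _ _ (\sum_(0 <= k <oo) (geometric 1 2^-1 k)%:E)%E).
    apply: lee_nneseries => [k _ _|k _].
      by apply: integral_ge0 => x _; exact: t0.
    have sd := sqintB (sv k.+1) (sv k).
    under eq_integral do rewrite EFinM.
    rewrite ge0_integralZl//; last 2 first.
    - apply/measurable_EFinP; apply: measurable_funX.
      by apply: measurable_funB; [case: (sv k.+1) | case: (sv k)].
    - by move=> x _; rewrite lee_fin sqr_ge0.
    rewrite sqint_dot// -EFinM lee_fin /geometric /= mul1r.
    rewrite (_ : 2^-1 = 4 * 8^-1); last by lra.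
    by rewrite exprMn ler_wpM2l ?exprn_ge0.
  have /cvg_ex[l hl] : cvgn (series (geometric 1 (2^-1 : R))).
    by apply: is_cvg_geometric_series; rewrite ger0_norm//; lra.
  rewrite (_ : (\sum_(0 <= k <oo) _)%E = l%:E) ?ltry//.
  apply: cvg_lim => //; rewrite (_ : (fun n => _) = EFin \o series (geometric 1 2^-1)).
    by apply: cvg_EFin => //; exact: nearW.
  by apply/funext => n; rewrite /= /series /= sumEFin.
apply: filterS (integrable_ae measurableT iS) => x /(_ I) Sx.
pose c := fine (S x).
have c0 : 0 <= c by exact: fine_ge0.
have inc k : `|v k.+1 x - v k x| <= geometric (Num.sqrt c) 2^-1 k.
  rewrite /geometric /= -(@ler_pXn2r _ 2) ?nnegrE ?mulr_ge0 ?exprn_ge0 ?sqrtr_ge0//.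
  rewrite exprMn sqr_sqrtr// real_normK ?num_real// -exprM mulnC exprM.
  rewrite (_ : 2^-1 ^+ 2 = 4^-1); last by lra.
  rewrite exprVn ler_pdivlMr ?exprn_gt0// mulrC.
  rewrite -lee_fin (fineK Sx).
  apply: le_trans (nneseries_lim_ge k.+1 _) => //.
  rewrite big_nat_recr//= leeDr// sume_ge0// => i _; exact: t0.
have : cvgn (series (telescope (fun k => v k x))).
  apply: normed_cvg; apply: (series_le_cvg _ _ inc).
  - by move=> n /=.
  - by move=> n; rewrite /geometric /= mulr_ge0 ?sqrtr_ge0 ?exprn_ge0.
  - by apply: is_cvg_geometric_series; rewrite ger0_norm//; lra.
rewrite telescopeK => /cvg_ex[l hl]; apply/cvg_ex; exists (l + v 0%N x).
rewrite (_ : (fun k => _) = (fun k => (v k x - v 0%N x) + v 0%N x)).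
  by apply: cvgD => //; exact: cvg_cst.
by apply/funext => k; rewrite subrK.
Qed.

(** The Riesz-Fischer theorem. A fast subsequence converges almost everywhere,
    and Fatou's lemma bounds the distance of the whole sequence to the pointwise
    limit. *)
Lemma sqint_complete (u : nat -> T -> R) : (forall n, sqint (u n)) ->
  (forall e, 0 < e -> exists N, forall m n, (N <= m)%N -> (N <= n)%N ->
    dot (fun x => u m x - u n x) (fun x => u m x - u n x) < e) ->
  exists2 l, sqint l &
    dot (fun x => u n x - l x) (fun x => u n x - l x) @[n --> \oo] --> 0.
Proof.
move=> su cu.
have e8 (k : nat) : 0 < (8^-1 : R) ^+ k by rewrite exprn_gt0.
pose N k := projT1 (cid (cu _ (e8 k))).
have NP k m n : (N k <= m)%N -> (N k <= n)%N ->
    dot (fun x => u m x - u n x) (fun x => u m x - u n x) < 8^-1 ^+ k.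
  by rewrite /N; case: cid => /= ? h; exact: h.
pose s := fix s k := if k is j.+1 then maxn (s j).+1 (N j.+1) else N 0%N.
have sN k : (N k <= s k)%N by case: k => //= k; rewrite leq_maxr.
have sS k : (s k <= s k.+1)%N by rewrite /= (leq_trans (leqnSn _))// leq_maxl.
have sge k : (k <= s k)%N.
  by elim: k => // k IH; rewrite /= (leq_trans _ (leq_maxl _ _)).
pose v k := u (s k).
have vae := @ae_cvg_of_fast v (fun k => su _) (fun k => ltW (NP k _ _ (leq_trans (sN k) (sS k))
    (sN k))).
(* unlike the pointwise limit, the upper limit exists and is measurable everywhere *)
pose l x := fine (limn_esup (fun k => (v k x)%:E)).
have ml : measurable_fun setT l.
  apply: measurableT_comp; first exact: fine_measurable.
  by apply: measurable_fun_limn_esup => k; apply/measurable_EFinP; case: (su (s k)).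
have vl : {ae mu, forall x, v k x @[k --> \oo] --> l x}.
  apply: filterS vae => x /cvg_ex[c vc].
  suff -> : l x = c by [].
  have vcE : (v k x)%:E @[k --> \oo] --> c%:E.
    by apply: cvg_EFin => //; exact: nearW.
  by rewrite /l (cvg_limn_einf_sup vcE).2.
have tail e n : (exists K, forall m, (K <= m)%N ->
     dot (fun x => u m x - u n x) (fun x => u m x - u n x) <= e) ->
   sqint (fun x => l x - u n x) /\ dot (fun x => l x - u n x) (fun x => l x - u n x) <= e.
  move=> [K hK]; apply: sqint_bounded.
    by apply: measurable_funB => //; case: (su n).
  pose g k x := ((v k x - u n x) ^+ 2)%:E.
  have mg k : measurable_fun setT (g k).
    apply/measurable_EFinP; apply: measurable_funX.
    by apply: measurable_funB; [case: (su (s k)) | case: (su n)].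
  rewrite (_ : (\int[mu]_x _)%E = (\int[mu]_x limn_einf (g^~ x))%E); last first.
    apply: ae_eq_integral => //.
    - apply/measurable_EFinP; apply: measurable_funX.
      by apply: measurable_funB => //; case: (su n).
    - apply: (measurableT_comp (@oppe_measurable R setT)).
      apply: measurable_fun_limn_esup => k.
      exact: (measurableT_comp (@oppe_measurable R setT)).
    apply: filterS vl => x vlx _.
    have c : g k x @[k --> \oo] --> ((l x - u n x) ^+ 2)%:E.
      apply: cvg_EFin; first exact: nearW.
      rewrite /= (_ : _ \o _ = fun k => (v k x - u n x) * (v k x - u n x)); last first.
        by apply/funext => k; rewrite /= expr2.
      by rewrite expr2; apply: cvgM; apply: cvgB => //; exact: cvg_cst.
    by rewrite (cvg_limn_einf_sup c).1.
  apply: (le_trans (fatou mu measurableT mg _)) => [k x _|].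
    by rewrite lee_fin sqr_ge0.
  rewrite limn_einfE; apply: ge_ereal_sup => _ [k _ <-].
  pose j := maxn k K.
  apply: (@le_trans _ _ (\int[mu]_x g j x)%E).
    by apply: ereal_inf_lbound; exists j => //=; rewrite leq_maxl.
  rewrite sqint_dot; last by apply: sqintB; exact: su.
  rewrite lee_fin; apply: hK.
  apply: (leq_trans (leq_maxr k K)).
  exact: sge.
have near_l e : 0 < e -> exists K, forall n, (K <= n)%N ->
    sqint (fun x => l x - u n x) /\
    dot (fun x => l x - u n x) (fun x => l x - u n x) <= e.
  move=> e0; have [K hK] := cu e e0; exists K => n Kn; apply: tail.
  by exists K => m Km; exact/ltW/hK.
have [K hK] := near_l _ ltr01.
exists l.
  have [sd _] := hK _ (leqnn K).
  by have := sqintD sd (su K); congr sqint; apply/funext => x; rewrite subrK.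
apply/cvgrPdist_le => e e0; have [M hM] := near_l e e0.
exists M => // n /= Mn; rewrite sub0r normrN ger0_norm ?dot_ge0//.
have [_] := hM n Mn; congr (_ <= _); apply: eq_Rintegral => x _.
by rewrite -mulrNN !opprB.
Qed.

Lemma semi_hilbert_sqint : semi_hilbert sqint dot.
Proof.
split=> [|a x y sx sy|x y _ _|a x y z|x _|v sv cv] //.
- exact: sqint0.
- exact: sqintL.
- exact: dotC.
- exact: dotL.
- exact: dot_ge0.
- exact: sqint_complete.
Qed.

Lemma dot_CS f g : sqint f -> sqint g -> dot f g ^+ 2 <= dot f f * dot g g.
Proof. by move=> sf sg; exact: (sh_CS semi_hilbert_sqint). Qed.

(** Spaces such as [L^2(U; R^3)] and [W^{1,2}(U; R^3)] are given by finitely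
    many maps [L i] into square-integrable functions. These maps need to be
    linear only almost everywhere, as is the case for chosen representatives of
    weak derivatives. *)
Lemma semi_hilbert_of_maps (X : lmodType R) (V : set X) (I : finType)
    (L : I -> X -> T -> R) :
  V 0 -> (forall a x y, V x -> V y -> V (a *: x + y)) ->
  (forall i x, V x -> sqint (L i x)) ->
  (forall i a x y, V x -> V y ->
    {ae mu, forall t, L i (a *: x + y) t = a * L i x t + L i y t}) ->
  (forall (u : nat -> X) (g : I -> T -> R), (forall n, V (u n)) ->
    (forall i, sqint (g i)) ->
    (forall i, dot (fun t => L i (u n) t - g i t) (fun t => L i (u n) t - g i t)
       @[n --> \oo] --> 0) ->
    exists2 l, V l & forall i,
      dot (fun t => L i (u n) t - L i l t) (fun t => L i (u n) t - L i l t)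
        @[n --> \oo] --> 0) ->
  semi_hilbert V (fun x y => \sum_i dot (L i x) (L i y)).
Proof.
move=> V0 VL sL linL closed.
have mL i x : V x -> measurable_fun setT (L i x) by move=> /(sL i)[].
have VB x y : V x -> V y -> V (x - y).
  by move=> Vx Vy; rewrite addrC -scaleN1r; exact: VL.
have LB i x y : V x -> V y -> {ae mu, forall t, L i (x - y) t = L i x t - L i y t}.
  move=> Vx Vy; rewrite addrC -scaleN1r.
  by apply: filterS (linL i (-1) y x Vy Vx) => t ->; rewrite mulN1r addrC.
have dotLB i x y : V x -> V y -> dot (L i (x - y)) (L i (x - y)) =
    dot (fun t => L i x t - L i y t) (fun t => L i x t - L i y t).
  move=> Vx Vy; have Vxy := VB _ _ Vx Vy.
  have mB : measurable_fun setT (fun t => L i x t - L i y t).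
    by apply: measurable_funB; exact: mL.
  rewrite (dot_ae_eq (mL i _ Vxy) mB (mL i _ Vxy) (LB i _ _ Vx Vy)) dotC.
  exact: (dot_ae_eq (mL i _ Vxy) mB mB (LB i _ _ Vx Vy)).
split=> //.
- by move=> x y Vx Vy; apply: eq_bigr => i _; exact: dotC.
- move=> a x y z Vx Vy Vz; rewrite mulr_sumr -big_split /=; apply: eq_bigr => i _.
  rewrite -dotL; [|exact: sL|exact: sL|exact: sL].
  apply: dot_ae_eq; [by apply: mL; exact: VL| |exact: mL|exact: linL].
  by apply: measurable_funD; [apply: measurable_funM|]; rewrite //; exact: mL.
- by move=> x Vx; apply: sumr_ge0 => i _; exact: dot_ge0.
move=> u Vu cu.
have /choice[g gP] : forall i, exists g, sqint g /\
    dot (fun t => L i (u n) t - g t) (fun t => L i (u n) t - g t) @[n --> \oo] --> 0.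
  move=> i; have [|e e0|g sg gc] := @sqint_complete (fun n => L i (u n)).
  - by move=> n; exact: sL.
  - have [N hN] := cu e e0; exists N => m n Nm Nn.
    rewrite -dotLB//; apply: (le_lt_trans _ (hN m n Nm Nn)).
    by rewrite (bigD1 i)//= lerDl sumr_ge0// => j _; exact: dot_ge0.
  - by exists g.
have [l Vl lg] := closed u g Vu (fun i => (gP i).1) (fun i => (gP i).2).
exists l => //.
rewrite [X in _ --> X](_ : _ = \sum_(i : I) (0 : R)); last by rewrite big1.
apply: cvg_sumr => i.
rewrite (_ : (fun n => _) =
  (fun n => dot (fun t => L i (u n) t - L i l t) (fun t => L i (u n) t - L i l t))).
  exact: lg.
by apply/funext => n; rewrite dotLB.
Qed.

Lemma sqint_cvg_dot (u : nat -> T -> R) l g : (forall n, sqint (u n)) ->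
  sqint l -> sqint g ->
  dot (fun x => u n x - l x) (fun x => u n x - l x) @[n --> \oo] --> 0 ->
  dot (u n) g @[n --> \oo] --> dot l g.
Proof.
move=> su sl sg ul; exact: (sh_cvg_l semi_hilbert_sqint).
Qed.

End SquareIntegrable.

(** * Boxes in R^3 *)

(** The measurable space on which [leb3] is defined. The product structure that
    type inference finds on [R3 R] has another display. *)
Notation T3 R := (measurableTypeR R * measurableTypeR R * measurableTypeR R)%type.
Notation mset3 A := (@measurable _ (T3 _) A).
Notation mfun3 f := (@measurable_fun _ _ (T3 _) _ setT f).

#[global] Instance ae_leb3_filter (R : realType) :
  Filter (almost_everywhere (@leb3 R)).
Proof. exact: (ae_filter_ringOfSetsType (@leb3 R)). Qed.

Section Boxes.
Context {R : realType}.
Implicit Types (a b x y : R3 R) (i j : 'I_3) (U : set (R3 R)).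

Lemma I3P (P : 'I_3 -> Prop) : P i1 -> P i2 -> P i3 -> forall i, P i.
Proof.
move=> P1 P2 P3 [[|[|[|//]]] h].
- by rewrite (_ : Ordinal h = i1)//; exact: val_inj.
- by rewrite (_ : Ordinal h = i2)//; exact: val_inj.
- by rewrite (_ : Ordinal h = i3)//; exact: val_inj.
Qed.

Lemma big_I3 (V : nmodType) (F : 'I_3 -> V) : \sum_i F i = F i1 + F i2 + F i3.
Proof.
rewrite !big_ord_recr big_ord0 /= add0r; congr (F _ + F _ + F _); exact: val_inj.
Qed.

Lemma prod_I3 (F : 'I_3 -> R) : \prod_i F i = F i1 * F i2 * F i3.
Proof.
rewrite !big_ord_recr big_ord0 /= mul1r; congr (F _ * F _ * F _); exact: val_inj.
Qed.

Lemma coordD i x y : coord i (x + y) = coord i x + coord i y.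
Proof. by elim/I3P : i. Qed.

Lemma coordN i x : coord i (- x) = - coord i x.
Proof. by elim/I3P : i. Qed.

Lemma coordB i x y : coord i (x - y) = coord i x - coord i y.
Proof. by rewrite coordD coordN. Qed.

Lemma coordZ i (t : R) x : coord i (t *: x) = t * coord i x.
Proof. by elim/I3P : i. Qed.

Lemma coord_evec i j : coord j (evec i : R3 R) = (j == i)%:R.
Proof. by move: i j; elim/I3P; elim/I3P. Qed.

Lemma coord_inj x y : (forall i, coord i x = coord i y) -> x = y.
Proof.
move: x y => [[x1 x2] x3] [[y1 y2] y3] h.
by have := (h i1, h i2, h i3); rewrite /coord /= => -[[-> ->] ->].
Qed.

Lemma coord_archi x : exists N : nat, forall j, `|coord j x| < N%:R.
Proof.
pose S := `|coord i1 x| + `|coord i2 x| + `|coord i3 x|.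
have S0 : 0 <= S by rewrite !addr_ge0.
exists (Num.bound S) => j; apply: (le_lt_trans _ (archi_boundP S0)); rewrite /S.
by elim/I3P : j; have := normr_ge0 (coord i1 x); have := normr_ge0 (coord i2 x);
  have := normr_ge0 (coord i3 x); lra.
Qed.

Definition pt (f : 'I_3 -> R) : R3 R := (f i1, f i2, f i3).

Lemma coord_pt f i : coord i (pt f) = f i.
Proof. by elim/I3P : i. Qed.

Definition setc i (t : R) x : R3 R := pt (fun j => if j == i then t else coord j x).

Lemma coord_setc i t x j : coord j (setc i t x) = if j == i then t else coord j x.
Proof. by rewrite coord_pt. Qed.

(** Boxes are half-open, so that bisection gives an exact partition. *)
Definition box a b : set (R3 R) :=
  [set x | forall i, coord i a < coord i x <= coord i b].

Definition vol a b : R := \prod_i (coord i b - coord i a).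

Lemma box_prod a b : box a b =
  (`]a.1.1, b.1.1] `*` `]a.1.2, b.1.2] `*` `]a.2, b.2])%classic.
Proof.
apply/seteqP; split=> [x xab|x /= [[h1 h2] h3]].
  by rewrite /= !in_itv /=; split; [split; [have := xab i1 | have := xab i2] | have := xab i3].
by elim/I3P; move: h1 h2 h3; rewrite /= !in_itv.
Qed.

Lemma measurable_box a b : mset3 (box a b).
Proof.
by rewrite box_prod; apply: measurableX; [apply: measurableX|]; exact: measurable_itv.
Qed.

Lemma leb3_box a b : (forall i, coord i a <= coord i b) ->
  leb3 (box a b) = (vol a b)%:E.
Proof.
move=> ab; rewrite box_prod /leb3.
rewrite product_measure1E; [|by apply: measurableX; exact: measurable_itv|exact: measurable_itv].
rewrite [X in (X * _)%E](_ : _ = (lebesgue_measure `]a.1.1, b.1.1]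
    * lebesgue_measure `]a.1.2, b.1.2])%E); last first.
  by rewrite [LHS]product_measure1E//; exact: measurable_itv.
have E (s t : R) : s <= t -> lebesgue_measure `]s, t]%classic = (t - s)%:E.
  move=> st; rewrite lebesgue_measure_itv /= lte_fin; case: ltP => //.
  by move=> ts; rewrite (_ : s = t) ?subrr//; apply/eqP; rewrite eq_le st.
rewrite (E _ _ (ab i1)) (E _ _ (ab i2)) [X in (_ * X)%E](_ : _ = (b.2 - a.2)%:E); last first.
  exact: (E _ _ (ab i3)).
by rewrite -!EFinM /vol prod_I3.
Qed.

Lemma box_empty a b i : coord i b <= coord i a -> box a b = set0.
Proof.
move=> ba; apply/seteqP; split => // x /(_ i) /andP[h1 h2].
by have := lt_le_trans h1 (le_trans h2 ba); rewrite ltxx.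
Qed.

Lemma leb3_box_fin a b : (leb3 (box a b) < +oo)%E.
Proof.
have [/forallP ab|/forallPn[i]] := boolP [forall i, coord i a <= coord i b].
  by rewrite leb3_box ?ltry.
by rewrite -ltNge => /ltW/box_empty ->; rewrite measure0 ltry.
Qed.

Lemma boxI a b a' b' : box a b `&` box a' b' =
  box (pt (fun i => Num.max (coord i a) (coord i a')))
      (pt (fun i => Num.min (coord i b) (coord i b'))).
Proof.
apply/seteqP; split=> [x [xab xab'] i|x h].
  have /andP[h1 h2] := xab i; have /andP[h3 h4] := xab' i.
  by rewrite !coord_pt gt_max le_min h1 h2 h3 h4.
by split=> i; have := h i; rewrite !coord_pt gt_max le_min => /andP[/andP[h1 h2] /andP[h3 h4]];
    apply/andP.
Qed.

Definition boxes : set (set (R3 R)) := [set B | exists a b, B = box a b].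

Lemma boxes_setI : setI_closed boxes.
Proof. by move=> _ _ [a [b ->]] [a' [b' ->]]; rewrite boxI; do 2 eexists. Qed.

Lemma sigma_algebra_preimage_sub (S T : Type) (f : S -> T) (G : set (set S))
    (M : set (set T)) : (forall A, M A -> <<s G>> (f @^-1` A)) ->
  forall A, <<s M>> A -> <<s G>> (f @^-1` A).
Proof.
move=> MG.
suff : <<s M>> `<=` [set A | <<s G>> (f @^-1` A)] by [].
apply: smallest_sub => [|B MB]; last exact: MG.
have [G0 GC GU] := smallest_sigma_algebra setT G.
split => //= [B GB|F GF].
  have -> : f @^-1` (setT `\` B) = setT `\` (f @^-1` B) by [].
  exact: GC.
by rewrite preimage_bigcup; exact: GU.
Qed.

(** A slab [s < coord i x <= t] is a countable union of boxes, and slabs generate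
    the product sigma-algebra. *)
Lemma measurable_boxes : (@measurable _ (T3 R)) = <<s boxes>>.
Proof.
apply/seteqP; split; last first.
  apply: smallest_sub; first exact: sigma_algebra_measurable.
  by move=> _ [a [b ->]]; exact: measurable_box.
have SI (A B : set (R3 R)) : <<s boxes>> A -> <<s boxes>> B -> <<s boxes>> (A `&` B).
  move=> GA GB.
  have := @measurableI _ (g_sigma_algebraType boxes) A B GA GB; exact.
have Sc i (A : set R) : measurable A -> <<s boxes>> (coord i @^-1` A).
  apply: sigma_algebra_preimage_sub => _ [[s t] _ <-].
  have [_ _ GU] := smallest_sigma_algebra setT boxes.
  rewrite (_ : _ @^-1` _ = \bigcup_n box (setc i s (pt (fun=> - n%:R))) (setc i t (pt
      (fun=> n%:R)))).
    by apply: GU => n; apply: sub_sigma_algebra; do 2 eexists.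
  apply/seteqP; split=> [x /=|x [n _ xn] /=]; rewrite ?in_itv /=; last first.
    by have := xn i; rewrite !coord_setc eqxx.
  move=> xst; have [N Nx] := coord_archi x.
  exists N => // j; rewrite !coord_setc !coord_pt; case: eqP => [->//|_].
  by have := Nx j; rewrite ltr_norml => /andP[-> /ltW ->].
rewrite measurable_prod_measurableType; apply: smallest_sub.
  exact: smallest_sigma_algebra.
move=> _ [A mA [B mB <-]].
have -> : A `*` B = (fst @^-1` A) `&` (coord i3 @^-1` B) by [].
apply: (SI); last exact: Sc.
move: A mA; rewrite measurable_prod_measurableType.
apply: sigma_algebra_preimage_sub => _ [C mC [D mD <-]].
exact: (SI _ _ (Sc i1 C mC) (Sc i2 D mD)).
Qed.

(** The boxes with rational corners inside [U], enumerated by [unpickle]; the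
    remaining indices give empty boxes. *)
Lemma open_bigcup_box U : open U -> exists a b : nat -> R3 R,
  U = \bigcup_n box (a n) (b n).
Proof.
move=> oU.
pose q (r : rat * rat * rat) : R3 R := (ratr r.1.1, ratr r.1.2, ratr r.2).
pose F n := if unpickle n is Some r
  then if `[< box (q r.1) (q r.2) `<=` U >] then r else (0, 0) else (0, 0).
exists (fun n => q (F n).1), (fun n => q (F n).2).
apply/seteqP; split=> [x Ux|x [n _]]; last first.
  rewrite /F; have e0 : box (q 0) (q 0) = set0 by apply: (@box_empty _ _ i1).
  case: unpickle => [r|] /=; last by rewrite e0.
  by case: ifPn => [/asboolP h|_]; [exact: h | rewrite e0].
have : nbhs x U by exact: open_nbhs_nbhs.
rewrite -nbhs_ballE => -[e /= e0 eU].
have /choice[l lP] : forall i, exists r : rat, ratr r \in `]coord i x - e, coord i x[%R.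
  by move=> i; apply: rat_in_itvoo; lra.
have /choice[u uP] : forall i, exists r : rat, ratr r \in `]coord i x, coord i x + e[%R.
  by move=> i; apply: rat_in_itvoo; lra.
pose r := ((l i1, l i2, l i3), (u i1, u i2, u i3)).
have ql i : coord i (q r.1) = ratr (l i) by elim/I3P : i.
have qu i : coord i (q r.2) = ratr (u i) by elim/I3P : i.
have rU : box (q r.1) (q r.2) `<=` U.
  move=> y yr; apply: eU.
  have d i : ball (coord i x) e (coord i y).
    have /andP[] := yr i; rewrite ql qu.
    have := lP i; have := uP i; rewrite !in_itv /= => /andP[h1 h2] /andP[h3 h4] h5 h6.
    by rewrite /ball /= ltr_norml; apply/andP; split; lra.
  by split; [split; [exact: (d i1) | exact: (d i2)] | exact: (d i3)].
exists (pickle r) => //; rewrite /F pickleK; case: asboolP => // _ i.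
rewrite ql qu; have := lP i; have := uP i; rewrite !in_itv /= => /andP[h1 h2] /andP[h3 h4].
by rewrite h4 ltW.
Qed.

Lemma open_measurable3 U : open U -> mset3 U.
Proof.
move=> /open_bigcup_box[a [b ->]].
by apply: bigcup_measurable => n _; exact: measurable_box.
Qed.

Lemma continuous_measurable3 (f : R3 R -> R) : continuous f ->
  mfun3 f.
Proof.
move=> /continuousP cf; apply: (measurability (@RGenOInfty.G R)).
  exact: RGenOInfty.measurableE.
move=> _ [_ [x ->] <-]; rewrite setTI; apply: open_measurable3.
apply: cf; exact: rray_open.
Qed.

(** Boxes are stable under intersection and generate the Borel sets, so that
    the integrals of [f] over all Borel subsets of a box in [U] vanish. *)
Lemma box_ae0 U (f : R3 R -> R) : open U -> mfun3 f ->
  (forall a b, box a b `<=` U -> leb3.-integrable (box a b) (EFin \o f)) ->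
  (forall a b, box a b `<=` U -> \int[leb3]_(x in box a b) f x = 0) ->
  {ae leb3, forall x, U x -> f x = 0}.
Proof.
move=> oU mf intf f0.
have one a b : box a b `<=` U -> {ae leb3, forall x, box a b x -> f x = 0}.
  move=> abU; set Q := box a b; have mQ : mset3 Q := measurable_box a b.
  have H A : mset3 A -> (\int[leb3]_(x in A `&` Q) (f x)%:E = 0)%E.
    pose D := [set A | mset3 A /\ (\int[leb3]_(x in A `&` Q) (f x)%:E = 0)%E].
    have D0 a' b' : box a' b' `<=` U -> (\int[leb3]_(x in box a' b') (f x)%:E = 0)%E.
      move=> a'b'U; rewrite -[LHS]fineK; last first.
        by apply: integrable_fin_num; [exact: measurable_box | exact: intf].
      by rewrite -[fine _]/(Rintegral _ _ _) f0.
    suff HD : (@measurable _ (T3 R)) `<=` D by move=> /HD[].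
    rewrite measurable_boxes -setI_closed_g_dynkin_g_sigma_algebra//; last exact: boxes_setI.
    apply: smallest_sub.
      split=> [|B [mB B0]|F tF DF].
      - by split; rewrite // setTI; exact: D0.
      - split; first exact: measurableC.
        have : (\int[leb3]_(x in Q) (f x)%:E = 0)%E by exact: D0.
        have {1}-> : Q = (B `&` Q) `|` (~` B `&` Q) by rewrite -setIUl setUv setTI.
        rewrite integral_setU ?B0 ?add0e//.
        + exact: measurableI.
        + by apply: measurableI => //; exact: measurableC.
        + by rewrite -setIUl setUv setTI; apply/measurable_EFinP; exact: measurable_funTS.
        + by apply/disj_setPS => x [[Bx _] []].
      - have mF n : mset3 (F n) by case: (DF n).
        split; first exact: bigcup_measurable.
        rewrite setI_bigcupl integral_bigcup//.
        + by apply: eseries0 => n _ _; case: (DF n).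
        + exact: trivIset_setIr.
        + by move=> n; apply: measurableI; [exact: mF | exact: mQ].
        + rewrite -setI_bigcupl; apply: integrableS (intf a b abU) => //.
          apply: measurableI; [|exact: mQ].
          by apply: bigcup_measurable => n _; exact: mF.
    move=> _ [a' [b' ->]]; split; first exact: measurable_box.
    rewrite /Q boxI D0// -boxI => x [_ xQ]; exact: abU.
  have := @integral_ae_eq _ _ _ leb3 Q mQ (cst 0%E) (EFin \o f) (intf a b abU) _ _.
  move=> []//.
    move=> E EQ mE; rewrite integral0; have := H E mE; congr (_ = _).
    by rewrite (setIidl EQ).
  by move=> N [mN N0 h]; exists N; split => // x hx; apply: h => /= h'; apply: hx => Qx;
      have [] := h' Qx.
have [a [b UE]] := open_bigcup_box oU.
have : {ae leb3, forall x, forall n, box (a n) (b n) x -> f x = 0}.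
  apply: ae_foralln => n; apply: one.
  by rewrite UE => x xn; exists n.
by apply: filterS => x h; rewrite UE => -[n _ xn]; exact: (h n).
Qed.

End Boxes.

(** * Smooth functions with compact support *)

Section Smooth1.
Context {R : realType}.
Implicit Types (f g F : R -> R).

Lemma is_deriveE (V : normedModType R) (f : V -> R) x v d :
  is_derive x v f d <-> h^-1 * (f (h *: v + x) - f x) @[h --> 0^'] --> d.
Proof.
split=> [[fd <-]|fd]; first by have := fd.
by split; [apply/cvg_ex; exists d | apply: cvg_lim].
Qed.

(** The span of these functions is closed under derivation. *)
Definition sig (k : nat) (x : R) : R :=
  if 0 < x then x^-1 ^+ k * expR (- x^-1) else 0.

Lemma sig_le0 k x : x <= 0 -> sig k x = 0.
Proof. by rewrite /sig ltNge => ->. Qed.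

Lemma sig_ge0 k x : 0 <= sig k x.
Proof.
rewrite /sig; case: ifPn => // x0.
by rewrite mulr_ge0 ?expR_ge0// exprn_ge0// invr_ge0 ltW.
Qed.

(** From [exp (1/h) >= (1/h)^(k+1) / (k+1)!]. Applied with [k.+1], it gives the
    derivative of [sig k] at the origin. *)
Lemma sig_bound k h : 0 < h -> sig k h <= (k.+1)`!%:R * h.
Proof.
move=> h0; rewrite /sig h0 expRN ler_pdivrMr ?expR_gt0//.
have := @expR_ge1Dxn _ h^-1 k; rewrite invr_ge0 ltW// => /(_ isT) E.
have f0 : 0 < (k.+1)`!%:R :> R by rewrite ltr0n fact_gt0.
have {}E : h^-1 ^+ k.+1 <= (k.+1)`!%:R * expR h^-1.
  by rewrite mulrC -ler_pdivrMr//; apply: le_trans E; rewrite lerDr.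
rewrite mulrAC -ler_pdivrMr//; apply: le_trans E.
by rewrite exprSr.
Qed.

Lemma sig_derive k (x : R) : is_derive x 1 (sig k) (sig k.+2 x - k%:R * sig k.+1 x).
Proof.
case: (ltgtP x 0) => [x0|x0|->].
- rewrite !sig_le0 ?ltW// mulr0 subr0.
  apply: (@near_eq_is_derive _ _ _ (fun=> 0 : R)).
  near=> y; rewrite sig_le0// ltW//; near: y; exact: lt_nbhsl.
- apply: (@near_eq_is_derive _ _ _ (fun y : R => y^-1 ^+ k * expR (- y^-1) : R)).
    near=> y; rewrite /sig ifT//; near: y; exact: lt_nbhsr.
  have xn0 : x != 0 by rewrite gt_eqF.
  have dV : is_derive x 1 (fun y : R => y^-1) (- x ^- 2).
    have := @is_deriveV R id x 1 1 xn0 (is_derive_id _ _).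
    by rewrite /GRing.scale /= mulr1.
  have := @is_deriveX _ _ _ k _ _ _ dV; rewrite exprfctE => dX.
  have dE := @is_derive1_comp _ expR _ x _ _ (is_derive_expR _) (is_deriveN dV).
  apply: (is_derive_eq (is_deriveM dX dE)).
  rewrite /sig x0 /GRing.scale /= opprK.
  case: k {dX} => [|k] /=; first by rewrite !mul0r mulr0 addr0 subr0 expr0 mul1r exprVn mulrC.
  rewrite !exprS !exprVn; field.
  by rewrite xn0 expf_neq0.
- rewrite !sig_le0// mulr0 subr0; apply/is_deriveE.
  apply/cvgrPdist_le => e e0; near=> h.
  rewrite [sig k 0]sig_le0// subr0 sub0r normrN addr0 /GRing.scale /= mulr1.
  have [h0|h0] := leP h 0; first by rewrite sig_le0// mulr0 normr0 ltW.
  rewrite ger0_norm ?mulr_ge0 ?invr_ge0 ?sig_ge0 ?ltW//.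
  have -> : h^-1 * sig k h = sig k.+1 h by rewrite /sig h0 exprS mulrA.
  apply: (le_lt_trans (sig_bound _ h0)).
  have f0 : 0 < (k.+2)`!%:R :> R by rewrite ltr0n fact_gt0.
  rewrite mulrC -ltr_pdivlMr//.
  rewrite -(gtr0_norm h0).
  near: h; apply: dnbhs0_lt; exact: divr_gt0.
Unshelve. all: by end_near. Qed.

Lemma sig_homo x y : x <= y -> sig 0 x <= sig 0 y.
Proof.
move=> xy; rewrite /sig; case: ifPn => [x0|_]; last exact: sig_ge0.
have y0 := lt_le_trans x0 xy; rewrite y0 !expr0 !mul1r ler_expR lerN2.
by rewrite lef_pV2.
Qed.

(** A class of functions that is closed under derivation, so that its members
    have derivatives of all orders. *)
Inductive smooth1 : (R -> R) -> Prop :=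
| smooth1_cst c : smooth1 (fun=> c)
| smooth1_sig k s c : smooth1 (fun x => sig k (s * x + c))
| smooth1_add f g : smooth1 f -> smooth1 g -> smooth1 (fun x => f x + g x)
| smooth1_mul f g : smooth1 f -> smooth1 g -> smooth1 (fun x => f x * g x)
| smooth1_exp f : smooth1 f -> smooth1 (fun x => expR (f x))
| smooth1_prim F f : (forall x : R, is_derive x 1 F (f x)) -> smooth1 f ->
    smooth1 F.

Lemma smooth1_derive f : smooth1 f ->
  exists2 g, smooth1 g & forall x : R, is_derive x 1 f (g x).
Proof.
elim=> [c|k s c|{}f {}g _ [f' sf' df] _ [g' sg' dg]
       |{}f {}g sf [f' sf' df] sg [g' sg' dg]|{}f sf [f' sf' df]|F {}f df sf _].
- exists (fun=> 0) => [|x]; [exact: smooth1_cst|exact: is_derive_cst].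
- exists (fun x => (sig k.+2 (s * x + c) + (- k%:R) * sig k.+1 (s * x + c)) * s).
    apply: smooth1_mul; last exact: smooth1_cst.
    apply: smooth1_add; first exact: smooth1_sig.
    by apply: smooth1_mul; [exact: smooth1_cst | exact: smooth1_sig].
  move=> x; have dl : is_derive x 1 (fun y : R => s * y + c) s.
    have := is_deriveD (is_deriveZ s (is_derive_id x (1 : R))) (is_derive_cst c x (1 : R)).
    by rewrite /GRing.scale /= mulr1 addr0.
  rewrite mulNr; exact: (is_derive1_comp (sig_derive k _) dl).
- exists (fun x => f' x + g' x) => [|x]; [exact: smooth1_add|exact: is_deriveD].
- exists (fun x => f x * g' x + g x * f' x) => [|x]; last exact: (is_deriveM (df x) (dg x)).
  by apply: smooth1_add; exact: smooth1_mul.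
- exists (fun x => expR (f x) * f' x) => [|x];
    last exact: (is_derive1_comp (is_derive_expR _) (df x)).
  by apply: smooth1_mul => //; exact: smooth1_exp.
- by exists f.
Qed.

Lemma smooth1_continuous f : smooth1 f -> continuous f.
Proof.
move=> /smooth1_derive[g _ df] x; apply: differentiable_continuous.
by apply/derivable1_diffP; case: (df x).
Qed.

(** As [n] grows, [1 - exp (- n c)] tends to 1 wherever the bump [c] is positive;
    the margins [1/(n+1)] keep the support inside the interval. *)
Definition cutoff (n : nat) (a b t : R) : R :=
  1 - expR (- (n%:R *
    (sig 0 (t - (a + n.+1%:R^-1)) * sig 0 (b - n.+1%:R^-1 - t)))).

Lemma cutoff_smooth n a b : smooth1 (cutoff n a b).
Proof.
have -> : cutoff n a b = fun t => 1 + (-1) * expR ((- n%:R) *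
    (sig 0 (1 * t + (- (a + n.+1%:R^-1))) * sig 0 ((-1) * t + (b - n.+1%:R^-1)))).
  by apply/funext => t; rewrite /cutoff mulN1r mul1r mulN1r mulNr [- t + _]addrC.
apply: smooth1_add; first exact: smooth1_cst.
apply: smooth1_mul; first exact: smooth1_cst.
apply: smooth1_exp; apply: smooth1_mul; first exact: smooth1_cst.
by apply: smooth1_mul; exact: smooth1_sig.
Qed.

Lemma cutoff_arg_ge0 n a b t : 0 <= n%:R *
  (sig 0 (t - (a + n.+1%:R^-1)) * sig 0 (b - n.+1%:R^-1 - t)).
Proof. by rewrite !mulr_ge0 ?sig_ge0. Qed.

Lemma cutoff_ge0 n a b t : 0 <= cutoff n a b t.
Proof. by rewrite /cutoff subr_ge0 -[leRHS]expR0 ler_expR oppr_le0 cutoff_arg_ge0. Qed.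

Lemma cutoff_le1 n a b t : cutoff n a b t <= 1.
Proof. by rewrite /cutoff gerBl expR_ge0. Qed.

Lemma cutoff_out n a b t :
  ~~ (a + n.+1%:R^-1 < t < b - n.+1%:R^-1) -> cutoff n a b t = 0.
Proof.
rewrite negb_and -!leNgt /cutoff => /orP[h|h].
  by rewrite sig_le0 ?subr_le0// mul0r mulr0 oppr0 expR0 subrr.
by rewrite [sig 0 (b - _ - t)]sig_le0 ?subr_le0// !mulr0 oppr0 expR0 subrr.
Qed.

Lemma cutoff_shift n a b s t : cutoff n a b (t - s) = cutoff n (a + s) (b + s) t.
Proof.
rewrite /cutoff (_ : t - s - _ = t - (a + s + n.+1%:R^-1)); last by ring.
by rewrite (_ : b - _ - (t - s) = b + s - n.+1%:R^-1 - t); last by ring.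
Qed.

Lemma cutoff_cvg a b t :
  cutoff n a b t @[n --> \oo] --> ((a < t < b)%R%:R : R).
Proof.
have [/andP[ta tb]|h] := boolP (a < t < b); last first.
  rewrite (_ : (fun n => _) = fun=> 0); first exact: cvg_cst.
  apply/funext => n; apply: cutoff_out; apply: contra h => /andP[h1 h2].
  have e0 : 0 < n.+1%:R^-1 :> R by rewrite invr_gt0.
  by move: (n.+1%:R^-1) e0 h1 h2 => e e0 h1 h2; apply/andP; split; lra.
pose d := Num.min (t - a) (b - t) / 2.
have d0 : 0 < d by rewrite divr_gt0// lt_min !subr_gt0 ta tb.
have [da db] : d < t - a /\ d < b - t.
  have : d * 2 <= t - a /\ d * 2 <= b - t.
    by rewrite /d divfK//; split; rewrite ge_min lexx ?orbT.
  by move=> [? ?]; split; lra.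
pose c := sig 0 (t - (a + d)) * sig 0 (b - d - t).
have c0 : 0 < c.
  have sp x : 0 < x -> 0 < sig 0 x by rewrite /sig => ->; rewrite expr0 mul1r expR_gt0.
  by rewrite mulr_gt0// sp//; lra.
apply/cvgrPdist_le => e e0; near=> n.
rewrite /cutoff opprB addrCA subrr addr0 ger0_norm ?expR_ge0//.
have en : n.+1%:R^-1 <= d.
  near: n; have := @cvg_harmonic R => /cvgrPdist_lt /(_ _ d0); apply: filterS => n /=.
  by rewrite sub0r normrN ger0_norm ?invr_ge0// => /ltW.
have nc : n%:R * c <= n%:R *
    (sig 0 (t - (a + n.+1%:R^-1)) * sig 0 (b - n.+1%:R^-1 - t)).
  apply: ler_wpM2l => //; apply: ler_pM; rewrite ?sig_ge0//; apply: sig_homo;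
    move: (n.+1%:R^-1) en => z en; lra.
apply: (@le_trans _ _ (expR (- (n%:R * c)))); first by rewrite ler_expR lerN2.
rewrite expRN -[leRHS]invrK lef_pV2 ?posrE ?expR_gt0 ?invr_gt0//.
apply: (@le_trans _ _ (1 + n%:R * c)); last exact: expR_ge1Dx.
apply: (@le_trans _ _ (n%:R * c)); last by rewrite lerDr.
rewrite -ler_pdivrMr//; near: n; exact: nbhs_infty_ger.
Unshelve. all: by end_near. Qed.

Lemma cutoff_integrable n a b (D : set R) : measurable D ->
  lebesgue_measure.-integrable D (EFin \o cutoff n a b).
Proof.
move=> mD; have mb : measurable_fun setT (cutoff n a b).
  by apply: continuous_measurable_fun; apply: smooth1_continuous; exact: cutoff_smooth.
apply: (@integrableS _ _ _ _ setT) => //.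
apply: (@le_integrable _ _ _ lebesgue_measure _ measurableT _ (EFin \o \1_`[a, b]%classic)).
- exact/measurable_EFinP.
- move=> x _ /=; rewrite lee_fin ger0_norm ?cutoff_ge0//.
  have [/andP[h1 h2]|h] := boolP (a + n.+1%:R^-1 < x < b - n.+1%:R^-1); last first.
    by rewrite cutoff_out.
  rewrite indicE mem_set ?normr1 ?cutoff_le1//= in_itv /=.
  have e0 : 0 < n.+1%:R^-1 :> R by rewrite invr_gt0.
  by move: (n.+1%:R^-1) e0 h1 h2 => e e0 h1 h2; apply/andP; split; lra.
- exact: integrable_indic_itv.
Qed.

(** Differences of translates of these primitives have compact support and a
    derivative that is a difference of cutoffs. *)
Definition prim (n : nat) (a b x : R) : R :=
  \int[lebesgue_measure]_(t in `]-oo, x]) cutoff n a b t.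

Lemma is_derive_prim n a b (x : R) :
  is_derive x 1 (prim n a b) (cutoff n a b x).
Proof.
have xx : x < x + 1 by lra.
have ib := @cutoff_integrable n a b `]-oo, x + 1]%classic ltac:(exact: measurable_itv).
have [||d e] := @continuous_FTC1 _ _ -oo%O _ _ xx ib.
  by rewrite /= ltNyr.
  by apply: smooth1_continuous; exact: cutoff_smooth.
by split => //; rewrite -derive1E.
Qed.

Lemma prim_ge0 n a b x : 0 <= prim n a b x.
Proof. by apply: Rintegral_ge0 => t _; exact: cutoff_ge0. Qed.

Lemma prim_le n a b x : a <= b -> prim n a b x <= b - a.
Proof.
move=> ab; rewrite -lee_fin /prim /Rintegral fineK; last first.
  by apply: integrable_fin_num => //; apply: cutoff_integrable; exact: measurable_itv.
have mx : measurable `]-oo, x]%classic by exact: measurable_itv.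
apply: (@le_trans _ _ (\int[lebesgue_measure]_(t in `]-oo, x]) (\1_`[a, b] t)%:E)%E).
  apply: ge0_le_integral => //.
  - by move=> t _; rewrite lee_fin cutoff_ge0.
  - by have /integrableP[] := cutoff_integrable n a b mx.
  - by apply/measurable_EFinP; apply: measurable_funTS; apply: measurable_indic;
      exact: measurable_itv.
  - move=> t _; rewrite lee_fin.
    have [/andP[h1 h2]|h] := boolP (a + n.+1%:R^-1 < t < b - n.+1%:R^-1); last first.
      by rewrite cutoff_out.
    rewrite indicE mem_set ?cutoff_le1//= in_itv /=.
    have e0 : 0 < n.+1%:R^-1 :> R by rewrite invr_gt0.
    by move: (n.+1%:R^-1) e0 h1 h2 => e e0 h1 h2; apply/andP; split; lra.
rewrite integral_indic//; apply: (@le_trans _ _ (lebesgue_measure `[a, b]%classic)).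
  by apply: le_measure; rewrite ?inE//; apply: measurableI.
by rewrite lebesgue_measure_itv /= lte_fin; case: ltP => // _; rewrite lee_fin subr_ge0.
Qed.

Lemma prim_left n a b x : x <= a + n.+1%:R^-1 -> prim n a b x = 0.
Proof.
move=> xa; rewrite /prim (@eq_Rintegral _ _ _ _ _ (cst 0)).
  by rewrite Rintegral_cst ?mul0r//; exact: measurable_itv.
move=> t; rewrite inE /= in_itv /= => tx; apply: cutoff_out.
by rewrite negb_and -!leNgt (le_trans tx xa).
Qed.

Lemma prim_right n a b x y : b - n.+1%:R^-1 <= x -> b - n.+1%:R^-1 <= y ->
  prim n a b x = prim n a b y.
Proof.
suff E z : b - n.+1%:R^-1 <= z ->
    prim n a b z = \int[lebesgue_measure]_t cutoff n a b t.
  by move=> /E -> /E ->.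
move=> bz; rewrite /prim Rintegral_mkcond; apply: eq_Rintegral => t _.
rewrite /patch; case: ifPn => // /negP tz; rewrite cutoff_out//.
apply/negP => /andP[_ h]; apply: tz; rewrite inE /= in_itv /=.
by rewrite ltW// (lt_le_trans h).
Qed.

End Smooth1.

(** ** Products of functions of one variable *)

Section Tensor.
Context {R : realType}.
Implicit Types (A : 'I_3 -> R -> R) (a b x y : R3 R) (i j : 'I_3) (U : set (R3 R)).

Definition tensor A x : R := \prod_i A i (coord i x).

Lemma continuous_coord i : continuous (coord i : R3 R -> R).
Proof.
elim/I3P : i => x.
- apply: (@continuous_comp _ _ _ (fst : R3 R -> R * R) fst); exact: cvg_fst.
- apply: (@continuous_comp _ _ _ (fst : R3 R -> R * R) snd); [exact: cvg_fst|exact: cvg_snd].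
- exact: cvg_snd.
Qed.

Lemma continuous_tensor A : (forall i, smooth1 (A i)) -> continuous (tensor A).
Proof.
move=> sA x.
have c i : {for x, continuous (fun y : R3 R => A i (coord i y))}.
  by apply: continuous_comp; [exact: continuous_coord | exact: smooth1_continuous].
rewrite (_ : tensor A = fun y => A i1 (coord i1 y) * A i2 (coord i2 y) * A i3 (coord i3 y)).
  by apply: continuousM (c i3); exact: continuousM (c i1) (c i2).
by apply/funext => y; rewrite /tensor prod_I3.
Qed.

Lemma derive_tensor A j (d : R -> R) : (forall t : R, is_derive t 1 (A j) (d t)) ->
  forall x, is_derive x (evec j) (tensor A)
    (tensor (fun i => if i == j then d else A i) x).
Proof.
move=> dA x; apply/is_deriveE.
pose c := \prod_(i | i != j) A i (coord i x).
have -> : tensor (fun i => if i == j then d else A i) x = d (coord j x) * c.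
  rewrite /tensor (bigD1 j)//= eqxx; congr (_ * _).
  by apply: eq_bigr => i /negbTE ->.
rewrite (_ : (fun h : R => _) = (fun h : R =>
    h^-1 * (A j (h *: 1 + coord j x) - A j (coord j x)) * c)); last first.
  apply/funext => h; rewrite /tensor (bigD1 j)//= [X in _ - X](bigD1 j)//=.
  rewrite (eq_bigr (fun i => A i (coord i x))); last first.
    by move=> i ij; rewrite coordD coordZ coord_evec (negbTE ij) mulr0 add0r.
  rewrite coordD coordZ coord_evec eqxx -/c /GRing.scale /=; ring.
by apply: cvgM; [apply/is_deriveE; exact: dA | exact: cvg_cst].
Qed.

Lemma smooth_tensor A : (forall i, smooth1 (A i)) -> smooth (tensor A).
Proof.
move=> sA s.
have [B sB ->] : exists2 B, (forall i, smooth1 (B i)) & iter_partial s (tensor A) = tensor B.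
  elim: s => [|j s [B sB E]]; first by exists A.
  have [d sd dd] := smooth1_derive (sB j).
  exists (fun i => if i == j then d else B i) => [i|]; first by case: ifP.
  apply/funext => x /=; rewrite E.
  by have [_ ->] := derive_tensor dd x.
split=> [|j x]; first exact: continuous_tensor.
have [d sd dd] := smooth1_derive (sB j).
by have [+ _] := derive_tensor dd x.
Qed.

Lemma test_tensor A U (lo hi : 'I_3 -> R) : (forall i, smooth1 (A i)) ->
  (forall i t, ~~ (lo i <= t <= hi i) -> A i t = 0) ->
  (forall x, (forall i, lo i <= coord i x <= hi i) -> U x) ->
  test_function U (tensor A).
Proof.
move=> sA A0 inU.
pose K : set (R3 R) := (`[lo i1, hi i1] `*` `[lo i2, hi i2] `*` `[lo i3, hi i3])%classic.
have KP x : K x <-> forall i, lo i <= coord i x <= hi i.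
  split=> [[[h1 h2] h3]|h].
    by elim/I3P; move: h1 h2 h3; rewrite /= !in_itv.
  by rewrite /K /= !in_itv /=; split; [split; [exact: (h i1) | exact: (h i2)] | exact: (h i3)].
have cK : compact K.
  by apply: compact_setX; [apply: compact_setX|]; exact: segment_compact.
have clK : closed K by apply: compact_closed.
have sub : closure [set x | tensor A x != 0] `<=` K.
  rewrite ((closure_id K).1 clK); apply: closure_subset => x /=.
  rewrite /tensor => /prodf_neq0 h; apply/KP => i.
  by apply: contraTT (h i isT) => ni; rewrite A0// eqxx.
split; first exact: smooth_tensor.
  by apply: subclosed_compact cK sub; exact: closed_closure.
by move=> x /sub /KP; exact: inU.
Qed.

Lemma plane_null i (c : R) : leb3 (coord i @^-1` [set c]) = 0%E.
Proof.
elim/I3P : i.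
- rewrite (_ : _ @^-1` _ = ([set c] `*` setT) `*` setT); last first.
    by apply/seteqP; split=> x //= [[]].
  rewrite /leb3 product_measure1E//; last exact: measurableX.
  rewrite [X in (X * _)%E](_ : _ = 0%E) ?mul0e//.
  rewrite [LHS]product_measure1E//.
  by rewrite [X in (X * _)%E](_ : _ = 0%E) ?mul0e//; exact: lebesgue_measure_set1.
- rewrite (_ : _ @^-1` _ = (setT `*` [set c]) `*` setT); last first.
    by apply/seteqP; split=> x //= [[]].
  rewrite /leb3 product_measure1E//; last exact: measurableX.
  rewrite [X in (X * _)%E](_ : _ = 0%E) ?mul0e//.
  rewrite [LHS]product_measure1E//.
  by rewrite [X in (_ * X)%E](_ : _ = 0%E) ?mule0//; exact: lebesgue_measure_set1.
- rewrite (_ : _ @^-1` _ = setT `*` [set c]); last first.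
    by apply/seteqP; split=> x //= [].
  rewrite /leb3 product_measure1E//.
  by rewrite [X in (_ * X)%E](_ : _ = 0%E) ?mule0//; exact: lebesgue_measure_set1.
Qed.

Definition tcutoff n a b : R3 R -> R :=
  tensor (fun i => cutoff n (coord i a) (coord i b)).

Lemma tcutoff_measurable n a b : mfun3 (tcutoff n a b).
Proof.
by apply: continuous_measurable3; apply: continuous_tensor => i; exact: cutoff_smooth.
Qed.

Lemma inv_natS_gt0 n : 0 < n.+1%:R^-1 :> R.
Proof. by rewrite invr_gt0. Qed.

Lemma tcutoff_out n a b x : ~ box a b x -> tcutoff n a b x = 0.
Proof.
move=> /existsNP[i /negP h]; apply/eqP/prodf_eq0; exists i => //.
apply/eqP/cutoff_out; apply: contra h => /andP[].
by move: (n.+1%:R^-1) (inv_natS_gt0 n) => e e0 h1 h2; apply/andP; split; lra.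
Qed.

Lemma tcutoff_01 n a b x : 0 <= tcutoff n a b x <= 1.
Proof.
apply/andP; split; first by apply: prodr_ge0 => i _; exact: cutoff_ge0.
have -> : (1 : R) = \prod_(i < 3) 1 by rewrite big1.
by apply: ler_prod => i _; rewrite cutoff_ge0 cutoff_le1.
Qed.

Lemma tcutoff_test n a b U : box a b `<=` U -> test_function U (tcutoff n a b).
Proof.
move=> abU; apply: (@test_tensor _ _ (fun i => coord i a + n.+1%:R^-1)
  (fun i => coord i b - n.+1%:R^-1)) => [i|i t h|x h].
- exact: cutoff_smooth.
- by apply: cutoff_out; apply: contra h => /andP[h1 h2]; rewrite !ltW.
- apply: abU => i; have /andP[] := h i.
  by move: (n.+1%:R^-1) (inv_natS_gt0 n) => e e0 h1 h2; apply/andP; split; lra.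
Qed.

(** The cutoffs converge to the indicator of the box except on the faces
    [coord i x = coord i b], which belong to the half-open box and are null
    sets. *)
Lemma cvg_tcutoff (g : R3 R -> R) a b : mfun3 g ->
  leb3.-integrable (box a b) (EFin \o g) ->
  \int[leb3]_x (g x * tcutoff n a b x) @[n --> \oo] -->
  \int[leb3]_(x in box a b) g x.
Proof.
move=> mg ig; have mQ := measurable_box a b.
have mgQ : mfun3 (g \_ (box a b)).
  by apply/(measurable_restrictT _ mQ); exact: measurable_funTS.
have igQ : leb3.-integrable setT (EFin \o (g \_ (box a b))).
  by rewrite -restrict_EFin; apply/(integrable_mkcond _ mQ).
have [] := @dominated_convergence _ _ _ leb3 setT measurableT
  (fun n x => (g x * tcutoff n a b x)%:E) (EFin \o (g \_ (box a b)))
  (fun x => `|(g \_ (box a b)) x|%:E).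
- by move=> n; apply/measurable_EFinP; apply: measurable_funM => //; exact: tcutoff_measurable.
- exact/measurable_EFinP.
- have : {ae leb3, forall x, forall i, coord i x != coord i b}.
    have P i : {ae leb3, forall x, coord i x != coord i b}.
      exists (coord i @^-1` [set coord i b]); split => //.
      + rewrite -[_ @^-1` _]setTI; apply: continuous_measurable3 => //.
        exact: continuous_coord.
      + exact: plane_null.
      + by move=> x /= /negP; rewrite negbK => /eqP.
    apply: filterS (filterI (filterI (P i1) (P i2)) (P i3)) => x [[h1 h2] h3].
    by elim/I3P.
  apply: filterS => x xb _; apply: cvg_EFin; first exact: nearW.
  have tc : tcutoff n a b x @[n --> \oo] --> (\prod_i
      (coord i a < coord i x < coord i b)%R%:R : R).
    rewrite prod_I3 (_ : (fun n => _) = fun n => cutoff n (coord i1 a) (coord i1 b) (coord i1 x) *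
      cutoff n (coord i2 a) (coord i2 b) (coord i2 x) *
      cutoff n (coord i3 a) (coord i3 b) (coord i3 x)); last first.
      by apply/funext => n; rewrite /tcutoff /tensor prod_I3.
    by apply: cvgM; [apply: cvgM|]; exact: cutoff_cvg.
  rewrite (_ : (g \_ (box a b)) x = g x * (\prod_i (coord i a < coord i x < coord i b)%R%:R)).
    by apply: cvgM => //; exact: cvg_cst.
  rewrite /patch; case: ifPn => [/set_mem xab|/negP xab].
    rewrite big1 ?mulr1// => i _; have /andP[h1 h2] := xab i.
    by rewrite h1 lt_neqAle xb h2.
  have /existsNP[i /negP h] : ~ box a b x by move=> h; apply: xab; exact: mem_set.
  rewrite (bigD1 i)//= (_ : _ && _ = false) ?mul0r ?mulr0//.
  by apply/negbTE; apply: contra h => /andP[-> /ltW].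
- by have := integrable_norm igQ; apply: eq_integrable.
- apply: nearW => x n _; rewrite /= lee_fin normrM.
  rewrite /patch; case: ifPn => [_|/negP xab].
    have /andP[t0 t1] := tcutoff_01 n a b x.
    by rewrite ler_piMr// ger0_norm.
  rewrite tcutoff_out ?normr0 ?mulr0// => h; apply: xab; exact: mem_set.
move=> _ _ c; rewrite Rintegral_mkcond /Rintegral.
apply: fine_cvg; rewrite fineK//; exact: integrable_fin_num.
Qed.

End Tensor.

(** * Weak derivatives *)

Section Sobolev.
Context {R : realType}.
Local Notation mu := (@leb3 R).
Implicit Types (U : set (R3 R)) (f g eta : R3 R -> R) (u v : R3 R -> R3 R).
Implicit Types (i j k : 'I_3) (a b : R3 R).

Lemma L2_sqint U f : L2 U f <-> sqint mu (f \_ U).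
Proof. by rewrite sqint_Lfun. Qed.

Lemma patchE U f x : (f \_ U) x = if x \in U then f x else 0.
Proof. by []. Qed.

Lemma patch_lin U c f g : (fun x => c * f x + g x) \_ U =
  fun x => c * (f \_ U) x + (g \_ U) x.
Proof.
apply/funext => x; rewrite !patchE.
by case: (x \in U); rewrite ?mulr0 ?addr0.
Qed.

Lemma regular_distrE U f eta : regular_distr U f eta = dot mu (f \_ U) eta.
Proof.
rewrite /regular_distr Rintegral_mkcond; apply: eq_Rintegral => x _.
by rewrite !patchE; case: (x \in U); rewrite ?mul0r.
Qed.

Lemma L2_lin U c f g : L2 U f -> L2 U g -> L2 U (fun x => c * f x + g x).
Proof.
by move=> /L2_sqint sf /L2_sqint sg; apply/L2_sqint; rewrite patch_lin; exact: sqintL.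
Qed.

Lemma L2vec_lin U c u v : L2vec U u -> L2vec U v -> L2vec U (c *: u + v).
Proof.
move=> Lu Lv k.
rewrite (_ : component _ k = fun x => c * component u k x + component v k x).
  exact: L2_lin.
by apply/funext => x; rewrite /component coordD coordZ.
Qed.

(** ** Test functions are square-integrable *)

Lemma sqint_box f a b M : mfun3 f -> (forall x, `|f x| <= M) ->
  (forall x, ~ box a b x -> f x = 0) -> sqint mu f.
Proof.
move=> mf fM f0; split => //.
have mQ := measurable_box a b.
have -> : EFin \o (fun x => f x ^+ 2) = (EFin \o (fun x => f x ^+ 2)) \_ (box a b).
  apply/funext => x; rewrite /patch; case: ifPn => // /negP h /=.
  by rewrite f0 ?expr0n// => hx; apply: h; exact: mem_set.
apply/(integrable_mkcond _ mQ); apply: measurable_bounded_integrable => //.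
- exact: leb3_box_fin.
- by apply: measurable_funTS; exact: measurable_funX.
- exists (M ^+ 2); split; first exact: num_real.
  move=> y My x _; apply: le_trans (ltW My).
  by rewrite normrX ler_sqr ?nnegrE// (le_trans _ (fM x)).
Qed.

Lemma sqint_integrable_box g a b : sqint mu g ->
  mu.-integrable (box a b) (EFin \o g).
Proof.
move=> [mg ig]; have mQ := measurable_box a b.
have i1 : mu.-integrable (box a b) (cst 1%E).
  have := @measurable_bounded_integrable _ _ _ mu (cst 1) (box a b) mQ (leb3_box_fin a b).
  apply => //; exists 1; split; first exact: num_real.
  by move=> y y1 x _; rewrite /= normr1 ltW.
have i2 := integrableD mQ i1 (integrableS measurableT mQ (@subsetT _ _) ig).
apply: le_integrable i2 => //.
  by apply/measurable_EFinP; exact: measurable_funTS.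
move=> x _; rewrite /= lee_fin [leRHS]ger0_norm ?addr_ge0 ?sqr_ge0//.
have := sqr_ge0 (`|g x| - 1); rewrite sqrrB real_normK ?num_real// expr1n.
have := sqr_ge0 (g x); lra.
Qed.

Lemma compact_in_box (K : set (R3 R)) : compact K -> exists a b, K `<=` box a b.
Proof.
move=> /compact_bounded[M [_ hM]].
exists (pt (fun=> - (M + 2))), (pt (fun=> M + 2)) => x Kx i.
have : `|x| <= M + 1 by apply: hM => //; rewrite ltrDl.
have : `|coord i x| <= `|x|.
  elim/I3P : i; rewrite /coord /= !prod_normE !le_max lexx ?orbT//.
rewrite !coord_pt => h1 h2; have := le_trans h1 h2; rewrite ler_norml => /andP[h3 h4].
by apply/andP; split; lra.
Qed.

Lemma test_sqint U eta : test_function U eta -> sqint mu eta.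
Proof.
move=> [se cK _]; have [ce _] := se [::].
have [a [b Kab]] := compact_in_box cK.
have [M [_ hM]] : bounded_set (eta @` closure [set x | eta x != 0]).
  by apply: compact_bounded; apply: continuous_compact => //; exact: continuous_subspaceT.
have out x : ~ closure [set x | eta x != 0] x -> eta x = 0.
  move=> h; apply/eqP; apply: contraT => n0; case: h.
  exact: subset_closure.
apply: (@sqint_box _ a b (`|M| + 1)).
- exact: continuous_measurable3.
- move=> x; have [h|/out ->] := pselect (closure [set x | eta x != 0] x).
    by apply: hM; [have := ler_norm M; lra | exists x].
  by rewrite normr0 addr_ge0.
- by move=> x h; apply: out => /Kab.
Qed.

Lemma test_derive U i eta : test_function U eta ->
  test_function U (fun x => 'D_(evec i) eta x).
Proof.
move=> [se cK KU].
have it s : iter_partial s (fun x => 'D_(evec i) eta x) = iter_partial (rcons s i) eta.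
  by elim: s => //= j s ->.
have sub : closure [set x | 'D_(evec i) eta x != 0] `<=` closure [set x | eta x != 0].
  rewrite [X in _ `<=` X]((closure_id _).1 (@closed_closure _ [set x | eta x != 0])).
  apply: closure_subset => x /=.
  have [//|h /eqP[]] := pselect (closure [set x | eta x != 0] x).
  rewrite (@near_eq_derive _ _ _ eta (cst 0)); first by rewrite derive_cst.
  have : nbhs x (~` closure [set x | eta x != 0]).
    by apply: open_nbhs_nbhs; split => //; apply: closed_openC; exact: closed_closure.
  apply: filterS => y hy; apply/eqP; apply: contraT => n0; case: hy.
  exact: subset_closure.
split; first by move=> s; rewrite it; exact: se.
- by apply: subclosed_compact cK sub; exact: closed_closure.
- by move=> x /sub /KU.
Qed.

(** The fundamental lemma of the calculus of variations: the cutoffs of boxes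
    are test functions. *)
Lemma fund_lemma U f : open U -> L2 U f ->
  (forall eta, test_function U eta -> regular_distr U f eta = 0) ->
  {ae mu, forall x, (f \_ U) x = 0}.
Proof.
move=> oU /L2_sqint sf f0; have [mf _] := sf.
have : {ae mu, forall x, U x -> (f \_ U) x = 0}.
  apply: box_ae0 => // a b abU; first exact: sqint_integrable_box.
  have c := @cvg_tcutoff _ (f \_ U) a b mf (sqint_integrable_box a b sf).
  rewrite -(cvg_lim _ c)//; apply: cvg_lim => //.
  rewrite (_ : (fun n => _) = fun=> 0); first exact: cvg_cst.
  apply/funext => n; rewrite -[LHS]/(dot mu (f \_ U) (tcutoff n a b)) -regular_distrE.
  by apply: f0; exact: tcutoff_test.
apply: filterS => x h; rewrite patchE; case: ifPn => // /set_mem Ux.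
by have := h Ux; rewrite patchE mem_set.
Qed.

Lemma is_weak_partialE U i f g : is_weak_partial U i f g <->
  forall eta, test_function U eta ->
    - dot mu (f \_ U) (fun x => 'D_(evec i) eta x) = dot mu (g \_ U) eta.
Proof.
split=> h eta teta; have := h eta teta;
  by rewrite /fun_partial /distr_partial !regular_distrE.
Qed.

Lemma weak_partial_unique U i f g g' : open U -> L2 U g -> L2 U g' ->
  is_weak_partial U i f g -> is_weak_partial U i f g' ->
  {ae mu, forall x, (g \_ U) x = (g' \_ U) x}.
Proof.
move=> oU Lg Lg' /is_weak_partialE wg /is_weak_partialE wg'.
have := @fund_lemma U (fun x => (-1) * g' x + g x) oU (L2_lin _ Lg' Lg).
have -> : (fun x => -1 * g' x + g x) \_ U = fun x => (g \_ U) x - (g' \_ U) x.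
  by rewrite patch_lin; apply/funext => x; rewrite mulN1r addrC.
move=> h; apply: filterS (h _) => [x /eqP|eta teta].
  by rewrite subr_eq0 => /eqP.
move/L2_sqint : Lg => sg; move/L2_sqint : Lg' => sg'.
rewrite regular_distrE patch_lin dotL//; last exact: test_sqint teta.
by rewrite -wg// -wg'// mulN1r addNr.
Qed.

Lemma is_weak_partial_lin U i c f f' g g' : L2 U f -> L2 U f' -> L2 U g -> L2 U g' ->
  is_weak_partial U i f g -> is_weak_partial U i f' g' ->
  is_weak_partial U i (fun x => c * f x + f' x) (fun x => c * g x + g' x).
Proof.
move=> /L2_sqint sf /L2_sqint sf' /L2_sqint sg /L2_sqint sg'.
move=> /is_weak_partialE wg /is_weak_partialE wg'; apply/is_weak_partialE => eta teta.
rewrite !patch_lin !dotL//; [|exact: test_sqint teta|exact: test_sqint (test_derive i teta)].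
by rewrite -wg// -wg'// opprD mulrN.
Qed.

Lemma weak_partialP U i k v : W12 U v ->
  L2 U (weak_partial U i (component v k)) /\
  is_weak_partial U i (component v k) (weak_partial U i (component v k)).
Proof.
move=> [_ /(_ i k)[g Lg wg]].
have /getPex : exists h, [set h | L2 U h /\ is_weak_partial U i (component v k) h] h.
  by exists g.
by [].
Qed.

(** ** The Hilbert spaces of the problem *)

Definition L2map U k v : R3 R -> R := (component v k) \_ U.

Definition W12map U (p : 'I_3 + 'I_3 * 'I_3) v : R3 R -> R :=
  match p with
  | inl k => (component v k) \_ U
  | inr (i, k) => (weak_partial U i (component v k)) \_ U
  end.

Definition L2dot U u v : R := \sum_k dot mu (L2map U k u) (L2map U k v).

Definition W12dot U u v : R := \sum_p dot mu (W12map U p u) (W12map U p v).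

Lemma sqint_restrict U g : mset3 U -> sqint mu g -> sqint mu (g \_ U).
Proof.
move=> mU [mg ig]; split.
  by apply/(measurable_restrictT _ mU); exact: measurable_funTS.
rewrite (_ : _ \o _ = (EFin \o (fun x => g x ^+ 2)) \_ U); last first.
  by apply/funext => x; rewrite /= patchE /patch; case: ifP => //; rewrite expr0n.
by apply/(integrable_mkcond _ mU); exact: integrableS ig.
Qed.

(** Restriction to [U] is a contraction that fixes every [f n \_ U]. *)
Lemma sqint_patch_cvg U (f : nat -> R3 R -> R) g : mset3 U ->
  (forall n, sqint mu (f n \_ U)) -> sqint mu g ->
  dot mu (fun x => (f n \_ U) x - g x) (fun x => (f n \_ U) x - g x) @[n --> \oo] --> 0 ->
  sqint mu (g \_ U) /\
  dot mu (fun x => (f n \_ U) x - (g \_ U) x) (fun x => (f n \_ U) x - (g \_ U) x)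
    @[n --> \oo] --> 0.
Proof.
move=> mU sf sg fg.
have sgU := sqint_restrict mU sg.
split => //; apply: squeeze_cvgr fg; last exact: cvg_cst.
apply: nearW => n; rewrite dot_ge0 /=; apply: le_Rintegral => //.
- by apply: sqint_mul; apply: sqintB.
- by apply: sqint_mul; apply: sqintB.
move=> x _; rewrite !patchE; case: ifP => // _.
by rewrite subrr mulr0 -expr2 sqr_ge0.
Qed.

Lemma semi_hilbert_L2vec U : mset3 U -> semi_hilbert (L2vec U) (L2dot U).
Proof.
move=> mU; apply: semi_hilbert_of_maps => [k||||].
- apply/L2_sqint; rewrite (_ : _ \_ _ = fun=> 0); first exact: sqint0.
  by apply/funext => x; rewrite patchE /component; case: ifP => // _; elim/I3P : k.
- exact: L2vec_lin.
- by move=> k v /(_ k)/L2_sqint.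
- move=> k c u v Lu Lv; apply: nearW => x; rewrite /L2map !patchE /component.
  by case: ifP => _; rewrite ?coordD ?coordZ// mulr0 addr0.
- move=> u g Lu sg ug; pose l x := pt (fun k => g k x).
  have lE k : component l k = g k by apply/funext => x; rewrite /component coord_pt.
  have h k := sqint_patch_cvg mU (fun n => (L2_sqint _ _).1 (Lu n k)) (sg k) (ug k).
  exists l; first by move=> k; rewrite lE; apply/L2_sqint; exact: (h k).1.
  by move=> k; rewrite /L2map lE; exact: (h k).2.
Qed.

Lemma W12_lin U c u v : W12 U u -> W12 U v -> W12 U (c *: u + v).
Proof.
move=> Wu Wv; split; first by apply: L2vec_lin; [case: Wu | case: Wv].
move=> i k; have [Lg wg] := weak_partialP i k Wu; have [Lg' wg'] := weak_partialP i k Wv.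
exists (fun x => c * weak_partial U i (component u k) x + weak_partial U i (component v k) x).
  exact: L2_lin.
rewrite (_ : component _ k = fun x => c * component u k x + component v k x).
  by apply: is_weak_partial_lin => //; [case: Wu => + _ | case: Wv => + _]; exact.
by apply/funext => x; rewrite /component coordD coordZ.
Qed.

(** The chosen representative of a weak derivative depends linearly on the
    function only up to null sets. *)
Lemma weak_partial_lin U c u v i k : open U -> W12 U u -> W12 U v ->
  {ae mu, forall x, (weak_partial U i (component (c *: u + v) k) \_ U) x =
     c * (weak_partial U i (component u k) \_ U) x +
     (weak_partial U i (component v k) \_ U) x}.
Proof.
move=> oU Wu Wv; have [Lg wg] := weak_partialP i k Wu.
have [Lg' wg'] := weak_partialP i k Wv.
have [Lh wh] := weak_partialP i k (W12_lin c Wu Wv).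
have := weak_partial_unique oU Lh (L2_lin c Lg Lg') wh.
rewrite patch_lin; apply.
rewrite (_ : component _ k = fun x => c * component u k x + component v k x).
  by apply: is_weak_partial_lin => //; [case: Wu => + _ | case: Wv => + _]; exact.
by apply/funext => x; rewrite /component coordD coordZ.
Qed.

Lemma W12map_sqint U p v : W12 U v -> sqint mu (W12map U p v).
Proof.
move=> Wv; case: p => [k|[i k]] /=; apply/L2_sqint; first by case: Wv => + _; exact.
by have [] := weak_partialP i k Wv.
Qed.

(** Weak derivatives are closed: both sides of their defining identity pass to
    the limit in square mean. *)
Lemma semi_hilbert_W12 U : open U -> semi_hilbert (W12 U) (W12dot U).
Proof.
move=> oU; have mU := open_measurable3 oU.
have sh := semi_hilbert_L2vec mU.
have z0 k : (component (0 : R3 R -> R3 R) k) = fun=> 0.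
  by apply/funext => x; elim/I3P : k.
have p0 : (fun=> 0 : R) \_ U = fun=> 0.
  by apply/funext => x; rewrite patchE; case: ifP.
apply: semi_hilbert_of_maps => [||p v|p c u v Wu Wv|u g Wu sg ug].
- split; first exact: (sh_mem0 sh).
  move=> i k; exists (fun=> 0); first by apply/L2_sqint; rewrite p0; exact: sqint0.
  by apply/is_weak_partialE => eta teta; rewrite z0 p0 !(dotC mu (fun=> 0)) !dot0r oppr0.
- by move=> c u v; exact: W12_lin.
- exact: W12map_sqint.
- case: p => [k|[i k]] /=; last exact: weak_partial_lin.
  apply: nearW => x; rewrite !patchE /component.
  by case: ifP => _; rewrite ?coordD ?coordZ// mulr0 addr0.
- pose l x := pt (fun k => g (inl k) x).
  have lE k : component l k = g (inl k) by apply/funext => x; rewrite /component coord_pt.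
  have h0 k := sqint_patch_cvg mU (fun n => (W12map_sqint (inl k) (Wu n))) (sg (inl k)) (ug
      (inl k)).
  have h1 i k := sqint_patch_cvg mU (fun n => (W12map_sqint (inr (i, k)) (Wu n))) (sg (inr
      (i, k))) (ug (inr (i, k))).
  have L1 i k : L2 U (g (inr (i, k))) by apply/L2_sqint; exact: (h1 i k).1.
  have w1 i k : is_weak_partial U i (component l k) (g (inr (i, k))).
    apply/is_weak_partialE => eta teta; rewrite lE.
    have c0 := sqint_cvg_dot (fun n => (W12map_sqint (inl k) (Wu n))) (h0 k).1
      (test_sqint (test_derive i teta)) (h0 k).2.
    have c1 := sqint_cvg_dot (fun n => (W12map_sqint (inr (i, k)) (Wu n))) (h1 i k).1
      (test_sqint teta) (h1 i k).2.
    rewrite -(cvg_lim _ c1)//; apply/esym/cvg_lim => //.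
    move/cvgN : c0; apply: cvg_trans; apply: near_eq_cvg; apply: nearW => n.
    have [_ /is_weak_partialE wn] := weak_partialP i k (Wu n).
    exact: wn.
  have Wl : W12 U l.
    split; first by move=> k; rewrite lE; apply/L2_sqint; exact: (h0 k).1.
    by move=> i k; exists (g (inr (i, k))).
  exists l => // -[k|[i k]] /=; first by rewrite lE; exact: (h0 k).2.
  have [Lw ww] := weak_partialP i k Wl.
  have ae := weak_partial_unique oU Lw (L1 i k) ww (w1 i k).
  have sn n := W12map_sqint (inr (i, k)) (Wu n).
  have m1 n : mfun3 (fun x => W12map U (inr (i, k)) (u n) x -
      (weak_partial U i (component l k) \_ U) x).
    by apply: measurable_funB; [exact: (sn n).1 | exact: ((L2_sqint _ _).1 Lw).1].
  have m2 n : mfun3 (fun x => W12map U (inr (i, k)) (u n) x -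
      (g (inr (i, k)) \_ U) x).
    by apply: measurable_funB; [exact: (sn n).1 | exact: ((L2_sqint _ _).1 (L1 i k)).1].
  have := (h1 i k).2; apply: cvg_trans; apply: near_eq_cvg; apply: nearW => n.
  have E : {ae mu, forall x, W12map U (inr (i, k)) (u n) x - (g (inr (i, k)) \_ U) x =
      W12map U (inr (i, k)) (u n) x - (weak_partial U i (component l k) \_ U) x}.
    by apply: filterS ae => x ->.
  by rewrite /= (dot_ae_eq (m2 n) (m1 n) (m2 n) E) dotC (dot_ae_eq (m2 n) (m1 n) (m1 n) E).
Qed.

End Sobolev.

(** ** Norms and weak convergence in terms of inner products *)

Lemma integral_sum_sq d (T : measurableType d) (R : realType)
    (mu : {measure set T -> \bar R}) (I : finType) (c : I -> R) (g : I -> T -> R) :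
  (forall p, 0 <= c p) -> (forall p, sqint mu (g p)) ->
  (\int[mu]_x (\sum_p c p * g p x ^+ 2)%:E = (\sum_p c p * dot mu (g p) (g p))%:E)%E.
Proof.
move=> c0 sg; under eq_integral do rewrite -sumEFin.
rewrite ge0_integral_sum//.
- rewrite -sumEFin; apply: eq_bigr => p _.
  under eq_integral do rewrite EFinM.
  rewrite ge0_integralZl ?lee_fin//; first by rewrite sqint_dot// EFinM.
  + by apply/measurable_EFinP; apply: measurable_funX; case: (sg p).
  + by move=> x _; rewrite lee_fin sqr_ge0.
- move=> p; apply/measurable_EFinP; apply: measurable_funM => //.
  by apply: measurable_funX; case: (sg p).
- by move=> p x _; rewrite lee_fin mulr_ge0 ?sqr_ge0.
Qed.

Section Norms.
Context {R : realType}.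
Local Notation mu := (@leb3 R).
Implicit Types (U : set (R3 R)) (u v : R3 R -> R3 R) (i k : 'I_3).

Lemma enorm_sq (x : R3 R) : enorm x ^+ 2 = \sum_i coord i x ^+ 2.
Proof. by rewrite sqr_sqrtr// sumr_ge0// => i _; exact: sqr_ge0. Qed.

Lemma poweR_sqrt (a : R) : 0 <= a -> (a%:E `^ 2^-1 = (Num.sqrt a)%:E)%E.
Proof. by move=> a0; rewrite poweR_EFin powR12_sqrt. Qed.

Lemma L2dot_integral U v : L2vec U v ->
  (\int[mu]_(x in U) (enorm (v x) ^+ 2)%:E = (L2dot U v v)%:E)%E.
Proof.
move=> Lv; rewrite integral_mkcond.
transitivity (\int[mu]_x (\sum_k 1 * L2map U k v x ^+ 2)%:E)%E.
  apply: eq_integral => x _; rewrite /patch /L2map /patch enorm_sq.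
  case: ifP => _; congr EFin; first by apply: eq_bigr => k _; rewrite mul1r.
  by rewrite big1// => k _; rewrite expr0n mulr0.
rewrite integral_sum_sq//; last by move=> k; apply/L2_sqint; exact: Lv.
by congr EFin; apply: eq_bigr => k _; rewrite mul1r.
Qed.

Lemma L2dot_ge0 U v : 0 <= L2dot U v v.
Proof. by apply: sumr_ge0 => k _; exact: dot_ge0. Qed.

Lemma W12dot_ge0 U v : 0 <= W12dot U v v.
Proof. by apply: sumr_ge0 => k _; exact: dot_ge0. Qed.

Lemma L2norm_dot U v : L2vec U v -> L2norm U v = (Num.sqrt (L2dot U v v))%:E.
Proof. by move=> Lv; rewrite /L2norm L2dot_integral// poweR_sqrt// L2dot_ge0. Qed.

(** The weighted Dirichlet form. *)
Definition graddot (w : 'I_3 -> R) U u v : R :=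
  \sum_i \sum_k w i ^+ 2 *
    dot mu (W12map U (inr (i, k)) u) (W12map U (inr (i, k)) v).

Lemma graddot_integral (w : 'I_3 -> R) U v : W12 U v ->
  (\int[mu]_(x in U) (grad_sq w U v x)%:E = (graddot w U v v)%:E)%E.
Proof.
move=> Wv; rewrite integral_mkcond.
transitivity (\int[mu]_x (\sum_(p : 'I_3 * 'I_3) w p.1 ^+ 2 * W12map U (inr p) v x ^+ 2)%:E)%E.
  apply: eq_integral => x _; rewrite /patch /W12map /grad_sq pair_big /=.
  case: ifP => h; congr EFin; last first.
    by rewrite big1// => -[i k] _ /=; rewrite patchE h expr0n mulr0.
  by apply: eq_bigr => -[i k] _ /=; rewrite patchE h exprMn.
rewrite (integral_sum_sq (c := fun p => w p.1 ^+ 2)).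
- by congr EFin; rewrite /graddot pair_big; apply: eq_bigr => -[i k] _.
- by move=> p; exact: sqr_ge0.
- by move=> p; exact: W12map_sqint.
Qed.

Lemma graddot_ge0 (w : 'I_3 -> R) U v : 0 <= graddot w U v v.
Proof.
apply: sumr_ge0 => i _; apply: sumr_ge0 => k _.
by rewrite mulr_ge0 ?sqr_ge0 ?dot_ge0.
Qed.

Lemma W12dotE U u v :
  W12dot U u v = L2dot U u v + graddot (fun=> 1) U u v.
Proof.
rewrite /W12dot big_sumType /=; congr (_ + _).
rewrite /graddot pair_big /=; apply: eq_bigr => -[i k] _ /=.
by rewrite expr1n mul1r.
Qed.

Lemma measurable_grad_sq (w : 'I_3 -> R) U v : W12 U v ->
  mfun3 ((grad_sq w U v) \_ U).
Proof.
move=> Wv.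
rewrite (_ : _ \_ _ = fun x => \sum_i \sum_k w i ^+ 2 * W12map U (inr (i, k)) v x ^+ 2).
  apply: measurable_sum => i; apply: measurable_sum => k.
  apply: measurable_funM => //; apply: measurable_funX.
  by case: (W12map_sqint (inr (i, k)) Wv).
apply/funext => x; rewrite /patch /grad_sq; case: ifP => h.
  by apply: eq_bigr => i _; apply: eq_bigr => k _; rewrite /W12map patchE h exprMn.
by rewrite big1// => i _; rewrite big1// => k _; rewrite /W12map patchE h expr0n mulr0.
Qed.

Lemma W12norm_dot U v : mset3 U -> W12 U v ->
  W12norm U v = (Num.sqrt (W12dot U v v))%:E.
Proof.
move=> mU Wv; have Lv : L2vec U v by case: Wv.
suff E : (\int[mu]_(x in U) (enorm (v x) ^+ 2 + grad_sq (fun=> 1) U v x)%:E =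
    (W12dot U v v)%:E)%E by rewrite /W12norm E poweR_sqrt// W12dot_ge0.
under eq_integral do rewrite EFinD.
rewrite ge0_integralD//.
- by rewrite L2dot_integral// graddot_integral// W12dotE.
- by move=> x _; rewrite lee_fin sqr_ge0.
- apply/measurable_EFinP; apply/(measurable_restrictT _ mU).
  rewrite (_ : _ \_ _ = fun x => \sum_k L2map U k v x ^+ 2).
    by apply: measurable_sum => k; apply: measurable_funX; case: ((L2_sqint _ _).1 (Lv k)).
  apply/funext => x; rewrite /patch /L2map /patch enorm_sq; case: ifP => // _.
  by rewrite big1// => k _; rewrite expr0n.
- by move=> x _; rewrite lee_fin; apply: sumr_ge0 => i _; apply: sumr_ge0 => k _; exact: sqr_ge0.
- by apply/measurable_EFinP; apply/(measurable_restrictT _ mU); exact: measurable_grad_sq.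
Qed.

(** Pairing with [g] a component, or one of its weak derivatives, is a bounded
    functional. *)
Lemma W12_weakly_cvg_dot U (u : nat -> R3 R -> R3 R) l p g : open U ->
  weakly_cvg (W12 U) (W12norm U) u l -> sqint mu g ->
  dot mu (W12map U p (u j)) g @[j --> \oo] --> dot mu (W12map U p l) g.
Proof.
move=> oU [Wu Wl ul] sg; have mU := open_measurable3 oU.
apply: (ul (fun v => dot mu (W12map U p v) g)) => [c x y Wx Wy|].
  rewrite -dotL; [|exact: W12map_sqint|exact: W12map_sqint|by []].
  apply: dot_ae_eq.
  - by case: (W12map_sqint p (W12_lin c Wx Wy)).
  - by case: (sqintL c (W12map_sqint p Wx) (W12map_sqint p Wy)).
  - by case: sg.
  case: p => [k|[i k]] /=; last exact: weak_partial_lin.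
  apply: nearW => t; rewrite !patchE /component.
  by case: ifP => _; rewrite ?coordD ?coordZ// mulr0 addr0.
exists (Num.sqrt (dot mu g g)) => v Wv; rewrite W12norm_dot// -EFinM lee_fin.
have := sh_CS_sqrt (semi_hilbert_sqint mu) (W12map_sqint p Wv) sg.
rewrite mulrC => /le_trans; apply; apply: ler_wpM2l; first exact: sqrtr_ge0.
apply: ler_wsqrtr; rewrite /W12dot (bigD1 p)//= lerDl.
by apply: sumr_ge0 => q _; exact: dot_ge0.
Qed.

Lemma L2_weakly_cvg_dot U (u : nat -> R3 R -> R3 R) l k g : mset3 U ->
  weakly_cvg (L2vec U) (L2norm U) u l -> sqint mu g ->
  dot mu (L2map U k (u j)) g @[j --> \oo] --> dot mu (L2map U k l) g.
Proof.
move=> mU [Lu Ll ul] sg.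
have sL v : L2vec U v -> sqint mu (L2map U k v) by move=> /(_ k)/L2_sqint.
apply: (ul (fun v => dot mu (L2map U k v) g)) => [c x y Lx Ly|].
  rewrite -dotL; [|exact: sL|exact: sL|by []].
  congr (dot _ _ _); apply/funext => t; rewrite /L2map !patchE /component.
  by case: ifP => _; rewrite ?coordD ?coordZ// mulr0 addr0.
exists (Num.sqrt (dot mu g g)) => v Lv; rewrite L2norm_dot// -EFinM lee_fin.
have := sh_CS_sqrt (semi_hilbert_sqint mu) (sL _ Lv) sg.
rewrite mulrC => /le_trans; apply; apply: ler_wpM2l; first exact: sqrtr_ge0.
apply: ler_wsqrtr; rewrite /L2dot (bigD1 k)//= lerDl.
by apply: sumr_ge0 => q _; exact: dot_ge0.
Qed.

End Norms.

(** * Averages over boxes *)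

Section BoxIntegrals.
Context {R : realType}.
Local Notation mu := (@leb3 R).
Implicit Types (U : set (R3 R)) (f g eta : R3 R -> R) (i j k : 'I_3).
Implicit Types (a b x y : R3 R).

Definition bint f a b : R := \int[mu]_(x in box a b) f x.

Definition one_box a b : R3 R -> R := (fun=> 1 : R) \_ (box a b).

Definition increasing_pt a b := forall j, coord j a < coord j b.

Lemma vol_gt0 a b : increasing_pt a b -> 0 < vol a b.
Proof. by move=> ab; apply: prodr_gt0 => i _; rewrite subr_gt0. Qed.

Lemma one_boxE a b x : one_box a b x = if x \in box a b then 1 else 0.
Proof. by []. Qed.

Lemma one_box_sqint a b : sqint mu (one_box a b).
Proof.
have mQ := measurable_box a b.
apply: (@sqint_box _ _ a b 1).
- by apply/(measurable_restrictT _ mQ); exact: measurable_cst.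
- by move=> x; rewrite /one_box patchE; case: ifP; rewrite ?normr1 ?normr0.
- by move=> x h; rewrite /one_box patchE; case: ifPn => // /set_mem.
Qed.

Lemma bint_dot f a b : bint f a b = dot mu (one_box a b) f.
Proof.
rewrite /bint Rintegral_mkcond; apply: eq_Rintegral => x _.
by rewrite /one_box !patchE; case: ifP => _; rewrite ?mul1r ?mul0r.
Qed.

Lemma bint_sqr_dot f a b :
  bint (fun x => f x ^+ 2) a b = dot mu (f \_ (box a b)) (f \_ (box a b)).
Proof.
rewrite /bint Rintegral_mkcond; apply: eq_Rintegral => x _.
by rewrite !patchE; case: ifP => _; rewrite ?mul0r ?expr2.
Qed.

Lemma bint_one a b : increasing_pt a b -> dot mu (one_box a b) (one_box a b) = vol a b.
Proof.
move=> ab; rewrite -bint_dot /bint.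
rewrite (@eq_Rintegral _ _ _ _ _ (cst 1)); last first.
  by move=> x xab; rewrite /one_box patchE xab.
rewrite Rintegral_cst ?mul1r; last exact: measurable_box.
transitivity (fine (vol a b)%:E) => //; congr fine.
by apply: leb3_box => i; exact/ltW.
Qed.

Lemma bint_CS f a b : sqint mu f -> increasing_pt a b ->
  bint f a b ^+ 2 <= vol a b * bint (fun x => f x ^+ 2) a b.
Proof.
move=> sf ab; have mQ := measurable_box a b.
rewrite bint_sqr_dot -bint_one//.
rewrite (_ : bint f a b = dot mu (one_box a b) (f \_ (box a b))).
  by apply: dot_CS; [exact: one_box_sqint | exact: sqint_restrict].
rewrite bint_dot; apply: eq_Rintegral => x _; rewrite /one_box !patchE.
by case: ifP => _; rewrite ?mul0r.
Qed.

Lemma sqint_norm f : sqint mu f -> sqint mu (fun x => `|f x|).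
Proof.
move=> [mf if2]; split; first exact: measurableT_comp.
by apply: eq_integrable if2 => // x _ /=; rewrite real_normK ?num_real.
Qed.

Lemma sqr_integrable f (D : set (R3 R)) : mset3 D -> sqint mu f ->
  mu.-integrable D (EFin \o (fun x => f x ^+ 2)).
Proof. by move=> mD [_ i2]; exact: integrableS i2. Qed.

(** ** Density of uniformly continuous functions *)

Definition unif_cont (v : R3 R -> R) := forall w : R, 0 < w ->
  exists2 d : R, 0 < d & forall x y, (forall i, `|coord i x - coord i y| < d) ->
    `|v x - v y| <= w.

(** The Heine-Cantor theorem, in which only one of the two points is in [K]. *)
Lemma compact_unif (K : set (R3 R)) f : compact K -> continuous f ->
  forall e : R, 0 < e -> exists2 d : R, 0 < d &
    forall x y, K x -> (forall i, `|coord i x - coord i y| < d) ->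
      `|f x - f y| <= e.
Proof.
move=> /compact_near_coveringP cK cf e e0.
have bP x d y : ball x d y <-> forall i, `|coord i x - coord i y| < d.
  split=> [[[h1 h2] h3]|h]; first by elim/I3P.
  by split; [split; [exact: (h i1) | exact: (h i2)] | exact: (h i3)].
have := cK R (0^'+) (fun d x => forall y, ball x d y -> `|f x - f y| <= e) _.
move=> [x Kx|d0 /= d0gt0 hd].
  have e2 : 0 < e / 2 by lra.
  have /cvgrPdist_lt/(_ _ e2) := cf x; rewrite -nbhs_ballE => -[r /= r0 hr].
  have r2 : 0 < r / 2 by lra.
  exists (ball x (r / 2), [set d | d < r / 2]) => /=.
    split; first exact: nbhsx_ballx.
    near=> d; near: d; exact: nbhs_right_lt.
  move=> [x' d] /= [xx' dr] y x'y.
  have h1 := hr x' (le_ball (ltac:(lra) : r / 2 <= r) xx').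
  have xy : ball x r y.
    rewrite (splitr r); apply: ball_triangle xx' _; exact: le_ball (ltW dr) _ x'y.
  have h2 := hr y xy.
  rewrite (_ : f x' - f y = - (f x - f x') + (f x - f y)); last by ring.
  by apply: (le_trans (ler_normD _ _)); rewrite normrN; lra.
have d2 : 0 < d0 / 2 by lra.
exists (d0 / 2) => // x y Kx xy; apply: (hd (d0 / 2)) => //=.
- by rewrite sub0r normrN gtr0_norm//; lra.
- exact/bP.
Unshelve. all: by end_near. Qed.

Lemma test_unif U eta : test_function U eta -> unif_cont eta.
Proof.
move=> [se cK _] e e0; have [ce _] := se [::].
have [d d0 KE] := compact_unif cK ce e0.
set K := closure _ in KE.
have out x : ~ K x -> eta x = 0.
  by move=> h; apply/eqP; apply: contraT => n0; case: h; exact: subset_closure.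
exists d => // x y xy.
have [Kx|/out x0] := pselect (K x); first exact: KE.
have [Ky|/out y0] := pselect (K y); last by rewrite x0 y0 subrr normr0 ltW.
by rewrite distrC; apply: KE => // i; rewrite distrC.
Qed.

(** The functions that can be approximated form a closed subspace, which contains
    the test functions; what is orthogonal to all test functions vanishes. *)
Lemma unif_dense f : sqint mu f -> forall e, 0 < e -> exists2 v, sqint mu v &
  dot mu (fun x => f x - v x) (fun x => f x - v x) <= e /\ unif_cont v.
Proof.
pose W := [set u : R3 R -> R | sqint mu u /\ forall e, 0 < e -> exists2 v, sqint mu v &
  dot mu (fun x => u x - v x) (fun x => u x - v x) <= e /\ unif_cont v].
have sh := semi_hilbert_sqint mu.
have dz : dot mu (fun=> 0) (fun=> 0) = 0 := dot0r mu _.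
have WT U eta : test_function U eta -> W eta.
  move=> te; have se := test_sqint te; split => // e e0; exists eta => //; split.
    rewrite (_ : (fun x => _) = fun=> 0) ?dz ?ltW//.
    by apply/funext => x; rewrite subrr.
  exact: test_unif te.
suff WA u : sqint mu u -> W u by move=> /WA[].
move=> su; have [||||p [sp hp] pw] := sh_proj sh (W := W) _ _ _ _ su.
- by move=> v [].
- split; first exact: sqint0.
  move=> e e0; exists (fun=> 0); first exact: sqint0.
  split; last by move=> w w0; exists 1 => // x y _; rewrite subrr normr0 ltW.
  rewrite (_ : (fun x => _) = fun=> 0) ?dz ?ltW//.
  by apply/funext => x; rewrite subrr.
- move=> c y z [sy hy] [sz hz]; split; first exact: sqintL.
  move=> e e0.
  have c1 : 0 < c ^+ 2 + 1 by rewrite ltr_wpDl ?sqr_ge0.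
  have [v sv [yv uv]] := hy (e / 4 / (c ^+ 2 + 1)) ltac:(rewrite !divr_gt0//).
  have [v' sv' [zv' uv']] := hz (e / 4) ltac:(rewrite divr_gt0//).
  exists (fun x => c * v x + v' x); first exact: sqintL.
  split.
    have syv := sqintB sy sv; have szv := sqintB sz sv'.
    have -> : (fun x => (c *: y + z) x - (c * v x + v' x)) =
       c *: (fun x => y x - v x) + (fun x => z x - v' x).
      by apply/funext => x; rewrite /= !fctE /GRing.scale /=; ring.
    have := sh_sqL sh c syv szv; have := sh_sqL sh (- c) syv szv.
    have := dot_ge0 mu ((- c) *: (fun x => y x - v x) + (fun x => z x - v' x)).
    set X := dot mu (fun x => y x - v x) (fun x => y x - v x) in yv *.
    set Z := dot mu (fun x => z x - v' x) (fun x => z x - v' x) in zv' *.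
    move=> h0 h1 h2; rewrite h1 in h0; rewrite h2.
    have : c ^+ 2 * X <= e / 4.
      have X0 : 0 <= X := dot_ge0 _ _.
      move: yv; rewrite ler_pdivlMr// => yv; nra.
    rewrite sqrrN in h0; lra.
  move=> w w0; have c2 : 0 < `|c| + 1 by rewrite ltr_wpDl.
  have [d d0 hd] := uv (w / 2 / (`|c| + 1)) ltac:(rewrite !divr_gt0//).
  have [d' d'0 hd'] := uv' (w / 2) ltac:(rewrite divr_gt0//).
  exists (Num.min d d'); first by rewrite lt_min d0.
  move=> x x' xx'.
  have h1 : `|v x - v x'| <= w / 2 / (`|c| + 1).
    by apply: hd => i; apply: lt_le_trans (xx' i) _; rewrite ge_min lexx.
  have h2 : `|v' x - v' x'| <= w / 2.
    by apply: hd' => i; apply: lt_le_trans (xx' i) _; rewrite ge_min lexx orbT.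
  rewrite (_ : _ - _ = c * (v x - v x') + (v' x - v' x')); last by ring.
  apply: (le_trans (ler_normD _ _)); rewrite normrM.
  move: h1; rewrite ler_pdivlMr// => h1.
  have := normr_ge0 (v x - v x'); have := normr_ge0 c; nra.
- move=> y l Wy sl yl; split => // e e0.
  have e4 : 0 < e / 4 by lra.
  move/cvgrPdist_le : (yl) => /(_ _ e4)[N _ /(_ N (leqnn N))] /=.
  rewrite sub0r normrN ger0_norm ?dot_ge0// => yN.
  have [syN hyN] := Wy N; have [v sv [yv uv]] := hyN _ e4.
  exists v => //; split => //.
  have s1 := sqintB syN sl; have s2 := sqintB syN sv.
  have := sh_sqL sh (-1) s1 s2; have := sh_sqL sh 1 s1 s2.
  have -> : (-1) *: (fun x => y N x - l x) + (fun x => y N x - v x) = fun x => l x - v x.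
    by apply/funext => x; rewrite /= !fctE /GRing.scale /=; ring.
  move=> h1 ->; have := dot_ge0 mu (1 *: (fun x => y N x - l x) + (fun x => y N x - v x)).
  rewrite h1; move: yN yv; rewrite -[y N - l]/(fun x => y N x - l x); lra.
have spu := sqintB su sp.
have ae : {ae mu, forall x, u x = p x}.
  have := @box_ae0 _ setT (fun x => u x - p x) openT spu.1 _ _.
  move=> H; apply: filterS (H _ _) => [x /(_ I)/eqP|a b _|a b _].
  - by rewrite subr_eq0 => /eqP.
  - exact: sqint_integrable_box.
  - have c := cvg_tcutoff spu.1 (sqint_integrable_box a b spu).
    rewrite -(cvg_lim _ c)//; apply: cvg_lim => //.
    rewrite (_ : (fun n => _) = fun=> 0); first exact: cvg_cst.
    apply/funext => n; apply: (pw (tcutoff n a b)).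
    by apply: (WT setT); exact: tcutoff_test.
split => // e e0; have [v sv [pv uv]] := hp e e0; exists v => //; split => //.
have m1 : mfun3 (fun x => u x - v x) by case: (sqintB su sv).
have m2 : mfun3 (fun x => p x - v x) by case: (sqintB sp sv).
have E : {ae mu, forall x, u x - v x = p x - v x} by apply: filterS ae => x ->.
by rewrite (dot_ae_eq m1 m2 m1 E) dotC (dot_ae_eq m1 m2 m2 E).
Qed.

End BoxIntegrals.

(** ** Translates of boxes *)

Section Translation.
Context {R : realType}.
Local Notation mu := (@leb3 R).
Implicit Types (U : set (R3 R)) (f g eta : R3 R -> R) (i j k : 'I_3).
Implicit Types (a b x y : R3 R).

(** A function with compact support whose [i]-th partial derivative is the
    difference of two cutoffs of boxes that are translates of each other. *)
Definition ramp n i (s : R) a b : R3 R -> R := tensor (fun j =>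
  if j == i then fun t => prim n (coord i a) (coord i b) t -
                          prim n (coord i a) (coord i b) (t - s)
  else cutoff n (coord j a) (coord j b)).

Lemma prim_shift_derive n (a b s t : R) : is_derive t 1
  (fun t => prim n a b t - prim n a b (t - s))
  (cutoff n a b t - cutoff n (a + s) (b + s) t).
Proof.
have d1 := is_derive_prim n a b t.
have d2 := @is_derive1_comp _ (prim n a b) (fun t => t - s) t _ _
  (is_derive_prim n a b (t - s)) (is_derive_shift t 1 (- s)).
rewrite mulr1 cutoff_shift in d2; exact: (is_deriveB d1 d2).
Qed.

Lemma ramp_smooth n i s a b j : smooth1 ((fun j =>
  if j == i then fun t : R => prim n (coord i a) (coord i b) t -
                          prim n (coord i a) (coord i b) (t - s)
  else cutoff n (coord j a) (coord j b)) j).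
Proof.
rewrite /=; case: ifP => _; last exact: cutoff_smooth.
apply: (@smooth1_prim _ _ (fun t => cutoff n (coord i a) (coord i b) t +
   (-1) * cutoff n (coord i a + s) (coord i b + s) t)).
  by move=> t; rewrite mulN1r; exact: prim_shift_derive.
apply: smooth1_add; first exact: cutoff_smooth.
by apply: smooth1_mul; [exact: smooth1_cst | exact: cutoff_smooth].
Qed.

Definition shiftc i s a : R3 R := setc i (coord i a + s) a.

Lemma derive_ramp n i s a b x : is_derive x (evec i) (ramp n i s a b)
  (tcutoff n a b x - tcutoff n (shiftc i s a) (shiftc i s b) x).
Proof.
have := @derive_tensor _ (fun j =>
  if j == i then fun t : R => prim n (coord i a) (coord i b) t -
                          prim n (coord i a) (coord i b) (t - s)
  else cutoff n (coord j a) (coord j b)) i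
  (fun t => cutoff n (coord i a) (coord i b) t - cutoff n (coord i a + s) (coord i b + s) t).
rewrite eqxx => /(_ (prim_shift_derive n (coord i a) (coord i b) s) x) h.
apply: is_derive_eq h _; rewrite /tcutoff /tensor !(bigD1 (P := predT) i)//= eqxx.
rewrite /shiftc !coord_setc eqxx mulrBl; congr (_ - _ * _).
  by congr (_ * _); apply: eq_bigr => j /negbTE ->.
by apply: eq_bigr => j /negbTE ji; rewrite !coord_setc ji.
Qed.

Lemma ramp_out n i s a b x : 0 <= s -> ~ box a (shiftc i s b) x -> ramp n i s a b x = 0.
Proof.
move=> s0 /existsNP[j /negP]; rewrite /shiftc coord_setc => h.
apply/eqP/prodf_eq0; exists j => //; apply/eqP; move: h.
case: (eqVneq j i) => [->|ji] h; last first.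
  apply: cutoff_out; apply: contra h => /andP[].
  by move: (n.+1%:R^-1 : R) (@inv_natS_gt0 R n) => e e0 h1 h2; apply/andP; split; lra.
rewrite negb_and -leNgt -ltNge in h; have /orP[xa|bx] := h.
  have e0 := @inv_natS_gt0 R n.
  by rewrite !prim_left ?subrr//; move: (n.+1%:R^-1 : R) e0 => e e0; lra.
apply/eqP; rewrite subr_eq0; apply/eqP/prim_right;
  by move: (n.+1%:R^-1 : R) (@inv_natS_gt0 R n) => e e0; lra.
Qed.

Lemma ramp_le n i s a b x : coord i a <= coord i b ->
  `|ramp n i s a b x| <= coord i b - coord i a.
Proof.
move=> ab; rewrite /ramp /tensor (bigD1 i)//= eqxx normrM.
rewrite -[leRHS]mulr1; apply: ler_pM => //.
  have h1 := prim_ge0 n (coord i a) (coord i b) (coord i x).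
  have h2 := prim_ge0 n (coord i a) (coord i b) (coord i x - s).
  have h3 := prim_le n (coord i x) ab; have h4 := prim_le n (coord i x - s) ab.
  by rewrite ler_norml; apply/andP; split; lra.
rewrite normr_prod [leRHS](_ : 1 = \prod_(j < 3 | j != i) 1); last by rewrite big1.
apply: ler_prod => j /negbTE ->.
by rewrite normr_ge0 ger0_norm ?cutoff_ge0// cutoff_le1.
Qed.

Lemma ramp_test U n i s a b : 0 <= s -> box a (shiftc i s b) `<=` U ->
  test_function U (ramp n i s a b).
Proof.
move=> s0 abU; apply: (@test_tensor _ _ _ (fun j => coord j a + n.+1%:R^-1)
  (fun j => (if j == i then coord j b + s else coord j b) - n.+1%:R^-1)).
- exact: ramp_smooth.
- move=> j t /=; case: (eqVneq j i) => [->|ji] h; last first.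
    by apply: cutoff_out; apply: contra h => /andP[h1 h2]; rewrite !ltW.
  rewrite negb_and -!ltNge in h; have /orP[ta|bt] := h.
    by rewrite !prim_left ?subrr//; move: (n.+1%:R^-1 : R) ta => e ta; lra.
  apply/eqP; rewrite subr_eq0; apply/eqP/prim_right;
    by move: (n.+1%:R^-1 : R) bt => e bt; lra.
- move=> x h; apply: abU => j; have /andP[] := h j; rewrite /shiftc coord_setc.
  move: (n.+1%:R^-1 : R) (@inv_natS_gt0 R n) => e e0 h1 h2; apply/andP; split; first lra.
  by move: h2; case: (eqVneq j i) => [->|ji] h2; lra.
Qed.

(** Test the weak derivative with [ramp] and let [n] grow. *)
Lemma translate_estimate U i f g s a b : L2 U f -> L2 U g ->
  is_weak_partial U i f g -> 0 <= s -> coord i a <= coord i b ->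
  box a (shiftc i s b) `<=` U ->
  `|bint (f \_ U) a b - bint (f \_ U) (shiftc i s a) (shiftc i s b)| <=
  (coord i b - coord i a) * bint (fun x => `|(g \_ U) x|) a (shiftc i s b).
Proof.
move=> /L2_sqint sf /L2_sqint sg /is_weak_partialE wfg s0 ab abU.
set a' := shiftc i s a; set b' := shiftc i s b.
have c1 := cvg_tcutoff sf.1 (sqint_integrable_box a b sf).
have c2 := cvg_tcutoff sf.1 (sqint_integrable_box a' b' sf).
have st n (p q : R3 R) : sqint mu (tcutoff n p q).
  by apply: (@test_sqint _ setT); exact: tcutoff_test.
have E n : dot mu (f \_ U) (tcutoff n a b) - dot mu (f \_ U) (tcutoff n a' b') =
    - dot mu (g \_ U) (ramp n i s a b).
  have tr := ramp_test n s0 abU.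
  rewrite -wfg// opprK (dotC mu (f \_ U) (tcutoff n a b)) (dotC mu (f \_ U) (tcutoff n a' b')).
  rewrite -dotB// dotC.
  congr (dot _ _ _); apply/funext => x.
  by have [_ ->] := derive_ramp n i s a b x.
have c : `|dot mu (f \_ U) (tcutoff n a b) - dot mu (f \_ U) (tcutoff n a' b')|
    @[n --> \oo] --> `|bint (f \_ U) a b - bint (f \_ U) a' b'|.
  by apply: cvg_norm; exact: cvgB.
apply: (ler_cvg_to c (cvg_cst _)); apply: nearW => n; rewrite E.
have sr := test_sqint (ramp_test n s0 abU).
rewrite normrN; apply: (le_trans (le_normr_Rintegral measurableT (sqint_mul sg sr))).
rewrite bint_dot -[X in _ <= _ * X]/(\int[mu]_x _).
have i1 := sqint_mul (one_box_sqint a b') (sqint_norm sg).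
rewrite -RintegralZl//.
apply: le_Rintegral => //.
- by have := integrable_norm (sqint_mul sg sr).
- by have := integrableZl measurableT (coord i b - coord i a) i1.
move=> x _; rewrite normrM one_boxE; case: ifPn => [_|/negP h].
  by rewrite mul1r mulrC ler_wpM2r// ramp_le.
by rewrite ramp_out// ?normr0 ?mul0r ?mulr0// => hx; apply: h; exact: mem_set.
Qed.

End Translation.

(** * Bisection of boxes *)

Section Bisection.
Context {R : realType}.
Local Notation mu := (@leb3 R).
Implicit Types (U : set (R3 R)) (f g eta : R3 R -> R) (i j k : 'I_3).
Implicit Types (a b x y : R3 R) (q : R3 R * R3 R) (F G : R3 R * R3 R -> R).

Lemma bint_split f i (c : R) a b : mu.-integrable (box a b) (EFin \o f) ->
  coord i a <= c -> c <= coord i b ->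
  bint f a b = bint f a (setc i c b) + bint f (setc i c a) b.
Proof.
move=> fi ac cb.
have E : box a b = box a (setc i c b) `|` box (setc i c a) b.
  apply/seteqP; split=> [x xab|x].
    have [xc|cx] := leP (coord i x) c; [left|right] => j; have := xab j;
      rewrite coord_setc; case: eqP => // -> /andP[h1 h2]; first by rewrite h1.
    by rewrite cx.
  by case=> h j; have := h j; rewrite coord_setc; case: eqP => // -> /andP[h1 h2];
    apply/andP; split=> //; [exact: le_trans cb|exact: le_lt_trans h1].
rewrite /bint E Rintegral_setU//; [exact: measurable_box|exact: measurable_box|by rewrite -E|].
apply/disj_setPS => x [/(_ i) + /(_ i)]; rewrite !coord_setc eqxx.
by move=> /andP[_ h1] /andP[h2 _]; have := lt_le_trans h2 h1; rewrite ltxx.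
Qed.

Definition mid i q : R := (coord i q.1 + coord i q.2) / 2.
Definition lo i q : R3 R * R3 R := (q.1, setc i (mid i q) q.2).
Definition hi i q : R3 R * R3 R := (setc i (mid i q) q.1, q.2).

(** Sums over the two halves and the eight octants of a box. Iterating [oct] sums
    over finer and finer dyadic partitions without naming their parts. *)
Definition bis i F q : R := F (lo i q) + F (hi i q).
Definition oct F : R3 R * R3 R -> R := bis i1 (bis i2 (bis i3 F)).

Definition fits (l : 'I_3 -> R) U q :=
  (forall j, 0 < coord j q.2 - coord j q.1 <= l j) /\ box q.1 q.2 `<=` U.

Definition halve i (l : 'I_3 -> R) j : R := if j == i then l j / 2 else l j.

Lemma fits_incr l U q : fits l U q -> increasing_pt q.1 q.2.
Proof. by move=> [h _] j; have /andP[] := h j; rewrite subr_gt0. Qed.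

Lemma incr_fits q : increasing_pt q.1 q.2 ->
  fits (fun=> \sum_j (coord j q.2 - coord j q.1)) setT q.
Proof.
move=> h; split => // j; rewrite subr_gt0 h /= (bigD1 j)//= lerDl.
by apply: sumr_ge0 => k _; rewrite subr_ge0 ltW.
Qed.

Lemma fits_lo l U i q : fits l U q -> fits (halve i l) U (lo i q).
Proof.
move=> [h qU]; split=> [j|x xq]; rewrite /halve /=.
  have := h j; rewrite coord_setc /mid; case: eqP => [->|//] /andP[h1 h2].
  by apply/andP; split; lra.
apply: qU => j; have := xq j; rewrite /= coord_setc /mid; case: eqP => [->|//].
by have /andP[h1 h2] := h i => /andP[h3 h4]; apply/andP; split; lra.
Qed.

Lemma fits_hi l U i q : fits l U q -> fits (halve i l) U (hi i q).
Proof.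
move=> [h qU]; split=> [j|x xq]; rewrite /halve /=.
  have := h j; rewrite coord_setc /mid; case: eqP => [->|//] /andP[h1 h2].
  by apply/andP; split; lra.
apply: qU => j; have := xq j; rewrite /= coord_setc /mid; case: eqP => [->|//].
by have /andP[h1 h2] := h i => /andP[h3 h4]; apply/andP; split; lra.
Qed.

Lemma bis_mono l U i F G q : fits l U q ->
  (forall q', fits (halve i l) U q' -> F q' <= G q') -> bis i F q <= bis i G q.
Proof. by move=> fq FG; apply: lerD; apply: FG; [exact: fits_lo | exact: fits_hi]. Qed.

Lemma halve3 (L : R) : halve i3 (halve i2 (halve i1 (fun=> L))) = fun=> L / 2.
Proof. by apply/funext => j; rewrite /halve; elim/I3P : j. Qed.

Lemma oct_mono (L : R) U F G q : fits (fun=> L) U q ->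
  (forall q', fits (fun=> L / 2) U q' -> F q' <= G q') -> oct F q <= oct G q.
Proof.
move=> fq FG; apply: (bis_mono fq) => q1 f1; apply: (bis_mono f1) => q2 f2.
by apply: (bis_mono f2) => q3; rewrite halve3; exact: FG.
Qed.

Lemma iter_oct_mono n (L : R) U F G q : fits (fun=> L) U q ->
  (forall q', fits (fun=> L / 2 ^+ n) U q' -> F q' <= G q') ->
  iter n oct F q <= iter n oct G q.
Proof.
elim: n L q => [|n IH] L q fq FG /=; first by apply: FG; rewrite expr0 divr1.
apply: (oct_mono fq) => q' f'; apply: (IH (L / 2)) => // q'' f''; apply: FG.
by rewrite exprS invfM mulrA.
Qed.

Lemma iter_oct_lin n F G (c : R) q :
  iter n oct (fun q => F q + c * G q) q = iter n oct F q + c * iter n oct G q.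
Proof.
elim: n q => [//|n IH] q /=; rewrite [in LHS](funext IH) /oct /bis; ring.
Qed.

Lemma oct_additive F q : (forall i q, increasing_pt q.1 q.2 -> F q = bis i F q) ->
  increasing_pt q.1 q.2 -> oct F q = F q.
Proof.
move=> FE qi; have fq := incr_fits qi; rewrite [RHS](FE i1)//.
have E l i q' : fits l setT q' -> bis i F q' = F q'.
  by move=> /fits_incr h; rewrite -FE.
have f1 := fits_lo i1 fq; have f2 := fits_hi i1 fq.
rewrite /oct {1 4}/bis; congr (_ + _).
  rewrite {1}/bis (E _ _ _ (fits_lo i2 f1)) (E _ _ _ (fits_hi i2 f1)).
  exact: E f1.
rewrite {1}/bis (E _ _ _ (fits_lo i2 f2)) (E _ _ _ (fits_hi i2 f2)).
exact: E f2.
Qed.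

Lemma iter_oct_additive n F q :
  (forall i q, increasing_pt q.1 q.2 -> F q = bis i F q) ->
  increasing_pt q.1 q.2 -> iter n oct F q = F q.
Proof.
move=> FE; elim: n q => [//|n IH] q qi /=; rewrite -[RHS](oct_additive FE qi).
apply/eqP; rewrite eq_le; apply/andP; split; apply: (oct_mono
    (incr_fits qi)) => q' /fits_incr qi';
  by rewrite IH.
Qed.

Lemma bint_bis f i q : (forall a b, mu.-integrable (box a b) (EFin \o f)) ->
  increasing_pt q.1 q.2 ->
  bint f q.1 q.2 = bis i (fun q => bint f q.1 q.2) q.
Proof.
move=> fi qi; have h := qi i; rewrite (@bint_split f i (mid i q))//.
- by rewrite /mid; lra.
- by rewrite /mid; lra.
Qed.

Lemma vol_lo i q : vol (lo i q).1 (lo i q).2 = vol q.1 q.2 / 2.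
Proof.
rewrite /vol (bigD1 i)//= [in RHS](bigD1 i)//= coord_setc eqxx /mid.
rewrite (eq_bigr (fun j => coord j q.2 - coord j q.1)); first by field.
by move=> j /negbTE ji; rewrite coord_setc ji.
Qed.

Lemma vol_hi i q : vol (hi i q).1 (hi i q).2 = vol q.1 q.2 / 2.
Proof.
rewrite /vol (bigD1 i)//= [in RHS](bigD1 i)//= coord_setc eqxx /mid.
rewrite (eq_bigr (fun j => coord j q.2 - coord j q.1)); first by field.
by move=> j /negbTE ji; rewrite coord_setc ji.
Qed.

(** The squared distance of [f] to the constants in [L^2] of a box. *)
Definition variance f q : R :=
  bint (fun x => f x ^+ 2) q.1 q.2 - bint f q.1 q.2 ^+ 2 / vol q.1 q.2.

Lemma sqint_locint f : sqint mu f ->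
  forall a b, mu.-integrable (box a b) (EFin \o f).
Proof. by move=> sf a b; exact: sqint_integrable_box. Qed.

Lemma sqint_locint2 f : sqint mu f ->
  forall a b, mu.-integrable (box a b) (EFin \o (fun x => f x ^+ 2)).
Proof. by move=> sf a b; apply: sqr_integrable => //; exact: measurable_box. Qed.

(** Bisection lowers the variance by the squared coefficient of a Haar
    function, which [translate_estimate] bounds by the partial derivative. *)
Lemma variance_bis U i f g l q : L2 U f -> L2 U g -> is_weak_partial U i f g ->
  fits l U q ->
  variance (f \_ U) q <= bis i (variance (f \_ U)) q +
    (l i / 2) ^+ 2 * bint (fun x => (g \_ U) x ^+ 2) q.1 q.2.
Proof.
move=> Lf Lg wfg fq; have qi := fits_incr fq.
have sf := (L2_sqint _ _).1 Lf; have sg := (L2_sqint _ _).1 Lg.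
have [/(_ i)/andP[h1 h2] qU] := fq.
rewrite /variance (bint_bis i (sqint_locint2 sf) qi) (bint_bis i (sqint_locint sf) qi).
rewrite /bis vol_lo vol_hi.
pose s := mid i q - coord i q.1.
have s0 : 0 <= s by rewrite /s /mid; lra.
have sE : shiftc i s (setc i (mid i q) q.2) = q.2.
  apply: coord_inj => j; rewrite /shiftc !coord_setc eqxx /s /mid.
  by case: eqP => [->|//]; field.
have aE : shiftc i s q.1 = setc i (mid i q) q.1.
  by rewrite /shiftc /s addrC subrK.
have := @translate_estimate _ U i f g s q.1 (setc i (mid i q) q.2) Lf Lg wfg s0.
rewrite sE aE !coord_setc eqxx -/s -subr_ge0 -/s => /(_ s0 qU) est.
have := bint_CS (sqint_norm sg) qi.
rewrite [X in _ * X](_ : _ = bint (fun x => (g \_ U) x ^+ 2) q.1 q.2); last first.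
  by apply: eq_Rintegral => x _; rewrite real_normK ?num_real.
set H := bint (fun x => `|(g \_ U) x|) _ _ in est *.
set G := bint (fun x => (g \_ U) x ^+ 2) _ _.
have V0 := vol_gt0 qi; set V := vol _ _ in V0 * => HV.
move: est => /=; set A := bint (f \_ U) _ (setc _ _ _); set B :=
    bint (f \_ U) (setc _ _ _) _ => est.
have ABs : (A - B) ^+ 2 <= (s * H) ^+ 2.
  by rewrite -[leLHS]real_normK ?num_real// ler_sqr ?nnegrE// (le_trans _ est).
have sl : s ^+ 2 <= (l i / 2) ^+ 2 by rewrite ler_sqr ?nnegrE//; rewrite /s /mid; lra.
have G0 : 0 <= G by apply: Rintegral_ge0 => x _; exact: sqr_ge0.
have fin : (A - B) ^+ 2 / V <= (l i / 2) ^+ 2 * G.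
  rewrite ler_pdivrMr//; apply: (le_trans ABs); rewrite exprMn.
  apply: (@le_trans _ _ (s ^+ 2 * (V * G))); first by rewrite ler_wpM2l ?sqr_ge0.
  rewrite [leRHS](_ : _ = (l i / 2) ^+ 2 * (V * G)); last by ring.
  by apply: ler_wpM2r => //; rewrite mulr_ge0// ltW.
set QA := bint _ q.1 (setc _ _ _); set QB := bint _ (setc _ _ _) q.2.
(* [2 (A^2 + B^2) - (A + B)^2 = (A - B)^2], where [A] and [B] are the integrals
   over the halves *)
rewrite -subr_ge0; move: fin; rewrite -subr_ge0; congr (0 <= _).
by field; rewrite gt_eqF.
Qed.

End Bisection.

(** * The Poincare inequality and Rellich's theorem on boxes *)

Section Poincare.
Context {R : realType}.
Local Notation mu := (@leb3 R).
Implicit Types (U : set (R3 R)) (f g eta : R3 R -> R) (i j k : 'I_3).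
Implicit Types (a b x y : R3 R) (q : R3 R * R3 R) (F G : R3 R * R3 R -> R).

Definition dirichlet (g : 'I_3 -> R3 R -> R) q : R :=
  \sum_i bint (fun x => g i x ^+ 2) q.1 q.2.

Lemma bint_sqr_ge0 f a b : 0 <= bint (fun x => f x ^+ 2) a b.
Proof. by apply: Rintegral_ge0 => x _; exact: sqr_ge0. Qed.

Lemma bint_le_dot f a b : sqint mu f ->
  bint (fun x => f x ^+ 2) a b <= dot mu f f.
Proof.
move=> sf; have mQ := measurable_box a b.
rewrite bint_sqr_dot; have sfQ := sqint_restrict mQ sf.
apply: le_Rintegral => //; [exact: sqint_mul|exact: sqint_mul|].
by move=> x _; rewrite patchE; case: ifP => _; rewrite ?mul0r// -expr2 sqr_ge0.
Qed.

(** One bisection in each direction. *)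
Lemma variance_oct U f (g : 'I_3 -> R3 R -> R) (L : R) q : L2 U f ->
  (forall i, L2 U (g i)) -> (forall i, is_weak_partial U i f (g i)) ->
  fits (fun=> L) U q ->
  variance (f \_ U) q <= oct (variance (f \_ U)) q +
    (L / 2) ^+ 2 * dirichlet (fun i => g i \_ U) q.
Proof.
move=> Lf Lg wfg fq; pose c := (L / 2) ^+ 2.
pose E i q := bint (fun x => (g i \_ U) x ^+ 2) q.1 q.2.
have EE i j q' : increasing_pt q'.1 q'.2 -> bis j (E i) q' = E i q'.
  move=> qi; rewrite [RHS](bint_bis j)//; apply: sqint_locint2.
  exact: (L2_sqint _ _).1.
have V i l q' : fits l U q' -> l i = L ->
    variance (f \_ U) q' <= bis i (variance (f \_ U)) q' + c * E i q'.
  by move=> f' lL; have := variance_bis Lf (Lg i) (wfg i) f'; rewrite lL.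
have lin i F G q' : bis i (fun q => F q + c * G q) q' = bis i F q' + c * bis i G q'.
  by rewrite /bis; ring.
have qi := fits_incr fq.
have h1 := V i1 _ _ fq erefl.
have h2 : bis i1 (variance (f \_ U)) q <=
    bis i1 (bis i2 (variance (f \_ U))) q + c * E i2 q.
  rewrite -[E i2 q](EE i2 i1)// -lin; apply: (bis_mono fq) => q1 f1.
  exact: (V i2 _ _ f1).
have h3 : bis i1 (bis i2 (variance (f \_ U))) q <=
    oct (variance (f \_ U)) q + c * E i3 q.
  rewrite -[E i3 q](EE i3 i1)// -lin; apply: (bis_mono fq) => q1 f1.
  rewrite -[E i3 q1](EE i3 i2) -?lin; last exact: fits_incr f1.
  by apply: (bis_mono f1) => q2 f2; exact: (V i3 _ _ f2).
rewrite /dirichlet big_I3 -/c -/(E i1 q) -/(E i2 q) -/(E i3 q); lra.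
Qed.

Lemma dirichlet_additive (g : 'I_3 -> R3 R -> R) i q :
  (forall i, sqint mu (g i)) -> increasing_pt q.1 q.2 ->
  dirichlet g q = bis i (dirichlet g) q.
Proof.
move=> sg qi; rewrite /dirichlet /bis -big_split /=; apply: eq_bigr => j _.
by rewrite (bint_bis i)//; exact: sqint_locint2.
Qed.

Lemma dirichlet_ge0 (g : 'I_3 -> R3 R -> R) q : 0 <= dirichlet g q.
Proof. by apply: sumr_ge0 => i _; exact: bint_sqr_ge0. Qed.

(** The errors of successive subdivisions decrease geometrically with ratio 1/4,
    because the side lengths are halved. *)
Lemma variance_iter U f (g : 'I_3 -> R3 R -> R) n (L : R) q : L2 U f ->
  (forall i, L2 U (g i)) -> (forall i, is_weak_partial U i f (g i)) ->
  fits (fun=> L) U q ->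
  variance (f \_ U) q <= iter n oct (variance (f \_ U)) q +
    L ^+ 2 * dirichlet (fun i => g i \_ U) q.
Proof.
move=> Lf Lg wfg; have sg i : sqint mu (g i \_ U) by exact: (L2_sqint _ _).1.
elim: n L q => [|n IH] L q fq /=.
  by rewrite lerDl mulr_ge0 ?sqr_ge0 ?dirichlet_ge0.
have h := variance_oct Lf Lg wfg fq; have qi := fits_incr fq.
have dE := oct_additive (fun i q => dirichlet_additive i sg) qi.
have h' : oct (variance (f \_ U)) q <= oct (iter n oct (variance (f \_ U))) q +
    (L / 2) ^+ 2 * dirichlet (fun i => g i \_ U) q.
  rewrite -[X in _ * X]dE -(iter_oct_lin 1).
  by apply: (oct_mono fq) => q' f'; exact: IH.
have D0 := dirichlet_ge0 (fun i => g i \_ U) q.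
have : 0 <= L ^+ 2 * dirichlet (fun i => g i \_ U) q by rewrite mulr_ge0 ?sqr_ge0.
move: h h'; rewrite (_ : (L / 2) ^+ 2 = L ^+ 2 / 4); last by field.
lra.
Qed.

Lemma fine_leb3_box a b : increasing_pt a b -> fine (mu (box a b)) = vol a b.
Proof.
move=> ab; transitivity (fine (vol a b)%:E) => //; congr fine.
by apply: leb3_box => j; exact/ltW.
Qed.

Lemma box_integrable_cst a b (c : R) :
  mu.-integrable (box a b) (EFin \o (fun=> c)).
Proof.
apply: measurable_bounded_integrable; first exact: measurable_box.
- exact: leb3_box_fin.
- exact: measurable_cst.
by exists (`|c|); split; [exact: num_real|move=> z /ltW h x _].
Qed.

Lemma variance_le_cst f q (c : R) : sqint mu f -> increasing_pt q.1 q.2 ->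
  variance f q <= bint (fun x => (f x - c) ^+ 2) q.1 q.2.
Proof.
move=> sf qi; have mQ := measurable_box q.1 q.2.
have i1 := sqint_locint sf q.1 q.2; have i2 := sqint_locint2 sf q.1 q.2.
have V0 := vol_gt0 qi.
have fc := fine_leb3_box qi.
have ic := box_integrable_cst q.1 q.2 (c ^+ 2).
have E : bint (fun x => (f x - c) ^+ 2) q.1 q.2 =
    bint (fun x => f x ^+ 2) q.1 q.2 - 2 * c * bint f q.1 q.2 + c ^+ 2 * vol q.1 q.2.
  rewrite /bint -RintegralZl// -RintegralB//; last first.
    by have := integrableZl mQ (2 * c) i1.
  rewrite -fc -Rintegral_cst// -RintegralD//; last first.
    have := integrableB mQ i2 (integrableZl mQ (2 * c) i1).
    by apply: eq_integrable => // x _; rewrite /= EFinB EFinM.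
  by apply: eq_Rintegral => x _; ring.
rewrite E /variance; set J := bint f _ _; set Q := bint _ _ _.
have : 0 <= (J - c * vol q.1 q.2) ^+ 2 / vol q.1 q.2.
  by rewrite divr_ge0 ?sqr_ge0 ?ltW.
rewrite (_ : _ / _ = J ^+ 2 / vol q.1 q.2 - 2 * c * J + c ^+ 2 * vol q.1 q.2).
  by lra.
by field; rewrite gt_eqF.
Qed.

(** The function is close to a uniformly continuous one, which is nearly constant
    on small boxes. *)
Lemma variance_small f q (e : R) : sqint mu f -> increasing_pt q.1 q.2 -> 0 < e ->
  exists n, iter n oct (variance f) q <= e.
Proof.
move=> sf qi e0; have V0 := vol_gt0 qi.
have e4 : 0 < e / 4 by lra.
have [v sv [fv uv]] := unif_dense sf e4.
pose w := Num.sqrt (e / 4 / vol q.1 q.2).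
have w0 : 0 < w by rewrite sqrtr_gt0 divr_gt0.
have [d d0 hd] := uv w w0.
have fq := incr_fits qi; set L := \sum_j _ in fq.
have L0 : 0 < L by have [/(_ i1)/andP[h1 h2] _] := fq; exact: lt_le_trans h2.
have [n hn] : exists n, L / 2 ^+ n < d.
  have n2 n : (n%:R <= 2 ^+ n :> R).
    by rewrite -natrX ler_nat ltnW// ltn_expl.
  exists (Num.bound (L / d)).+1; rewrite ltr_pdivrMr ?exprn_gt0// mulrC -ltr_pdivrMr//.
  apply: lt_le_trans (n2 _).
  apply: (lt_le_trans (archi_boundP _)); first by rewrite divr_ge0// ltW.
  by rewrite ler_nat.
exists n.
have sfv := sqintB sf sv.
pose Q q' := bint (fun x => (f x - v x) ^+ 2) q'.1 q'.2.
have main : iter n oct (variance f) q <=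
    iter n oct (fun q' => 2 * w ^+ 2 * vol q'.1 q'.2 + 2 * Q q') q.
  apply: (iter_oct_mono fq) => q' f'; have qi' := fits_incr f'.
  (* compare with the value of [v] at a corner *)
  apply: (le_trans (variance_le_cst (v q'.2) sf qi')).
  have mQ := measurable_box q'.1 q'.2.
  rewrite /Q /bint -(fine_leb3_box qi') -Rintegral_cst// -RintegralZl//;
      last exact: sqint_locint2.
  have icst := box_integrable_cst q'.1 q'.2.
  have i2 : mu.-integrable (box q'.1 q'.2) (EFin \o (fun x => 2 * (f x - v x) ^+ 2)).
    by have := integrableZl mQ 2 (sqint_locint2 sfv q'.1 q'.2).
  rewrite -RintegralD//; apply: le_Rintegral => //.
  - have := integrableD mQ (sqint_locint2 sf q'.1 q'.2)
      (integrableD mQ (integrableZl mQ (- 2 * v q'.2) (sqint_locint sf q'.1 q'.2)) (icst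
          (v q'.2 ^+ 2))).
    apply: eq_integrable => // x _; rewrite /= -EFinM -!EFinD; congr EFin; ring.
  - by have := integrableD mQ (icst (2 * w ^+ 2)) i2.
  move=> x xq.
  have xw : `|v x - v q'.2| <= w.
    apply: hd => j; have /andP[h1 h2] := xq j.
    have [/(_ j)/andP[h3 h4] _] := f'.
    rewrite ler0_norm ?subr_le0//; apply: le_lt_trans hn; lra.
  have xw2 : (v x - v q'.2) ^+ 2 <= w ^+ 2.
    by rewrite -[leLHS]real_normK ?num_real// ler_sqr ?nnegrE// ltW.
  have := sqr_ge0 (v x - v q'.2 - (f x - v x)); nra.
apply: (le_trans main); rewrite iter_oct_additive//; last first.
  move=> i q' qi'; rewrite /bis vol_lo vol_hi /Q (bint_bis i)//; last exact: sqint_locint2.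
  by rewrite /bis; field.
have Qe : Q q <= e / 4 by apply: le_trans fv; exact: bint_le_dot.
have we : w ^+ 2 * vol q.1 q.2 = e / 4.
  by rewrite sqr_sqrtr ?divfK ?gt_eqF// divr_ge0 ?ltW.
rewrite -mulrA we; lra.
Qed.

(** Under repeated subdivision the sum of the variances tends to zero. *)
Lemma poincare U f (g : 'I_3 -> R3 R -> R) (L : R) q : L2 U f ->
  (forall i, L2 U (g i)) -> (forall i, is_weak_partial U i f (g i)) ->
  fits (fun=> L) U q ->
  variance (f \_ U) q <= L ^+ 2 * dirichlet (fun i => g i \_ U) q.
Proof.
move=> Lf Lg wfg fq; apply/ler_addgt0Pl => e e0.
have [n hn] := variance_small ((L2_sqint _ _).1 Lf) (fits_incr fq) e0.
by apply: (le_trans (variance_iter n Lf Lg wfg fq)); rewrite lerD2r.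
Qed.

Lemma iter_oct_cvg0 n (F : nat -> R3 R * R3 R -> R) q :
  (forall q', increasing_pt q'.1 q'.2 -> F j q' @[j --> \oo] --> 0) ->
  increasing_pt q.1 q.2 -> iter n oct (F j) q @[j --> \oo] --> 0.
Proof.
move=> F0; elim: n q => [|n IH] q qi /=; first exact: F0.
pose G j := iter n oct (F j).
have B i (H : nat -> R3 R * R3 R -> R) : (forall q', increasing_pt q'.1 q'.2 -> H j q'
    @[j --> \oo] --> 0) ->
    forall q', increasing_pt q'.1 q'.2 -> bis i (H j) q' @[j --> \oo] --> 0.
  move=> H0 q' qi'; rewrite -[X in _ --> X]addr0; apply: cvgD; apply: H0.
    exact: fits_incr (fits_lo i (incr_fits qi')).
  exact: fits_incr (fits_hi i (incr_fits qi')).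
exact: (B _ _ (B _ _ (B _ _ IH))).
Qed.

(** On a partition into small boxes the Poincare inequality bounds the integral of
    [w n ^ 2] by the squares of finitely many means, which tend to zero by weak
    convergence, up to an error that is as small as the boxes. *)
Lemma rellich_box U (w : nat -> R3 R -> R) (g : nat -> 'I_3 -> R3 R -> R) (K : R) a b :
  box a b `<=` U -> (forall n, L2 U (w n)) -> (forall n i, L2 U (g n i)) ->
  (forall n i, is_weak_partial U i (w n) (g n i)) ->
  (forall n, \sum_i dot mu (g n i \_ U) (g n i \_ U) <= K) ->
  (forall h, sqint mu h -> dot mu (w n \_ U) h @[n --> \oo] --> 0) ->
  bint (fun x => (w n \_ U) x ^+ 2) a b @[n --> \oo] --> 0.
Proof.
move=> abU Lw Lg wg gK w0; pose q := (a, b).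
have [qi|/existsNP[i /negP]] := pselect (increasing_pt a b); last first.
  rewrite -leNgt => /box_empty E.
  rewrite (_ : (fun n => _) = fun=> 0); first exact: cvg_cst.
  by apply/funext => n; rewrite /bint E Rintegral_set0.
have K0 : 0 <= K.
  by apply: le_trans (gK 0%N); apply: sumr_ge0 => i _; exact: dot_ge0.
have sw n := (L2_sqint _ _).1 (Lw n).
have sg n i := (L2_sqint _ _).1 (Lg n i).
have fq : fits (fun=> \sum_j (coord j b - coord j a)) U q.
  by split => //; case: (incr_fits (q := q) qi).
set L := \sum_j _ in fq.
have L0 : 0 < L by have [/(_ i1)/andP[h1 h2] _] := fq; exact: lt_le_trans h2.
apply/cvgrPdist_le => e e0.
have [m hm] : exists m, (L / 2 ^+ m) ^+ 2 * K <= e / 2.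
  have n2 n : (n%:R <= 2 ^+ n :> R).
    by rewrite -natrX ler_nat ltnW// ltn_expl.
  pose m := (Num.bound (L ^+ 2 * K / (e / 2))).+1.
  have m1 : 1 <= 2 ^+ m :> R by rewrite exprn_ege1//; lra.
  have m0 : 0 < 2 ^+ m :> R by rewrite exprn_gt0.
  exists m; apply: (@le_trans _ _ (L ^+ 2 * K / 2 ^+ m)).
    rewrite expr_div_n mulrAC; apply: ler_wpM2l; first by rewrite mulr_ge0 ?sqr_ge0.
    by rewrite lef_pV2 ?posrE ?exprn_gt0// expr2 ler_peMr// ltW.
  have e2 : 0 < e / 2 by lra.
  rewrite ler_pdivrMr// [leRHS]mulrC -ler_pdivrMr//; apply: le_trans (n2 _).
  apply: (le_trans (ltW (archi_boundP _))); first by apply: divr_ge0;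
      [rewrite mulr_ge0 ?sqr_ge0 | exact: ltW].
  by rewrite ler_nat.
(* the part of the square integral that the variance leaves out *)
pose M n q' : R := bint (w n \_ U) q'.1 q'.2 ^+ 2 / vol q'.1 q'.2.
have Mc : iter m oct (M n) q @[n --> \oo] --> 0.
  apply: iter_oct_cvg0 => // q' qi'.
  rewrite (_ : (0 : R) = 0 * 0 * (vol q'.1 q'.2)^-1); last by rewrite !mul0r.
  apply: cvgM; last exact: cvg_cst.
  have c : bint (w n \_ U) q'.1 q'.2 @[n --> \oo] --> 0.
    have := w0 _ (one_box_sqint q'.1 q'.2); apply: cvg_trans; apply: near_eq_cvg.
    by apply: nearW => n; rewrite bint_dot dotC.
  by rewrite (_ : (fun n => _) = fun n => bint (w n \_ U) q'.1 q'.2 * bint (w n \_ U) q'.1 q'.2);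
    [exact: cvgM | apply/funext => n; rewrite expr2].
have e2 : 0 < e / 2 by lra.
move/cvgrPdist_le : Mc => /(_ _ e2); apply: filterS => n.
rewrite !sub0r !normrN [X in _ -> X <= _]ger0_norm; last exact: bint_sqr_ge0.
move=> /(le_trans (ler_norm _)) hM.
have E : bint (fun x => (w n \_ U) x ^+ 2) a b =
    iter m oct (fun q' => bint (fun x => (w n \_ U) x ^+ 2) q'.1 q'.2) q.
  rewrite iter_oct_additive// => i q' qi'.
  by rewrite (bint_bis i)//; exact: sqint_locint2.
rewrite E.
apply: (@le_trans _ _ (iter m oct (fun q' => M n q' +
    (L / 2 ^+ m) ^+ 2 * dirichlet (fun i => g n i \_ U) q') q)).
  apply: (iter_oct_mono fq) => q' f'.
  have := poincare (Lw n) (Lg n) (wg n) f'; rewrite /variance -/(M n q'); lra.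
rewrite iter_oct_lin [X in _ + _ * X]iter_oct_additive//; last first.
  by move=> i q' qi'; exact: dirichlet_additive.
have dK : dirichlet (fun i => g n i \_ U) q <= K.
  by apply: le_trans (gK n); apply: ler_sum => i _; exact: bint_le_dot.
have : (L / 2 ^+ m) ^+ 2 * dirichlet (fun i => g n i \_ U) q <= e / 2.
  by apply: le_trans hm; rewrite ler_wpM2l ?sqr_ge0.
lra.
Qed.

(** A box and its translates carry the same integral, but by Cauchy-Schwarz the
    integral over a row of [N] boxes is only of order [sqrt N]. *)
Lemma partial_eq0 f i : L2 setT f ->
  is_weak_partial setT i f (fun=> 0) -> {ae mu, forall x, f x = 0}.
Proof.
move=> Lf wf; have fT : f \_ setT = f by apply/funext => x; rewrite patchE in_setT.
have sf : sqint mu f by rewrite -fT; exact: (L2_sqint _ _).1.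
have L0 : L2 setT (fun=> 0 : R).
  apply/L2_sqint; rewrite (_ : _ \_ _ = fun=> 0); first exact: sqint0.
  by apply/funext => x; rewrite patchE; case: ifP.
suff B a b : bint f a b = 0.
  have := @box_ae0 _ setT f openT sf.1 (fun a b _ => sqint_integrable_box a b sf)
      (fun a b _ => B a b).
  by apply: filterS => x /(_ I).
have [qi|/existsNP[j /negP]] := pselect (increasing_pt a b); last first.
  by rewrite -leNgt => /box_empty E; rewrite /bint E Rintegral_set0.
have ab : coord i a <= coord i b by exact/ltW.
have tr s : 0 <= s -> bint f (shiftc i s a) (shiftc i s b) = bint f a b.
  move=> s0; have := translate_estimate Lf L0 wf s0 ab (@subsetT _ _).
  rewrite fT (_ : bint (fun x => `|_|) _ _ = 0).
    by rewrite mulr0 normr_le0 subr_eq0 => /eqP.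
  rewrite /bint (@eq_Rintegral _ _ _ _ _ (cst 0)) ?Rintegral_cst ?mul0r//.
    exact: measurable_box.
  by move=> x _; rewrite patchE; case: ifP; rewrite normr0.
pose l := coord i b - coord i a; have l0 : 0 < l by rewrite subr_gt0.
have long N : bint f a (shiftc i (N%:R * l) b) = N.+1%:R * bint f a b.
  elim: N => [|N IH].
    rewrite mul0r mul1r; congr bint; apply: coord_inj => j.
    by rewrite /shiftc coord_setc addr0; case: eqP => [->|].
  have Nl : 0 <= N%:R * l by rewrite mulr_ge0// ltW.
  rewrite (@bint_split _ f i (coord i b + N%:R * l)).
  - rewrite (_ : setc i _ (shiftc _ _ _) = shiftc i (N%:R * l) b); last first.
      by apply: coord_inj => j; rewrite /shiftc !coord_setc; case: eqP.
    rewrite IH (_ : setc i _ a = shiftc i (N.+1%:R * l) a); last first.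
      apply: coord_inj => j; rewrite /shiftc !coord_setc; case: eqP => // _.
      by rewrite -[N.+1]addn1 natrD /l; ring.
    rewrite tr; last by rewrite mulr_ge0// ltW.
    by rewrite -[N.+2]addn1 [in RHS]natrD mulrDl mul1r.
  - exact: sqint_integrable_box.
  - by lra.
  - by rewrite /shiftc coord_setc eqxx lerD2l ler_wpM2r ?ler_nat// ltW.
have V0 := vol_gt0 qi.
have volN N : vol a (shiftc i (N%:R * l) b) = N.+1%:R * vol a b.
  rewrite /vol (bigD1 i)//= [in RHS](bigD1 i)//= /shiftc coord_setc eqxx.
  rewrite (eq_bigr (fun j => coord j b - coord j a)).
    by rewrite mulrA -[N.+1]addn1 natrD /l; congr (_ * _); ring.
  by move=> j /negbTE ji; rewrite coord_setc ji.
have key N : N.+1%:R * bint f a b ^+ 2 <= vol a b * dot mu f f.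
  have qN : increasing_pt a (shiftc i (N%:R * l) b).
    move=> j; rewrite /shiftc coord_setc; case: eqP => [->|_]; last exact: qi.
    by apply: (lt_le_trans (qi i)); rewrite lerDl mulr_ge0// ltW.
  have := bint_CS sf qN; rewrite long volN exprMn expr2 -!mulrA ler_pM2l ?ltr0n//.
  by move=> /le_trans; apply; rewrite ler_wpM2l ?bint_le_dot// ltW.
apply/eqP; apply: contraT => n0.
have J0 : 0 < bint f a b ^+ 2 by rewrite exprn_even_gt0.
pose c := vol a b * dot mu f f / bint f a b ^+ 2.
have c0 : 0 <= c by apply: divr_ge0; [apply: mulr_ge0; rewrite ?dot_ge0 ?ltW | exact: ltW].
have cN : c < (Num.bound c).+1%:R.
  by apply: lt_trans (archi_boundP c0) _; rewrite ltr_nat.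
by have := key (Num.bound c); rewrite -ler_pdivlMr// -/c leNgt cN.
Qed.

End Poincare.

(** * Gradients have no curl *)

Section Gradients.
Context {R : realType}.
Local Notation mu := (@leb3 R).
Implicit Types (U : set (R3 R)) (f g eta zeta : R3 R -> R) (i j k : 'I_3).
Implicit Types (a b x y v : R3 R).

Definition translate v : T3 R -> T3 R := fun x : R3 R => x + v.

Lemma preimage_translate_box v a b :
  translate v @^-1` (box a b) = box (a - v) (b - v).
Proof.
apply/seteqP; split=> x h j; have := h j; rewrite !coordB /translate coordD;
  by move=> /andP[h1 h2]; apply/andP; split; lra.
Qed.

Lemma measurable_translate v : measurable_fun setT (translate v).
Proof.
apply: (measurability (boxes : set (set (T3 R)))); first exact: measurable_boxes.
move=> _ [_ [a [b ->]] <-]; rewrite setTI preimage_translate_box.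
exact: measurable_box.
Qed.

(** A sigma-finite measure is determined by its values on boxes. *)
Lemma leb3_translate v (A : set (R3 R)) : mset3 A ->
  leb3 (translate v @^-1` A) = leb3 A.
Proof.
pose n1 (n : nat) : R3 R := pt (fun=> - n%:R); pose n2 (n : nat) : R3 R := pt (fun=> n%:R).
have cover : \bigcup_n box (n1 n) (n2 n) = setT.
  apply/seteqP; split => // x _; have [N hN] := coord_archi x.
  exists N => // j; rewrite !coord_pt.
  by have := hN j; rewrite ltr_norml => /andP[-> /ltW ->].
move=> mA; apply/esym.
apply: (@measure_unique _ R (T3 R) boxes (fun n => box (n1 n) (n2 n)) measurable_boxes
  (@boxes_setI R) _ cover mu
  (measure_function_pushforward__canonical__measure_function_Measure mu
      (measurable_translate v))) => //.
- by move=> n; do 2 eexists.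
- move=> _ [a [b ->]]; rewrite /= /pushforward preimage_translate_box.
  have [ab|/existsNP[i /negP]] := pselect (increasing_pt a b); last first.
    rewrite -leNgt => ba; rewrite (box_empty ba) (@box_empty _ (a - v) (b - v) i) ?measure0//.
    by rewrite !coordB; lra.
  have e1 := @leb3_box _ a b (fun i => ltW (ab i)).
  have e2 := @leb3_box _ (a - v) (b - v).
  rewrite [LHS]e1 [RHS]e2; last by move=> i; rewrite !coordB lerD2r ltW.
  by congr EFin; apply: eq_bigr => i _; rewrite !coordB; ring.
- by move=> n; exact: leb3_box_fin.
Qed.

Lemma Rintegral_translate v f : mu.-integrable setT (EFin \o f) ->
  mu.-integrable setT (EFin \o (fun x => f (x + v))) ->
  \int[mu]_x f (x + v) = \int[mu]_x f x.
Proof.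
move=> fi fiv; rewrite /Rintegral; congr fine.
have mf : measurable_fun (setT : set (T3 R)) (EFin \o f) by have /integrableP[] := fi.
have := @integral_pushforward _ _ _ _ R (translate v)
    (measurable_translate v) mu setT _ mf fiv measurableT.
rewrite preimage_setT => <-.
apply: (@eq_measure_integral _ _ R _ mu
  (measure_function_pushforward__canonical__measure_function_Measure mu
      (measurable_translate v))).
by move=> A mA _; exact: leb3_translate.
Qed.

Lemma sqint_translate v f : sqint mu f -> sqint mu (fun x => f (x + v)).
Proof.
move=> sf; have [mf if2] := sf; have mv := measurable_translate v.
have mfv : mfun3 (fun x => f (x + v)) by exact: (measurableT_comp mf mv).
apply: (@sqint_bounded _ _ _ mu _ (dot mu f f) mfv _).1.
rewrite -sqint_dot// le_eqVlt; apply/orP; left; apply/eqP.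
have m2 : measurable_fun (setT : set (T3 R)) (fun x => (f x ^+ 2)%:E).
  by apply/measurable_EFinP; exact: measurable_funX.
have := @ge0_integral_pushforward _ _ _ _ R (translate v) mv mu setT (fun x =>
    (f x ^+ 2)%:E) measurableT m2 _.
rewrite preimage_setT => <-; last by move=> x _; rewrite lee_fin sqr_ge0.
apply: (@eq_measure_integral _ _ R _ mu
  (measure_function_pushforward__canonical__measure_function_Measure mu
      (measurable_translate v))).
by move=> A mA _; exact: leb3_translate.
Qed.

Lemma dot_translate v f g : sqint mu f -> sqint mu g ->
  dot mu (fun x => f (x + v)) (fun x => g (x + v)) = dot mu f g.
Proof.
move=> sf sg; apply: (@Rintegral_translate v (fun x => f x * g x)); first exact: sqint_mul.
exact: (sqint_mul (sqint_translate v sf) (sqint_translate v sg)).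
Qed.

Definition diff j (h : R) f x : R := f (x + h *: evec j) - f x.

Lemma sqint_diff j h f : sqint mu f -> sqint mu (diff j h f).
Proof. by move=> sf; apply: sqintB => //; exact: sqint_translate. Qed.

(** Difference operators commute, by invariance under translation. *)
Lemma diff_by_parts i j h eta zeta : sqint mu eta -> sqint mu zeta ->
  dot mu (diff j h eta) (diff i (- h) zeta) =
  dot mu (diff i h eta) (diff j (- h) zeta).
Proof.
move=> se sz.
have T v f : sqint mu f -> sqint mu (fun x => f (x + v)) by exact: sqint_translate.
have ex p q : dot mu (diff p h eta) (diff q (- h) zeta) =
   dot mu (fun x => eta (x + h *: evec p)) (fun x => zeta (x + - h *: evec q)) -
   dot mu (fun x => eta (x + h *: evec p)) zeta -
   dot mu eta (fun x => zeta (x + - h *: evec q)) + dot mu eta zeta.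
  have dBr f g (l : R3 R -> R) : sqint mu f -> sqint mu g -> sqint mu l ->
      dot mu l (fun x => f x - g x) = dot mu l f - dot mu l g.
    by move=> sf sg sl; rewrite dotC dotB// (dotC mu f) (dotC mu g).
  rewrite dotB//; [|exact: T|exact: sqint_diff].
  rewrite !dBr//; try exact: T.
  by ring.
rewrite !ex.
have t1 : dot mu (fun x => eta (x + h *: evec j)) (fun x => zeta (x + - h *: evec i)) =
    dot mu (fun x => eta (x + h *: evec i)) (fun x => zeta (x + - h *: evec j)).
  rewrite -(@dot_translate (h *: evec j - h *: evec i) (fun x => eta (x + h *: evec i)));
      [|exact: T|exact: T].
  congr (dot _ _ _); apply/funext => x; first by rewrite -addrA subrK.
  by rewrite -addrA !scaleNr addrAC subrr add0r.
have t2 p : dot mu (fun x => eta (x + h *: evec p)) zeta =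
    dot mu eta (fun x => zeta (x + - h *: evec p)).
  rewrite -(@dot_translate (h *: evec p) eta); [|by []|exact: T].
  by congr (dot _ _ _); apply/funext => x; rewrite scaleNr addrK.
rewrite t1 !t2; ring.
Qed.

Lemma diff_quotient_cvg eta j x (s : R) : s != 0 -> derivable eta x (evec j) ->
  (s / n.+1%:R)^-1 * diff j (s / n.+1%:R) eta x @[n --> \oo] --> 'D_(evec j) eta x.
Proof.
move=> s0 dx.
have /is_deriveE/cvgr_dnbhsP dE : is_derive x (evec j) eta ('D_(evec j) eta x) by split.
have h0 : (forall n, s / n.+1%:R != 0) /\ (s / n.+1%:R @[n --> \oo] --> (0 : R)).
  split=> [n|]; first by rewrite mulf_neq0// invr_neq0// pnatr_eq0.
  rewrite -[X in _ --> X](mulr0 s); apply: cvgM; first exact: cvg_cst.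
  exact: cvg_harmonic.
have := dE _ h0; apply: cvg_trans.
by apply: near_eq_cvg; apply: nearW => n; rewrite /diff /= [x + _]addrC.
Qed.

(** ** Limits of difference quotients *)

Lemma coord_line j x (s : R) k : coord k (x + s *: evec j) =
  if k == j then coord k x + s else coord k x.
Proof. by rewrite coordD coordZ coord_evec; case: eqP => _; rewrite ?mulr1 ?mulr0 ?addr0. Qed.

(** The mean value theorem provides the dominating function for limits of
    difference quotients. *)
Lemma diff_bound U eta j : test_function U eta ->
  exists M : R, forall x h, `|diff j h eta x| <= M * `|h|.
Proof.
move=> te; have [se _ _] := te.
have [sd cK _] := test_derive j te.
have [cd _] := sd [::].
have [M [_ hM]] : bounded_set ((fun x => 'D_(evec j) eta x) @` closure [set x | 'D_(evec j) eta x != 0]).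
  by apply: compact_bounded; apply: continuous_compact => //; exact: continuous_subspaceT.
pose N := `|M| + 1.
have bd x : `|'D_(evec j) eta x| <= N.
  have [h|h] := pselect (closure [set x | 'D_(evec j) eta x != 0] x).
    by apply: hM; [rewrite /N; have := ler_norm M; lra | exists x].
  rewrite (_ : 'D_(evec j) eta x = 0) ?normr0 ?addr_ge0//.
  by apply/eqP; apply: contraT => n0; case: h; exact: subset_closure.
have [_ de] := se [::].
have dl x (t : R) : is_derive t 1 (fun s : R => eta (x + s *: evec j)) ('D_(evec j) eta
    (x + t *: evec j)).
  apply/is_deriveE.
  have /is_deriveE : is_derive (x + t *: evec j) (evec j) eta ('D_(evec j) eta (x + t *: evec j)).
    by split => //; exact: de.
  apply: cvg_trans; apply: near_eq_cvg; apply: nearW => h /=.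
  rewrite [h *: 1]mulr1 scalerDl addrCA //.
exists N => x h.
have key y (s : R) : 0 < s -> `|eta (y + s *: evec j) - eta y| <= N * s.
  move=> s0.
  have [|c _] := @MVT _ (fun s : R => eta (y + s *: evec j)) (fun t => 'D_(evec j) eta
      (y + t *: evec j)) 0 s s0 (fun t _ => dl y t).
    apply: continuous_subspaceT => t.
    by apply: differentiable_continuous; apply/derivable1_diffP; case: (dl y t).
  rewrite scale0r addr0 subr0 => ->; rewrite normrM (gtr0_norm s0).
  by apply: ler_wpM2r; [exact: ltW | exact: bd].
have [h0|h0|h0] := ltgtP h 0; last by rewrite h0 /diff scale0r addr0 subrr normr0 mulr0.
- have := key (x + h *: evec j) (- h); rewrite oppr_gt0 => /(_ h0).
  by rewrite -addrA -scalerDl subrr scale0r addr0 distrC (ltr0_norm h0).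
- by rewrite (gtr0_norm h0); exact: key.

Qed.

(** The symmetry of second derivatives in weak form, as the limit of the one for
    difference quotients. *)
Lemma dot_derive_sym i j eta zeta : test_function setT eta -> test_function setT zeta ->
  dot mu (fun x => 'D_(evec j) eta x) (fun x => 'D_(evec i) zeta x) =
  dot mu (fun x => 'D_(evec i) eta x) (fun x => 'D_(evec j) zeta x).
Proof.
move=> te tz; have se := test_sqint te; have sz := test_sqint tz.
pose h n : R := 1 / n.+1%:R.
(* [diff_by_parts] calls for opposite increments *)
pose h' n : R := (- 1) / n.+1%:R.
have hh n : h' n = - h n by rewrite /h /h' mulNr.
have lim p q : dot mu (fun x => (h n)^-1 * diff p (h n) eta x)
      (fun x => (h' n)^-1 * diff q (h' n) zeta x) @[n --> \oo] -->
    dot mu (fun x => 'D_(evec p) eta x) (fun x => 'D_(evec q) zeta x).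
  have [M hM] := diff_bound p te; have [M' hM'] := diff_bound q tz.
  have [a [b ab]] : exists a b, forall x, ~ box a b x -> forall n, diff p (h n) eta x = 0.
    have [_ cK _] := te; have [a [b Kab]] := compact_in_box cK.
    have out x : ~ box a b x -> eta x = 0.
      move=> hx; apply/eqP; apply: contraT => n0; case: hx; apply: Kab; exact: subset_closure.
    exists (a - pt (fun=> 1)), b => x hx n; rewrite /diff.
    have h01 : 0 < h n <= 1.
      rewrite /h div1r invr_gt0 ltr0n /= invf_le1 ?ltr0n//.
      by rewrite ler1n.
    have sub y : box a b y -> (forall k, coord k y - 1 <= coord k x <= coord k y) -> False.
      move=> H d; apply: hx => k; have := H k; have := d k; rewrite coordB coord_pt.
      by move=> /andP[h1 h2] /andP[h3 h4]; apply/andP; split; lra.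
    rewrite (out x) 1?(out (x + _)) ?subrr// => H; apply: (sub _ H) => k.
      by rewrite coord_line; move: h01; move: (h n) => hn; case: ifP => _; lra.
    by lra.
  have mu1 n : mfun3 (fun x => (h n)^-1 * diff p (h n) eta x).
    by apply: measurable_funM => //; case: (sqint_diff p (h n) se).
  have mu2 n : mfun3 (fun x => (h' n)^-1 * diff q (h' n) zeta x).
    by apply: measurable_funM => //; case: (sqint_diff q (h' n) sz).
  have hn0 n : h n != 0 by rewrite /h div1r invr_neq0// pnatr_eq0.
  have b1 n x : `|(h n)^-1 * diff p (h n) eta x| <= M.
    rewrite normrM normfV mulrC ler_pdivrMr ?normr_gt0//; exact: hM.
  have b2 n x : `|(h' n)^-1 * diff q (h' n) zeta x| <= M'.
    by rewrite normrM normfV mulrC ler_pdivrMr ?normr_gt0 ?hh ?oppr_eq0//; exact: hM'.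
  have M0 : 0 <= M by apply: le_trans (b1 0%N 0).
  have M'0 : 0 <= M' by apply: le_trans (b2 0%N 0).
  have sde := test_sqint (test_derive p te); have sdz := test_sqint (test_derive q tz).
  have [] := @dominated_convergence _ _ _ mu setT measurableT
    (fun n x => ((h n)^-1 * diff p (h n) eta x * ((h' n)^-1 * diff q (h' n) zeta x))%:E)
    (fun x => ('D_(evec p) eta x * 'D_(evec q) zeta x)%:E)
    (fun x => (M * M' * one_box a b x)%:E).
  - by move=> n; apply/measurable_EFinP; exact: measurable_funM.
  - by apply/measurable_EFinP; apply: measurable_funM; [case: sde | case: sdz].
  - apply: nearW => x _; apply: cvg_EFin; first exact: nearW.
    have [se' _ _] := te; have [sz' _ _] := tz.
    apply: cvgM; apply: diff_quotient_cvg.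
    + exact: oner_neq0.
    + exact: (se' [::]).2.
    + by rewrite oppr_eq0 oner_eq0.
    + exact: (sz' [::]).2.
  - have mQ := measurable_box a b.
    have := integrableZl measurableT (M * M') (sqint_mul (one_box_sqint a b) (one_box_sqint a b)).
    apply: eq_integrable => // x _; rewrite /= -EFinM; congr EFin.
    by rewrite one_boxE; case: ifP => _; rewrite ?mulr1 ?mulr0.
  - apply: nearW => x n _; rewrite /= lee_fin normrM one_boxE; case: ifPn => [_|/negP hx].
      by rewrite mulr1 ler_pM.
    by rewrite ab ?mulr0 ?normr0 ?mul0r// => H; apply: hx; exact: mem_set.
  move=> _ _ c; rewrite /dot /Rintegral; apply: fine_cvg; rewrite fineK//.
  by apply: integrable_fin_num => //; exact: sqint_mul.
rewrite -(cvg_lim _ (lim j i))//; apply: cvg_lim => //.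
have := lim i j; apply: cvg_trans; apply: near_eq_cvg; apply: nearW => n /=.
have Z (c c' : R) f g : sqint mu f -> sqint mu g ->
    dot mu (fun x => c * f x) (fun x => c' * g x) = c * c' * dot mu f g.
  move=> sf sg; rewrite (sh_Zl (semi_hilbert_sqint mu) c sf (sqintZ c' sg)).
  by rewrite (sh_Zr (semi_hilbert_sqint mu) c' sg sf) mulrA.
rewrite !Z; try exact: sqint_diff.
by rewrite hh diff_by_parts.
Qed.

End Gradients.

(** * The energy of saturated magnetizations *)

Lemma open_Omega1 (R : realType) (omega : set (R * R)) :
  open omega -> open (Omega1 omega).
Proof.
move=> oo; rewrite openE => -[x y] [/= ox yI]; exists (omega, `]0, 1[%classic).
  split=> /=; first exact: open_nbhs_nbhs.
  by apply: open_nbhs_nbhs; split => //; exact: interval_open.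
by move=> z [].
Qed.

Section Energy.
Context {R : realType} (omega : set (R * R)).
Context (homega : unit_domain omega).
Local Notation mu := (@leb3 R).
Local Notation Om := (Omega1 omega).
Implicit Types (m h : R3 R -> R3 R) (w : 'I_3 -> R).

Lemma open_Om : open Om.
Proof. by apply: open_Omega1; case: homega. Qed.

Lemma mset_Om : mset3 Om.
Proof. by apply: open_measurable3; exact: open_Om. Qed.

Lemma leb3_Om : mu Om = 1%E.
Proof.
have [oo _ _ o1] := homega.
have h2 : (1 / 2 : R) \in (`]0, 1[%classic : set R) by rewrite inE /= in_itv /=; lra.
have mo : @measurable _ (measurableTypeR R * measurableTypeR R)%type omega.
  rewrite -(in_ysectionX omega h2).
  exact: (@measurable_ysection _ _ (measurableTypeR R * measurableTypeR R)%type
    (measurableTypeR R) Om (1 / 2) mset_Om).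
have mI : @measurable _ (measurableTypeR R) `]0, 1[%classic by exact: measurable_itv.
have e := @product_measure1E _ _ _ _ R leb2 lebesgue_measure _ _ mo mI.
have l1 : @lebesgue_measure R `]0, 1[%classic = 1%E.
  by rewrite lebesgue_measure_itv /= lte_fin ltr01 -EFinB subr0.
by rewrite [LHS]e [X in (X * _)%E]o1 mul1e.
Qed.

Lemma integral_cst_Om (c : R) : (\int[mu]_(x in Om) c%:E = c%:E)%E.
Proof.
have e := @integral_cst _ _ R mu _ mset_Om c%:E.
by rewrite [LHS]e [X in (_ * X)%E]leb3_Om mule1.
Qed.

Lemma L2map_measurable m k : L2vec Om m -> mfun3 (L2map Om k m).
Proof. by move=> /(_ k)/L2_sqint[]. Qed.

Lemma measurable_comp_Om (f : R3 R -> R) m : continuous f -> L2vec Om m ->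
  @measurable_fun _ _ (T3 R) (measurableTypeR R) Om (fun x => f (m x)).
Proof.
move=> cf Lm; apply: (@eq_measurable_fun _ _ (T3 R) _ Om
  (fun x => f (pt (fun k => L2map Om k m x)))).
  move=> x xO; congr (f _); apply: coord_inj => k.
  by rewrite coord_pt /L2map patchE xO.
have mp : @measurable_fun _ _ (T3 R) (T3 R) setT (fun x => pt (fun k => L2map Om k m x)).
  have mk k := L2map_measurable k Lm.
  exact: (measurable_fun_pair (measurable_fun_pair (mk i1) (mk i2)) (mk i3)).
apply: (@measurable_funTS _ _ (T3 R)).
exact: (measurableT_comp (continuous_measurable3 cf) mp).
Qed.

Lemma saturated_dot (ms : R) m : L2vec Om m -> saturated omega ms m ->
  L2dot Om m m = ms ^+ 2.
Proof.
move=> Lm sm; apply: EFin_inj; rewrite -L2dot_integral// -integral_cst_Om.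
have mO := mset_Om.
apply: ae_eq_integral => //.
- apply/measurable_EFinP.
  apply: (@eq_measurable_fun _ _ (T3 R) _ Om (fun x => \sum_k coord k (m x) ^+ 2)).
    by move=> x _; rewrite enorm_sq.
  apply: measurable_sum => k; apply: measurable_funX.
  apply: measurable_comp_Om => //; exact: continuous_coord.
- by apply: filterS sm => x H Ox; rewrite H.
Qed.

Definition cube (M : R) : set (R3 R) := [set x | forall k, `|coord k x| <= M].

Lemma saturated_cube (ms : R) m : saturated omega ms m ->
  {ae mu, forall x, Om x -> cube ms (m x)}.
Proof.
apply: filterS => x H /H <- k.
rewrite /enorm -[leLHS]sqrtr_sqr.
apply: ler_wsqrtr; rewrite (bigD1 k)//= lerDl.
by apply: sumr_ge0 => i _; exact: sqr_ge0.
Qed.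

Lemma compact_cube (M : R) : compact (cube M).
Proof.
rewrite (_ : cube M = (`[- M, M] `*` `[- M, M] `*` `[- M, M])%classic).
  by apply: compact_setX; [apply: compact_setX|]; exact: segment_compact.
apply/seteqP; split=> [x h|x [[h1 h2] h3]].
  by split; [split|]; rewrite /= in_itv /= -ler_norml;
      [exact: (h i1)|exact: (h i2)|exact: (h i3)].
by elim/I3P; rewrite ler_norml; move: h1 h2 h3; rewrite /= !in_itv.
Qed.

Section Phi.
Context (phi : R3 R -> R) (phi_ge0 : forall v, 0 <= phi v).
Context (phi_cont : continuous phi) (ms : R).

Lemma phi_bounded : exists B, forall x, cube ms x -> phi x <= B.
Proof.
have [M [_ hM]] : bounded_set (phi @` cube ms).
  apply: compact_bounded; apply: continuous_compact; last exact: compact_cube.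
  exact: continuous_subspaceT.
exists (`|M| + 1) => x cx; apply: le_trans (ler_norm _) _.
by apply: hM; [have := ler_norm M; lra | exists x].
Qed.

(** Boundedness turns uniform continuity on the cube into an estimate by the
    squared distance, which can be integrated. *)
Lemma phi_quadratic (e : R) : 0 < e -> exists2 C, 0 <= C & forall x y,
  cube ms x -> cube ms y ->
  `|phi x - phi y| <= e + C * \sum_k coord k (x - y) ^+ 2.
Proof.
move=> e0; have [B hB] := phi_bounded.
have [d d0 hd] := compact_unif (@compact_cube ms) phi_cont e0.
have B0 : 0 <= `|B| by [].
have d20 : 0 < d ^+ 2 by rewrite exprn_gt0.
exists (`|B| / d ^+ 2); first by rewrite divr_ge0// ltW.
move=> x y cx cy; have S0 : 0 <= \sum_k coord k (x - y) ^+ 2.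
  by apply: sumr_ge0 => k _; exact: sqr_ge0.
have [near_|/existsNP[k /negP]] := pselect (forall k, `|coord k x - coord k y| < d).
  by apply: (le_trans (hd x y cx near_)); rewrite lerDl mulr_ge0// divr_ge0// ltW.
rewrite -leNgt -coordB => far_.
have : d ^+ 2 <= \sum_k coord k (x - y) ^+ 2.
  rewrite (bigD1 k)//= -[leLHS]addr0 lerD//; last by apply: sumr_ge0 => i _; exact: sqr_ge0.
  by rewrite -[leRHS]real_normK ?num_real// ler_pXn2r ?nnegrE// ltW.
move=> le2; have : `|B| <= `|B| / d ^+ 2 * \sum_k coord k (x - y) ^+ 2.
  rewrite -mulrA ler_peMr// mulrC ler_pdivlMr// mul1r //.
have : `|phi x - phi y| <= `|B|.
  have := hB _ cx; have := hB _ cy; have := phi_ge0 x; have := phi_ge0 y.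
  have := ler_norm B; rewrite ler_norml => *; lra.
lra.
Qed.

Definition anisotropy m : R := \int[mu]_(x in Om) phi (m x).

Lemma phi_integrable m : L2vec Om m -> saturated omega ms m ->
  mu.-integrable Om (EFin \o (fun x => phi (m x))).
Proof.
move=> Lm sm; have mO := mset_Om; have [B hB] := phi_bounded.
have mphi := measurable_comp_Om phi_cont Lm.
apply/integrableP; split; first exact/measurable_EFinP.
apply: (@le_lt_trans _ _ (\int[mu]_(x in Om) (`|B|)%:E)%E); last first.
  by rewrite integral_cst_Om ltry.
apply: ae_ge0_le_integral => //.
- apply: measurableT_comp => //; exact/measurable_EFinP.
- apply: filterS (saturated_cube sm) => x H Ox.
  rewrite /= lee_fin ger0_norm//; exact: le_trans (hB _ (H Ox)) (ler_norm _).
Qed.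

Lemma anisotropyE m : L2vec Om m -> saturated omega ms m ->
  (\int[mu]_(x in Om) (phi (m x))%:E = (anisotropy m)%:E)%E.
Proof.
move=> Lm sm; rewrite /anisotropy /Rintegral fineK//.
by apply: integrable_fin_num => //; [exact: mset_Om | exact: phi_integrable].
Qed.

Lemma anisotropy_ge0 m : 0 <= anisotropy m.
Proof. by apply: fine_ge0; apply: integral_ge0 => x _; rewrite lee_fin. Qed.

Lemma energyE (alpha : R) w m h : 0 <= alpha -> in_W12_L2 omega m h ->
  saturated omega ms m ->
  energy omega alpha phi w m h =
  (alpha * graddot w Om m m + anisotropy m + 2^-1 * L2dot setT h h)%:E.
Proof.
move=> a0 [Wm Lh] sm; have mO := mset_Om.
rewrite /energy L2dot_integral// -EFinM EFinD; congr (_ + _)%E.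
have g0 x : 0 <= grad_sq w Om m x.
  by apply: sumr_ge0 => i _; apply: sumr_ge0 => k _; exact: sqr_ge0.
have mg : @measurable_fun _ _ (T3 R) (measurableTypeR R) Om (grad_sq w Om m).
  have := (@measurable_restrict _ _ (T3 R) _ Om setT (grad_sq w Om m) mO measurableT).2.
  by rewrite setTI; apply; exact: measurable_grad_sq.
have mphi := measurable_comp_Om phi_cont Wm.1.
under eq_integral do rewrite EFinD EFinM.
rewrite ge0_integralD//.
- rewrite ge0_integralZl_EFin//; [|by move=> x _; rewrite lee_fin|exact/measurable_EFinP].
  rewrite graddot_integral//.
  by rewrite (anisotropyE Wm.1 sm) EFinD EFinM.
- by move=> x _; rewrite mule_ge0// lee_fin.
- by apply: measurable_funeM; exact/measurable_EFinP.
- by move=> x _; rewrite lee_fin.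
- exact/measurable_EFinP.
Qed.

(** Integrate [phi_quadratic]. *)
Lemma anisotropy_cvg (m_ : nat -> R3 R -> R3 R) m :
  (forall n, L2vec Om (m_ n)) -> L2vec Om m ->
  (forall n, saturated omega ms (m_ n)) -> saturated omega ms m ->
  L2dot Om (m_ n - m) (m_ n - m) @[n --> \oo] --> 0 ->
  anisotropy (m_ n) @[n --> \oo] --> anisotropy m.
Proof.
move=> Ln Lm sn sm c0; have mO := mset_Om.
apply/cvgrPdist_le => e e0; have e2 : 0 < e / 2 by lra.
have [C C0 hC] := phi_quadratic e2.
have e3 : 0 < e / 2 / (C + 1) by rewrite divr_gt0//; lra.
move/cvgrPdist_le : c0 => /(_ _ e3); apply: filterS => n.
rewrite sub0r normrN ger0_norm ?L2dot_ge0// => small.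
have LB : L2vec Om (m_ n - m) by apply: (sh_memB (semi_hilbert_L2vec mO)).
have i1 := phi_integrable Lm sm; have i2 := phi_integrable (Ln n) (sn n).
rewrite -lee_fin /anisotropy -RintegralB//.
apply: (@le_trans _ _ (\int[mu]_(x in Om) (`|phi (m x) - phi (m_ n x)|)%:E)%E).
  have iB := integrableB mO i1 i2.
  have iBE : (\int[mu]_(x in Om) (phi (m x) - phi (m_ n x))%:E =
      (\int[mu]_(x in Om) (phi (m x) - phi (m_ n x)))%:E)%E.
    rewrite /Rintegral fineK//; exact: (integrable_fin_num mO iB).
  rewrite -abse_EFin -iBE; apply: le_abse_integral => //.
  by have /integrableP[] := iB.
have mp v := measurable_comp_Om phi_cont (m := v).
have menorm : measurable_fun (Om : set (T3 R)) (fun x : T3 R => enorm ((m_ n - m) x) ^+ 2).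
  apply: (@eq_measurable_fun _ _ (T3 R) _ Om (fun x => \sum_k coord k ((m_ n - m) x) ^+ 2)).
    by move=> x _; rewrite enorm_sq.
  apply: measurable_sum => k; apply: measurable_funX.
  by apply: measurable_comp_Om => //; exact: continuous_coord.
apply: (@le_trans _ _ (\int[mu]_(x in Om) ((e / 2)%:E + C%:E * (enorm
    ((m_ n - m) x) ^+ 2)%:E))%E).
  apply: ae_ge0_le_integral => //.
  - apply/measurable_EFinP; apply: measurableT_comp => //.
    by apply: measurable_funB; exact: mp.
  - move=> x _; rewrite -EFinM -EFinD lee_fin; apply: addr_ge0; first exact: ltW.
    by apply: mulr_ge0 => //; exact: sqr_ge0.
  - apply: emeasurable_funD; first exact: measurable_cst.
    by apply: measurable_funeM; exact/measurable_EFinP.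
  - apply: filterS2 (saturated_cube sm) (saturated_cube (sn n)) => x H1 H2 Ox.
    by rewrite -EFinM -EFinD lee_fin enorm_sq distrC; apply: hC; [exact: H2|exact: H1].
rewrite ge0_integralD//.
- rewrite integral_cst_Om ge0_integralZl_EFin//.
  + rewrite L2dot_integral// -EFinM -EFinD lee_fin.
    have : C * L2dot Om (m_ n - m) (m_ n - m) <= C * (e / 2 / (C + 1)) by rewrite ler_wpM2l.
    have : C * (e / 2 / (C + 1)) <= e / 2.
      rewrite mulrA ler_pdivrMr; last by lra.
      by rewrite [leRHS]mulrC ler_wpM2r//; lra.
    lra.
  + by move=> x _; rewrite lee_fin sqr_ge0.
  + exact/measurable_EFinP.
- by move=> x _; rewrite lee_fin ltW.
- by move=> x _; rewrite -EFinM lee_fin mulr_ge0 ?sqr_ge0.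
- by apply: measurable_funeM; exact/measurable_EFinP.
Qed.

End Phi.
End Energy.

(** * The rescaled Maxwell equations *)

Section Maxwell.
Context {R : realType}.
Local Notation mu := (@leb3 R).
Local Notation D i eta := (fun x => 'D_(evec i) eta x).
Implicit Types (v m h : R3 R -> R3 R) (eta zeta : R3 R -> R) (i j k : 'I_3) (e : R).

Lemma patchT (f : R3 R -> R) : f \_ setT = f.
Proof. by apply/funext => x; rewrite patchE in_setT. Qed.

Lemma component_patch m U k : component (m \_ U) k = (component m k) \_ U.
Proof.
apply/funext => x; rewrite patchE /component /patch; case: ifP => // _.
by elim/I3P : k.
Qed.

Lemma componentD u v k : component (u + v) k = fun x => component u k x + component v k x.
Proof. by apply/funext => x; rewrite /component coordD. Qed.

Lemma L2vec_sqint v k : L2vec setT v -> sqint mu (component v k).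
Proof. by move=> /(_ k)/L2_sqint; rewrite patchT. Qed.

Lemma sqint_L2vec v : (forall k, sqint mu (component v k)) -> L2vec setT v.
Proof. by move=> sv k; apply/L2_sqint; rewrite patchT; exact: sv. Qed.

Lemma L2vec_patch U m : L2vec U m -> L2vec setT (m \_ U).
Proof. by move=> Lm; apply: sqint_L2vec => k; rewrite component_patch; exact/L2_sqint/Lm. Qed.

Lemma L2dotT u v : L2dot setT u v = \sum_k dot mu (component u k) (component v k).
Proof. by apply: eq_bigr => k _; rewrite /L2map !patchT. Qed.

Lemma fun_partialE i f eta : fun_partial setT i f eta = - dot mu f (D i eta).
Proof. by rewrite /fun_partial /distr_partial regular_distrE patchT. Qed.

Definition scaled_grad e eta : R3 R -> R3 R :=
  fun x => pt (fun i => scale e i * 'D_(evec i) eta x).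

(** The cross product of [d] with the [k]-th unit vector. *)
Definition cross (k : 'I_3) (d : 'I_3 -> R) : R3 R :=
  nth 0 [:: (0, d i3, - d i2); (- d i3, 0, d i1); (d i2, - d i1, 0)] k.

(** The curl of [eta] times the [k]-th unit vector, against which the [k]-th
    component of a curl is integrated by parts. *)
Definition scaled_curl e k eta : R3 R -> R3 R :=
  fun x => cross k (fun i => scale e i * 'D_(evec i) eta x).

Lemma test_scaled_sqint e i eta : test_function setT eta ->
  sqint mu (fun x => scale e i * 'D_(evec i) eta x).
Proof. by move=> te; apply: sqintZ; apply: test_sqint; exact: test_derive te. Qed.

Lemma sqintN f : sqint mu f -> sqint mu (fun x => - f x).
Proof. by move=> /(sqintZ (-1)); under eq_fun do rewrite mulN1r. Qed.

Lemma dotNr f g : sqint mu f -> sqint mu g -> dot mu f (fun x => - g x) = - dot mu f g.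
Proof.
move=> sf sg; under [X in dot mu f X]eq_fun do rewrite -mulN1r.
by rewrite (sh_Zr (semi_hilbert_sqint mu))// mulN1r.
Qed.

Lemma dotZZ (c c' : R) f g : sqint mu f -> sqint mu g ->
  dot mu (fun x => c * f x) (fun x => c' * g x) = c * c' * dot mu f g.
Proof.
move=> sf sg; rewrite (sh_Zl (semi_hilbert_sqint mu) c sf (sqintZ c' sg)).
by rewrite (sh_Zr (semi_hilbert_sqint mu) c' sg sf) mulrA.
Qed.

Lemma dot_cross k (f g : 'I_3 -> R3 R -> R) :
  (forall i, sqint mu (f i)) -> (forall i, sqint mu (g i)) ->
  \sum_j dot mu (f j) (fun x => coord j (cross k (g^~ x))) =
  [:: dot mu (f i2) (g i3) - dot mu (f i3) (g i2);
      dot mu (f i3) (g i1) - dot mu (f i1) (g i3);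
      dot mu (f i1) (g i2) - dot mu (f i2) (g i1)]`_k.
Proof.
move=> sf sg; rewrite big_I3.
by elim/I3P : k; rewrite /cross /coord /= ?dot0r ?dotNr//; ring.
Qed.

Lemma scaled_grad_L2 e eta : test_function setT eta -> L2vec setT (scaled_grad e eta).
Proof.
move=> te; apply: sqint_L2vec => k.
rewrite (_ : component _ k = fun x => scale e k * 'D_(evec k) eta x);
    first exact: test_scaled_sqint.
by apply/funext => x; rewrite /component coord_pt.
Qed.

Lemma scaled_curl_L2 e k eta : test_function setT eta -> L2vec setT (scaled_curl e k eta).
Proof.
move=> te; have s i := test_scaled_sqint e i te.
have sN i := sqintN (s i).
have s0 := sqint0 mu.
by apply: sqint_L2vec; elim/I3P : k; elim/I3P; rewrite /component /scaled_curl /cross /coord /=.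
Qed.

Lemma div_epsE e v eta : L2vec setT v -> test_function setT eta ->
  div_eps e v eta = - L2dot setT v (scaled_grad e eta).
Proof.
move=> Lv te; rewrite L2dotT /div_eps -sumrN; apply: eq_bigr => i _.
rewrite /partial_eps fun_partialE mulrN; congr (- _).
rewrite (_ : component (scaled_grad e eta) i = fun x => scale e i * 'D_(evec i) eta x).
  rewrite (sh_Zr (semi_hilbert_sqint mu))//; last exact: L2vec_sqint.
  by apply: test_sqint; exact: test_derive te.
by apply/funext => x; rewrite /component coord_pt.
Qed.

Lemma curl_epsE e v k eta : L2vec setT v -> test_function setT eta ->
  curl_eps e v k eta = L2dot setT v (scaled_curl e k eta).
Proof.
move=> Lv te; have sv j := L2vec_sqint j Lv.
have sd i := test_sqint (test_derive i te).
have ss i := test_scaled_sqint e i te.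
pose F i j := dot mu (component v j) (fun x => scale e i * 'D_(evec i) eta x).
have Z i j : partial_eps e i v j eta = - F i j.
  by rewrite /partial_eps fun_partialE mulrN /F (sh_Zr (semi_hilbert_sqint mu)).
have E : L2dot setT v (scaled_curl e k eta) =
    [:: F i3 i2 - F i2 i3; F i1 i3 - F i3 i1; F i2 i1 - F i1 i2]`_k.
  by rewrite L2dotT; exact: (dot_cross k sv ss).
rewrite E /curl_eps !Z; clear Z E; clearbody F.
by elim/I3P : k => /=; ring.
Qed.

(** By the symmetry of second derivatives. *)
Lemma curl_grad e k eta zeta : test_function setT eta -> test_function setT zeta ->
  L2dot setT (scaled_grad e eta) (scaled_curl e k zeta) = 0.
Proof.
move=> te tz.
have sd i := test_sqint (test_derive i te); have sz i := test_sqint (test_derive i tz).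
have ss i := test_scaled_sqint e i te; have st i := test_scaled_sqint e i tz.
have comp i : component (scaled_grad e eta) i = fun x => scale e i * 'D_(evec i) eta x.
  by apply/funext => x; rewrite /component coord_pt.
have sym i j : dot mu (fun x => scale e i * 'D_(evec i) eta x) (fun x => scale e j
    * 'D_(evec j) zeta x) =
    dot mu (fun x => scale e j * 'D_(evec j) eta x) (fun x => scale e i * 'D_(evec i) zeta x).
  apply: etrans (dotZZ (scale e i) (scale e j) (sd i) (sz j)) _.
  apply/esym; apply: etrans (dotZZ (scale e j) (scale e i) (sd j) (sz i)) _.
  exact: (f_equal2 *%R (mulrC _ _) (dot_derive_sym i j te tz)).
rewrite L2dotT; transitivity (\sum_i dot mu (fun x => scale e i * 'D_(evec i) eta x)
    (fun x => coord i (cross k (fun i => scale e i * 'D_(evec i) zeta x)))).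
  by apply: eq_bigr => i _; exact: (f_equal (fun f => dot mu f _) (comp i)).
rewrite (dot_cross k ss st).
by elim/I3P : k => /=; apply/eqP; rewrite subr_eq0; apply/eqP; exact: sym.
Qed.

Definition limit_equations m h :=
  [/\ eq_distr setT (fun_partial setT i3 (component (m + h) i3)) (fun=> 0),
      eq_distr setT (fun_partial setT i3 (component h i2)) (fun=> 0),
      eq_distr setT (fun_partial setT i3 (component h i1)) (fun=> 0)
    & eq_distr setT (fun eta => fun_partial setT i1 (component h i2) eta
                    - fun_partial setT i2 (component h i1) eta) (fun=> 0)].

(** In the rescaled equations the derivative across the film carries the factor
    [eps^-1]; multiplying by [eps], the other terms disappear in the limit. *)
Lemma limit_equations_cvg (eps_ : nat -> R) (m_ h_ : nat -> R3 R -> R3 R) m h :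
  to_zero_pos eps_ ->
  (forall n, L2vec setT (m_ n)) -> (forall n, L2vec setT (h_ n)) ->
  L2vec setT m -> L2vec setT h ->
  (forall k g, sqint mu g -> dot mu (component (m_ n) k) g
      @[n --> \oo] --> dot mu (component m k) g) ->
  (forall k g, sqint mu g -> dot mu (component (h_ n) k) g
      @[n --> \oo] --> dot mu (component h k) g) ->
  (forall n, eq_distr setT (div_eps (eps_ n) (m_ n + h_ n)) (fun=> 0)) ->
  (forall n k, eq_distr setT (curl_eps (eps_ n) (h_ n) k) (fun=> 0)) ->
  limit_equations m h.
Proof.
move=> [e0 ec] Lmn Lhn Lm Lh cm ch dv cu.
pose H n i j eta := dot mu (component (h_ n) j) (D i eta).
pose M n i j eta := dot mu (component (m_ n) j) (D i eta).
have cH i j eta : test_function setT eta -> H n i j eta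
    @[n --> \oo] --> dot mu (component h j) (D i eta).
  by move=> te; apply: ch; apply: test_sqint; exact: test_derive te.
have cM i j eta : test_function setT eta -> M n i j eta
    @[n --> \oo] --> dot mu (component m j) (D i eta).
  by move=> te; apply: cm; apply: test_sqint; exact: test_derive te.
have sD i eta : test_function setT eta -> sqint mu (D i eta).
  by move=> te; apply: test_sqint; exact: test_derive te.
have dD i j eta u v : test_function setT eta -> L2vec setT u -> L2vec setT v ->
    dot mu (component (u + v) j) (D i eta) =
    dot mu (component u j) (D i eta) + dot mu (component v j) (D i eta).
  move=> te Lu Lv; rewrite componentD.
  by apply: (sh_Dl (semi_hilbert_sqint mu)); [exact: L2vec_sqint|exact: L2vec_sqint|exact: sD].
have QH n i j eta : partial_eps (eps_ n) i (h_ n) j eta = scale (eps_ n) i * - H n i j eta.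
  by rewrite /partial_eps fun_partialE.
have QS n i j eta : test_function setT eta ->
    partial_eps (eps_ n) i (m_ n + h_ n) j eta = scale (eps_ n) i * - (M n i j eta + H n i j eta).
  by move=> te; rewrite /partial_eps fun_partialE dD.
clearbody H M.
have sc3 n : scale (eps_ n) i3 = (eps_ n)^-1 by [].
have sc1 n : scale (eps_ n) i1 = 1 by [].
have sc2 n : scale (eps_ n) i2 = 1 by [].
have en n : eps_ n != 0 by rewrite gt_eqF.
have vanish (a b : nat -> R) (la lb : R) : a n @[n --> \oo] --> la -> b n @[n --> \oo] --> lb ->
    (forall n, a n = eps_ n * b n) -> la = 0.
  move=> ca cb ab; rewrite -(cvg_lim _ ca)//; apply: cvg_lim => //.
  rewrite (_ : a = fun n => eps_ n * b n); last exact/funext.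
  by rewrite -[X in _ --> X](mul0r lb); apply: cvgM.
split=> eta te.
- rewrite fun_partialE dD//; apply/eqP; rewrite oppr_eq0; apply/eqP.
  apply: (vanish (fun n => M n i3 i3 eta + H n i3 i3 eta)
    (fun n => - (M n i1 i1 eta + H n i1 i1 eta + (M n i2 i2 eta + H n i2 i2 eta)))).
  + by apply: cvgD; [exact: cM|exact: cH].
  + apply: cvgN; apply: cvgD; apply: cvgD; [exact: cM|exact: cH|exact: cM|exact: cH].
  + move=> n; have := dv n eta te; rewrite /div_eps big_I3 !QS// sc1 sc2 sc3.
    move: (M n i1 i1 eta) (M n i2 i2 eta) (M n i3 i3 eta) (H n i1 i1 eta) (H n i2 i2 eta)
        (H n i3 i3 eta).
    move=> a b c a' b' c' eq0.
    have -> : c + c' = eps_ n * ((eps_ n)^-1 * (c + c')) by rewrite mulrA mulfV// mul1r.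
    by congr (_ * _); lra.
- rewrite fun_partialE; apply/eqP; rewrite oppr_eq0; apply/eqP.
  apply: (vanish (fun n => H n i3 i2 eta) (fun n => H n i2 i3 eta)); [exact: cH|exact: cH|].
  move=> n; have := cu n i1 eta te; rewrite /curl_eps /= !QH sc2 sc3.
  move: (H n i2 i3 eta) (H n i3 i2 eta) => a b eq0.
  have -> : b = eps_ n * ((eps_ n)^-1 * b) by rewrite mulrA mulfV// mul1r.
  by congr (_ * _); lra.
- rewrite fun_partialE; apply/eqP; rewrite oppr_eq0; apply/eqP.
  apply: (vanish (fun n => H n i3 i1 eta) (fun n => H n i1 i3 eta)); [exact: cH|exact: cH|].
  move=> n; have := cu n i2 eta te; rewrite /curl_eps /= !QH sc1 sc3.
  move: (H n i1 i3 eta) (H n i3 i1 eta) => a b eq0.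
  have -> : b = eps_ n * ((eps_ n)^-1 * b) by rewrite mulrA mulfV// mul1r.
  by congr (_ * _); lra.
- rewrite !fun_partialE.
  have c0 : H n i2 i1 eta - H n i1 i2 eta @[n --> \oo] -->
      dot mu (component h i1) (D i2 eta) - dot mu (component h i2) (D i1 eta).
    by apply: cvgB; exact: cH.
  have z n : H n i2 i1 eta - H n i1 i2 eta = 0.
    by have := cu n i3 eta te; rewrite /curl_eps /= !QH sc1 sc2; lra.
  have : dot mu (component h i1) (D i2 eta) - dot mu (component h i2) (D i1 eta) = 0.
    rewrite -(cvg_lim _ c0)//; apply: cvg_lim => //.
    by rewrite (funext z); exact: cvg_cst.
  move: (dot _ _ _) (dot _ _ _) => p q pq.
  by rewrite opprK addrC.
Qed.

(** A square-integrable function on [R^3] that does not depend on [x_3] vanishes;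
    the limit equations leave no freedom for the field. *)
Lemma limit_equations_field m h : L2vec setT m -> L2vec setT h -> limit_equations m h ->
  [/\ {ae mu, forall x, component h i1 x = 0}, {ae mu, forall x, component h i2 x = 0}
    & {ae mu, forall x, component h i3 x = - component m i3 x}].
Proof.
move=> Lm Lh [q3 q2 q1 _].
have key v k : L2vec setT v -> eq_distr setT (fun_partial setT i3 (component v k)) (fun=> 0) ->
    {ae mu, forall x, component v k x = 0}.
  move=> Lv q; apply: (partial_eq0 (i := i3)); first exact: Lv.
  move=> eta te; rewrite q// regular_distrE.
  rewrite patchT dotC dot0r //.
split; [exact: key|exact: key|].
have Ls : L2vec setT (m + h) := sh_memD (semi_hilbert_L2vec measurableT) Lm Lh.
apply: filterS (key _ _ Ls q3) => x; rewrite componentD => ?; lra.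
Qed.

Lemma limit_equations_dot m h v : L2vec setT m -> L2vec setT h -> L2vec setT v ->
  limit_equations m h ->
  L2dot setT h v = - dot mu (component m i3) (component v i3).
Proof.
move=> Lm Lh Lv /(limit_equations_field Lm Lh)[a1 a2 a3].
have sm k := L2vec_sqint k Lm; have sh k := L2vec_sqint k Lh; have sv k := L2vec_sqint k Lv.
have m0 : mfun3 (fun _ : R3 R => 0 : R) by exact: measurable_cst.
rewrite L2dotT big_I3 (dot_ae_eq (sh i1).1 m0 (sv i1).1 a1) (dot_ae_eq (sh i2).1 m0 (sv i2).1 a2).
rewrite (dot_ae_eq (sh i3).1 (sqintN (sm i3)).1 (sv i3).1 a3) !(dotC _ (fun=> 0)) !dot0r !add0r.
by rewrite dotC dotNr// dotC.
Qed.

End Maxwell.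

(** * Weak limits of sequences of bounded energy *)

Lemma column_le_sum (R : realType) (k : 'I_3) (d : 'I_3 -> 'I_3 -> R) :
  (forall i j, 0 <= d i j) -> \sum_i d i k <= \sum_i \sum_j 1 ^+ 2 * d i j.
Proof.
move=> d0; apply: ler_sum => i _; rewrite (bigD1 k)//= expr1n mul1r lerDl.
by apply: sumr_ge0 => j _; rewrite mul1r.
Qed.

Section Saturation.
Context {R : realType} (omega : set (R * R)) (homega : unit_domain omega) (ms : R).
Context (hms : 0 < ms).
Local Notation mu := (@leb3 R).
Local Notation Om := (Omega1 omega).
Local Notation WH := (semi_hilbert_W12 (open_Om homega)).
Implicit Types (m h : R3 R -> R3 R).

Lemma L2mapB U k (u v : R3 R -> R3 R) :
  L2map U k (u - v) = fun x => L2map U k u x - L2map U k v x.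
Proof.
apply/funext => x; rewrite /L2map !patchE; case: ifP => _; last by rewrite subr0.
by rewrite /component -coordB.
Qed.

Lemma enorm_sat (x : R3 R) : (enorm x = ms) <-> (\sum_k coord k x ^+ 2 = ms ^+ 2).
Proof.
rewrite -enorm_sq; split=> [->//|e].
by apply/eqP; rewrite -(@eqrXn2 _ 2)// ?sqrtr_ge0 ?ltW//; exact/eqP.
Qed.

Lemma sum_L2map_sq m x : Om x -> \sum_k L2map Om k m x ^+ 2 = enorm (m x) ^+ 2.
Proof.
by move=> Ox; rewrite enorm_sq; apply: eq_bigr => k _; rewrite /L2map patchE mem_set.
Qed.

Lemma bint_sum_sq m a b : L2vec Om m ->
  \sum_k bint (fun x => L2map Om k m x ^+ 2) a b =
  bint (fun x => \sum_k L2map Om k m x ^+ 2) a b.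
Proof.
move=> Lm; have sm k : sqint mu (L2map Om k m) by exact/L2_sqint/Lm.
have mQ := measurable_box a b.
have sq k := sqr_integrable mQ (sm k).
rewrite big_I3 /bint -RintegralD// -RintegralD//.
  by apply: eq_Rintegral => x _; rewrite big_I3.
by have := integrableD mQ (sq i1) (sq i2).
Qed.

(** By Rellich's theorem the squares of the components converge in the mean on
    every box inside the domain, so that the limit satisfies the constraint in the
    mean on these boxes, hence almost everywhere. *)
Lemma saturated_weak_limit (m_ : nat -> R3 R -> R3 R) m K :
  (forall n, W12 Om (m_ n)) -> W12 Om m ->
  (forall n, W12dot Om (m_ n) (m_ n) <= K) ->
  (forall k g, sqint mu g ->
     dot mu (L2map Om k (m_ n)) g @[n --> \oo] --> dot mu (L2map Om k m) g) ->
  (forall n, saturated omega ms (m_ n)) -> saturated omega ms m.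
Proof.
move=> Wn Wm bK wc sn; have oO := open_Om homega; have mO := mset_Om homega.
have sqn n k : sqint mu (L2map Om k (m_ n)) by exact/L2_sqint/(Wn n).1.
have sqm k : sqint mu (L2map Om k m) by exact/L2_sqint/Wm.1.
have sumE a b : box a b `<=` Om ->
    \sum_k bint (fun x => L2map Om k m x ^+ 2) a b = bint (fun=> ms ^+ 2) a b.
  move=> abO; have mQ := measurable_box a b.
  have Wu n : W12 Om (m_ n - m) := sh_memB WH (Wn n) Wm.
  have comp k : bint (fun x => L2map Om k (m_ n) x ^+ 2) a b @[n --> \oo] -->
      bint (fun x => L2map Om k m x ^+ 2) a b.
    rewrite bint_sqr_dot; under eq_fun do rewrite bint_sqr_dot.
    apply: (sh_cvg_sq (semi_hilbert_sqint mu)); try by move=> *; exact: sqint_restrict.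
    have := @rellich_box R Om (fun n => component (m_ n - m) k)
      (fun n i => weak_partial Om i (component (m_ n - m) k)) (2 * K + 2 * W12dot Om m m)
      a b abO (fun n => (Wu n).1 k) (fun n i => (weak_partialP i k (Wu n)).1)
      (fun n i => (weak_partialP i k (Wu n)).2) _ _.
    have to0 : forall g, sqint mu g ->
        dot mu (component (m_ n - m) k \_ Om) g @[n --> \oo] --> 0.
      move=> g sg; rewrite -(subrr (dot mu (L2map Om k m) g)).
      rewrite (_ : (fun n => _) = fun n => dot mu (L2map Om k (m_ n)) g - dot mu
          (L2map Om k m) g).
        by apply: cvgB; [exact: wc|exact: cvg_cst].
      by apply/funext => n; rewrite -dotB// -L2mapB.
    have bd n : \sum_i dot mu (weak_partial Om i (component (m_ n - m) k) \_ Om)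
        (weak_partial Om i (component (m_ n - m) k) \_ Om) <= 2 * K + 2 * W12dot Om m m.
      apply: (@le_trans _ _ (W12dot Om (m_ n - m) (m_ n - m))); last first.
        have h1 := sh_sqB_le WH (Wn n) Wm; have h2 := bK n.
        by apply: (le_trans h1); rewrite lerD2r ler_pM2l.
      rewrite W12dotE -[leLHS]add0r; apply: lerD; first exact: L2dot_ge0.
      pose d (i j : 'I_3) := dot mu (W12map Om (inr (i, j)) (m_ n - m)) (W12map Om (inr (i, j))
          (m_ n - m)).
      have d0 i j : 0 <= d i j by exact: dot_ge0.
      exact: (column_le_sum k d0).
    move=> /(_ bd to0); apply: cvg_trans; apply: near_eq_cvg; apply: nearW => n.
    have -> : component (m_ n - m) k \_ Om = fun x => L2map Om k (m_ n) x - L2map Om k m x.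
      exact: L2mapB.
    have e (f g : R3 R -> R) : (fun x => f x - g x) \_ (box a b)
        = f \_ (box a b) - g \_ (box a b).
      apply/funext => x; rewrite -[RHS]/((f \_ _) x - (g \_ _) x) !patchE.
      by case: ifP => _ //; rewrite subr0.
    by rewrite bint_sqr_dot e.
  have c1 := cvg_sumr (r := index_enum _) (f :=
      fun k n => bint (fun x => L2map Om k (m_ n) x ^+ 2) a b)
    (l := fun k => bint (fun x => L2map Om k m x ^+ 2) a b) comp.
  rewrite -(cvg_lim (@Rhausdorff R) c1); apply: cvg_lim => //.
  have : (bint (fun=> ms ^+ 2) a b) @[n --> \oo] --> bint (fun=> ms ^+ 2) a b by exact: cvg_cst.
  apply: cvg_trans; apply: near_eq_cvg; apply: nearW => n; apply/esym.
  rewrite bint_sum_sq; last exact: (Wn n).1.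
  apply: Rintegral_ae_eq => //.
  - apply: (@measurable_funTS _ _ (T3 R)); apply: measurable_sum => k.
    by apply: measurable_funX; case: (sqn n k).
  - apply: filterS (sn n) => x H Qx; rewrite sum_L2map_sq; last exact: abO.
    by rewrite H//; exact: abO.
have ae0 : {ae mu, forall x, Om x -> \sum_k L2map Om k m x ^+ 2 - ms ^+ 2 = 0}.
  have mf : mfun3 (fun x => \sum_k L2map Om k m x ^+ 2).
    by apply: measurable_sum => k; apply: measurable_funX; case: (sqm k).
  have int a b : mu.-integrable (box a b) (EFin \o (fun x => \sum_k L2map Om k m x ^+ 2)).
    have mQ := measurable_box a b; have sq k := sqr_integrable mQ (sqm k).
    have := integrableD mQ (integrableD mQ (sq i1) (sq i2)) (sq i3).
    by apply: eq_integrable => // x _; rewrite /= big_I3.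
  apply: box_ae0 => // [|a b abO|a b abO].
  - exact: measurable_funB.
  - have := integrableB (measurable_box a b) (int a b) (box_integrable_cst a b (ms ^+ 2)).
    by apply: eq_integrable => //; exact: measurable_box.
  - rewrite RintegralB//; [|exact: measurable_box|exact: box_integrable_cst].
    by rewrite -[X in X - _]/(bint _ a b) -bint_sum_sq ?sumE ?subrr//; exact: Wm.1.
apply: filterS ae0 => x H Ox; apply/enorm_sat.
by have := H Ox; rewrite sum_L2map_sq// enorm_sq => ?; lra.
Qed.

End Saturation.

(** * The thin-film limit *)

Lemma weakly_cvg_subseq (R : realType) (X : lmodType R) (V : set X) N u l (k : nat -> nat) :
  {homo k : i j / (i < j)%N} -> weakly_cvg V N u l -> weakly_cvg V N (u \o k) l.
Proof.
move=> hk [Vu Vl ul]; split=> // [j|ell lin bd]; first exact: Vu.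
exact: (subseq_cvg (u := fun j => ell (u j)) hk (ul ell lin bd)).
Qed.

Lemma subseq_of_frequently (P : nat -> Prop) :
  (forall N, exists2 n, (N <= n)%N & P n) ->
  exists2 k : nat -> nat, {homo k : i j / (i < j)%N} & forall j, P (k j).
Proof.
move=> fP; have /choice[g hg] N : exists n, (N < n)%N /\ P n.
  by have [n Nn Pn] := fP N.+1; exists n.
exists (fun j => iter j g (g 0%N)) => [|[|j]]; [|exact: (hg 0%N).2|exact: (hg _).2].
by apply: homo_ltn => [a b c|n]; [exact: ltn_trans | exact: (hg _).1].
Qed.

Lemma homo_comp (k l : nat -> nat) : {homo k : i j / (i < j)%N} ->
  {homo l : i j / (i < j)%N} -> {homo k \o l : i j / (i < j)%N}.
Proof. by move=> hk hl i j ij; apply: hk; exact: hl. Qed.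

Lemma to_zero_pos_subseq (R : realType) (eps_ : nat -> R) (k : nat -> nat) :
  {homo k : i j / (i < j)%N} -> to_zero_pos eps_ -> to_zero_pos (eps_ \o k).
Proof. by move=> hk [e0 ec]; split=> [j|]; [exact: e0 | exact: (subseq_cvg hk ec)]. Qed.

Section Film.
Context {R : realType} (omega : set (R * R)) (alpha ms : R) (phi : R3 R -> R).
Context (homega : unit_domain omega) (halpha : 0 < alpha) (hms : 0 < ms).
Context (phi_ge0 : forall v, 0 <= phi v) (phi_cont : continuous phi).
Local Notation mu := (@leb3 R).
Local Notation Om := (Omega1 omega).
Local Notation oO := (open_Om homega).
Local Notation WH := (semi_hilbert_W12 (open_Om homega)).
Local Notation LH := (semi_hilbert_L2vec (mset_Om homega)).
Local Notation TH := (semi_hilbert_L2vec (@measurableT _ (T3 R))).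
Local Notation aniso := (anisotropy omega phi).
Local Notation Fe := (F_eps omega alpha ms phi).
Implicit Types (m h : R3 R -> R3 R).

Definition partial_energy m (i k : 'I_3) : R :=
  dot mu (W12map Om (inr (i, k)) m) (W12map Om (inr (i, k)) m).

Lemma partial_energy_ge0 m i k : 0 <= partial_energy m i k.
Proof. exact: dot_ge0. Qed.

Lemma graddotE w m : graddot w Om m m = \sum_i \sum_k w i ^+ 2 * partial_energy m i k.
Proof. by []. Qed.

Lemma weighted_term_le (w : 'I_3 -> R) (d : 'I_3 -> 'I_3 -> R) i k :
  (forall i k, 0 <= d i k) -> w i ^+ 2 * d i k <= \sum_i \sum_k w i ^+ 2 * d i k.
Proof.
move=> d0; have t0 i' k' : 0 <= w i' ^+ 2 * d i' k' by rewrite mulr_ge0 ?sqr_ge0.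
rewrite (bigD1 i)//= (bigD1 k)//= -addrA lerDl addr_ge0//.
  by apply: sumr_ge0.
by apply: sumr_ge0 => i' _; apply: sumr_ge0.
Qed.

Lemma weighted_le (w w' : 'I_3 -> R) (c : R) (d : 'I_3 -> 'I_3 -> R) :
  (forall i k, 0 <= d i k) -> (forall i, w i ^+ 2 <= c * w' i ^+ 2) ->
  \sum_i \sum_k w i ^+ 2 * d i k <= c * \sum_i \sum_k w' i ^+ 2 * d i k.
Proof.
move=> d0 ww; rewrite mulr_sumr; apply: ler_sum => i _; rewrite mulr_sumr.
by apply: ler_sum => k _; rewrite mulrA ler_wpM2r.
Qed.

Lemma scale_sq (e : R) i : scale e i ^+ 2 = if i == i3 then e ^- 2 else 1.
Proof. by rewrite /scale; case: ifP => _; rewrite ?exprVn ?expr1n. Qed.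

Lemma F_eps_leP e m h C : (Fe e m h <= C%:E)%E -> U_eps omega ms e m h /\
  alpha * graddot (scale e) Om m m + aniso m + 2^-1 * L2dot setT h h <= C.
Proof.
rewrite /F_eps; case: asboolP => // U; have [in_ _ _ sm] := U.
rewrite (energyE homega phi_ge0 phi_cont _ (ltW halpha) in_ sm) lee_fin.
by [].
Qed.

(** The weight [e^-2] makes the derivative across the film small; the other bounds
    are uniform in [e <= E]. *)
Lemma energy_bounds e E m h C : 0 < e -> e <= E -> (Fe e m h <= C%:E)%E ->
  [/\ W12dot Om m m <= ms ^+ 2 + (1 + E ^+ 2) * (C / alpha),
      L2dot setT h h <= 2 * C,
      (forall k, partial_energy m i3 k <= e ^+ 2 * (C / alpha)) & 0 <= C].
Proof.
move=> e0 eE /F_eps_leP[[[Wm Lh] _ _ sm] le].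
have g0 := graddot_ge0 (scale e) Om m; have p0 := anisotropy_ge0 omega phi_ge0 m.
have h0 := L2dot_ge0 setT h.
have ag0 : 0 <= alpha * graddot (scale e) Om m m by rewrite mulr_ge0// ltW.
have C0 : 0 <= C by lra.
have gC : graddot (scale e) Om m m <= C / alpha by rewrite ler_pdivlMr// mulrC; lra.
have e20 : 0 < e ^+ 2 by rewrite exprn_gt0.
have eE2 : e ^+ 2 <= E ^+ 2.
  by apply: lerXn2r => //; rewrite nnegrE; [exact: ltW | exact: le_trans (ltW e0) eE].
split => //; last 2 first.
- lra.
- move=> k; have := weighted_term_le (scale e) i3 k (partial_energy_ge0 m).
  rewrite -graddotE scale_sq eqxx => c1.
  have : e ^- 2 * partial_energy m i3 k <= C / alpha by exact: le_trans c1 gC.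
  by rewrite [e ^- 2 * _]mulrC ler_pdivrMr// mulrC.
- rewrite W12dotE (saturated_dot homega Wm.1 sm) lerD2l.
  apply: (@le_trans _ _ ((1 + E ^+ 2) * graddot (scale e) Om m m)); last first.
    by rewrite ler_wpM2l// addr_ge0// sqr_ge0.
  rewrite !graddotE; apply: weighted_le => [i k|i]; first exact: partial_energy_ge0.
  rewrite scale_sq expr1n; case: ifP => _; last by rewrite mulr1 lerDl sqr_ge0.
  by rewrite ler_pdivlMr// mul1r; lra.
Qed.

Lemma weakly_cvg_W12P (m_ : nat -> R3 R -> R3 R) m :
  weakly_cvg (W12 Om) (W12norm Om) m_ m <-> [/\ forall j, W12 Om (m_ j), W12 Om m &
    forall y, W12 Om y -> W12dot Om (m_ j) y @[j --> \oo] --> W12dot Om m y].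
Proof.
apply: (sh_weakly_cvgP WH) => x Wx; apply: W12norm_dot => //; exact: mset_Om.
Qed.

Lemma weakly_cvg_L2P (h_ : nat -> R3 R -> R3 R) h :
  weakly_cvg (L2vec setT) (L2norm setT) h_ h <-> [/\ forall j, L2vec setT (h_ j), L2vec setT h &
    forall y, L2vec setT y -> L2dot setT (h_ j) y @[j --> \oo] --> L2dot setT h y].
Proof. by apply: (sh_weakly_cvgP TH) => x Lx; exact: L2norm_dot. Qed.

Lemma to_zero_bounded (eps_ : nat -> R) : to_zero_pos eps_ -> exists E, forall j, eps_ j <= E.
Proof.
move=> [e0 ec]; have /cvg_seq_bounded[M [_ hM]] : cvgn eps_ by apply/cvg_ex; exists 0.
exists (`|M| + 1) => j; apply: le_trans (ler_norm _) _.
by apply: hM => //; have := ler_norm M; lra.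
Qed.

Lemma film_compactness (eps_ : nat -> R) (m_ h_ : nat -> R3 R -> R3 R) (C : R) :
  to_zero_pos eps_ -> (forall j, in_W12_L2 omega (m_ j) (h_ j)) ->
  (forall j, (Fe (eps_ j) (m_ j) (h_ j) <= C%:E)%E) ->
  exists (k : nat -> nat) (m h : R3 R -> R3 R),
    {homo k : i j / (i < j)%N} /\ weakly_cvg_pair omega (m_ \o k) (h_ \o k) m h.
Proof.
move=> te inn le; have [E hE] := to_zero_bounded te.
have B j := energy_bounds (te.1 j) (hE j) (le j).
have [k1 [m [hk1 Wm cm]]] := sh_weak_compact WH (fun j => (inn j).1)
  (fun j => let: And4 b _ _ _ := B j in b).
have [k2 [h [hk2 Lh ch]]] := sh_weak_compact TH (fun j => (inn (k1 j)).2)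
  (fun j => let: And4 _ b _ _ := B (k1 j) in b).
exists (k1 \o k2), m, h; split; first exact: homo_comp.
split; last by apply/weakly_cvg_L2P; split => // j; exact: (inn _).2.
apply: (weakly_cvg_W12P _ _).2; split=> [j| |y Wy]; [exact: (inn _).1|exact: Wm|].
exact: (subseq_cvg (u := fun j => W12dot Om (m_ (k1 j)) y) hk2 (cm y Wy)).
Qed.

Lemma weak_pair_coord (m_ h_ : nat -> R3 R -> R3 R) m h :
  weakly_cvg_pair omega m_ h_ m h ->
  (forall p g, sqint mu g -> dot mu (W12map Om p (m_ j)) g
      @[j --> \oo] --> dot mu (W12map Om p m) g) /\
  (forall k g, sqint mu g -> dot mu (component (h_ j) k) g
      @[j --> \oo] --> dot mu (component h k) g).
Proof.
move=> [cm ch]; split=> [p g sg|k g sg]; first exact: (W12_weakly_cvg_dot oO).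
have := L2_weakly_cvg_dot (k := k) (@measurableT _ (T3 R)) ch sg.
by rewrite /L2map patchT; under eq_fun do rewrite patchT.
Qed.

Local Notation flat := (fun i : 'I_3 => (i != i3)%:R : R).

Lemma flat_le_scale e i : flat i ^+ 2 <= 1 * scale e i ^+ 2.
Proof.
by rewrite mul1r scale_sq; case: ifP => _; rewrite ?expr0n ?expr1n// invr_ge0 sqr_ge0.
Qed.

Lemma partial_energy_eq0 m k : W12 Om m -> partial_energy m i3 k = 0 ->
  eq_distr Om (fun_partial Om i3 (component m k)) (fun=> 0).
Proof.
move=> Wm g0 eta te; have wp := (weak_partialP i3 k Wm).2.
rewrite (wp _ te) regular_distrE -[_ \_ _]/(W12map Om (inr (i3, k)) m).
have := dot_CS (W12map_sqint (inr (i3, k)) Wm) (test_sqint te).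
rewrite -/(partial_energy m i3 k) g0 mul0r => le0.
by apply/eqP; rewrite -sqrf_eq0 eq_le le0 sqr_ge0.
Qed.

Lemma eq0_partial_energy m k : W12 Om m ->
  eq_distr Om (fun_partial Om i3 (component m k)) (fun=> 0) -> partial_energy m i3 k = 0.
Proof.
move=> Wm d0; have [L wp] := weak_partialP i3 k Wm.
have s0 : L2 Om (fun=> 0).
  by apply/L2_sqint; rewrite (_ : _ \_ _ = fun=> 0); [exact: sqint0 | apply/funext => x;
      rewrite patchE if_same].
have w0 : is_weak_partial Om i3 (component m k) (fun=> 0).
  move=> eta te; rewrite d0// regular_distrE dotC (_ : _ \_ _ = fun=> 0) ?dot0r//.
  by apply/funext => x; rewrite patchE if_same.
have ae := weak_partial_unique oO L s0 wp w0.
have sw := W12map_sqint (inr (i3, k)) Wm.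
rewrite /partial_energy (dot_ae_eq (f' := fun=> 0) sw.1 _ sw.1) ?(dotC _ (fun=> 0)) ?dot0r//.
by apply: filterS ae => x; rewrite /W12map => ->; rewrite patchE if_same.
Qed.

(** Every term of the energy is lower semicontinuous: along the sequence the
    magnetizations converge strongly, because their norm is prescribed, and the
    quadratic terms are bounded below by their tangents at the limit. *)
Lemma F_0_le (eps_ : nat -> R) (m_ h_ : nat -> R3 R -> R3 R) m h C :
  to_zero_pos eps_ -> weakly_cvg_pair omega m_ h_ m h ->
  (forall j, (Fe (eps_ j) (m_ j) (h_ j) <= C%:E)%E) ->
  (F_0 omega alpha ms phi m h <= C%:E)%E.
Proof.
move=> te wc le; have [E hE] := to_zero_bounded te.
have B j := energy_bounds (te.1 j) (hE j) (le j).
have U j := (F_eps_leP (le j)).1.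
have [wm wh] := weak_pair_coord wc.
have [[Wn Wm _] [Ln Lh _]] := wc.
have sn j : saturated omega ms (m_ j) by have [] := U j.
have Lm := Wm.1; have Lmn j := (Wn j).1.
have sm : saturated omega ms m.
  apply: (saturated_weak_limit homega hms Wn Wm (fun j => let: And4 b _ _ _ := B j in b)) => //.
  by move=> k g sg; exact: (wm (inl k) g sg).
have strong : L2dot Om (m_ j - m) (m_ j - m) @[j --> \oo] --> 0.
  apply: (sh_cvg_norm LH) => //.
    apply: cvg_sumr => k; apply: (wm (inl k)); exact: (W12map_sqint (inl k) Wm).
  rewrite (saturated_dot homega Lm sm).
  by under eq_fun do rewrite (saturated_dot homega (Lmn _) (sn _)); exact: cvg_cst.
have pc := anisotropy_cvg homega phi_ge0 phi_cont Lmn Lm sn sm strong.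
have cell i k : dot mu (W12map Om (inr (i, k)) (m_ j)) (W12map Om (inr (i, k)) m)
    @[j --> \oo] --> partial_energy m i k.
  by apply: wm; exact: W12map_sqint.
have g3 k : partial_energy m i3 k = 0.
  have bnd j : dot mu (W12map Om (inr (i3, k)) (m_ j)) (W12map Om (inr (i3, k)) m) ^+ 2 <=
      eps_ j ^+ 2 * (C / alpha) * partial_energy m i3 k.
    apply: (le_trans (dot_CS (W12map_sqint _ (Wn j)) (W12map_sqint _ Wm))).
    rewrite ler_wpM2r//; first exact: partial_energy_ge0.
    by have [_ _ + _] := B j; apply.
  have lim0 : eps_ j ^+ 2 * (C / alpha) * partial_energy m i3 k @[j --> \oo] --> 0.
    rewrite -[X in _ --> X](mul0r (partial_energy m i3 k)); apply: cvgM; last exact: cvg_cst.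
    rewrite -[X in _ --> X](mul0r (C / alpha)); apply: cvgM; last exact: cvg_cst.
    by rewrite -[X in _ --> X](mulr0 0); exact: (cvgM te.2 te.2).
  have l2 : dot mu (W12map Om (inr (i3, k)) (m_ j)) (W12map Om (inr (i3, k)) m) ^+ 2
      @[j --> \oo] --> partial_energy m i3 k ^+ 2 by exact: (cvgM (cell i3 k) (cell i3 k)).
  have : partial_energy m i3 k ^+ 2 <= 0 by apply: (ler_cvg_to l2 lim0); exact: nearW.
  move=> le0; apply/eqP; rewrite -sqrf_eq0 eq_le sqr_ge0 le0 //.
have U0 : U_0 omega ms m h.
  split => //.
    apply: (limit_equations_cvg (m_ := fun j => m_ j \_ Om) te) => //.
    - by move=> j; exact: L2vec_patch.
    - exact: L2vec_patch.
    - by move=> k g sg; rewrite component_patch; under eq_fun do rewrite component_patch;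
        exact: (wm (inl k) g sg).
    - by move=> j; have [] := U j.
    - by move=> j; have [] := U j.
  by move=> k; exact: partial_energy_eq0.
rewrite /F_0 asboolT// (energyE homega phi_ge0 phi_cont _ (ltW halpha) (conj Wm Lh) sm) lee_fin.
have cG : \sum_i \sum_k flat i ^+ 2 * (2 * dot mu (W12map Om (inr (i, k)) (m_ j)) (W12map Om
    (inr (i, k)) m)
     - partial_energy m i k) @[j --> \oo] --> graddot flat Om m m.
  rewrite graddotE; apply: cvg_sumr => i; apply: cvg_sumr => k; apply: cvgM; first exact: cvg_cst.
  rewrite [X in _ --> X](_ : _ = 2 * partial_energy m i k - partial_energy m i k); last by ring.
  by apply: cvgB; [apply: cvgM; [exact: cvg_cst|exact: cell]|exact: cvg_cst].
have cH : 2 * L2dot setT (h_ j) h - L2dot setT h h @[j --> \oo] --> L2dot setT h h.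
  rewrite [X in _ --> X](_ : _ = 2 * L2dot setT h h - L2dot setT h h); last by ring.
  apply: cvgB; [apply: cvgM; [exact: cvg_cst|]|exact: cvg_cst].
  by have /weakly_cvg_L2P[_ _] := wc.2; apply.
pose G j := \sum_i \sum_k flat i ^+ 2 * (2 * dot mu (W12map Om (inr (i, k)) (m_ j)) (W12map Om
    (inr (i, k)) m)
     - partial_energy m i k).
have cA : alpha * G j + aniso (m_ j) + 2^-1 * (2 * L2dot setT (h_ j) h - L2dot setT h h)
    @[j --> \oo] --> alpha * graddot flat Om m m + aniso m + 2^-1 * L2dot setT h h.
  apply: cvgD; [apply: cvgD => //; apply: cvgM|apply: cvgM] => //; exact: cvg_cst.
apply: (cvgr_to_le cA); apply: nearW => j /=.
apply: le_trans (F_eps_leP (le j)).2; apply: lerD; first apply: lerD => //.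
  rewrite ler_pM2l//; apply: (@le_trans _ _ (graddot flat Om (m_ j) (m_ j))).
    rewrite graddotE; apply: ler_sum => i _; apply: ler_sum => k _.
    rewrite ler_wpM2l ?sqr_ge0//.
    exact: (sh_tangent (semi_hilbert_sqint mu) (W12map_sqint _ (Wn j)) (W12map_sqint _ Wm)).
  rewrite !graddotE -[leRHS]mul1r; apply: weighted_le => [i k|i]; first exact: partial_energy_ge0.
  exact: flat_le_scale.
by rewrite ler_pM2l//; exact: (sh_tangent TH).
Qed.

End Film.

(** ** Recovery sequences *)

Section StrayField.
Context {R : realType}.
Local Notation mu := (@leb3 R).
Local Notation TH := (semi_hilbert_L2vec (@measurableT _ (T3 R))).
Implicit Types (m h v : R3 R -> R3 R).

(** The field of a magnetization is minus its orthogonal projection onto the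
    curl-free fields: the latter contain all rescaled gradients, to which the
    difference is orthogonal. *)
Lemma stray_field (e : R) m : L2vec setT m -> exists h, [/\ L2vec setT h,
  eq_distr setT (div_eps e (m + h)) (fun=> 0),
  forall k, eq_distr setT (curl_eps e h k) (fun=> 0),
  L2dot setT h h = - L2dot setT m h & L2dot setT h h <= L2dot setT m m].
Proof.
move=> Lm; pose W : set (R3 R -> R3 R) := [set v | L2vec setT v /\ forall k zeta,
  test_function setT zeta -> L2dot setT v (scaled_curl e k zeta) = 0].
have LC k zeta : test_function setT zeta -> L2vec setT
    (scaled_curl e k zeta) by exact: scaled_curl_L2.
have W0 : W 0.
  split; first exact: (sh_mem0 TH).
  move=> k zeta tz; have := sh_Zl TH 0 (sh_mem0 TH) (LC k _ tz).
  by rewrite scale0r mul0r.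
have WL a u v : W u -> W v -> W (a *: u + v).
  move=> [Lu u0] [Lv v0]; split; first exact: (sh_memL TH).
  by move=> k zeta tz; rewrite (sh_lin TH)//; [rewrite u0// v0// mulr0 addr0|exact: LC].
have Wcl (u : nat -> R3 R -> R3 R) l : (forall n, W (u n)) -> L2vec setT l ->
    L2dot setT (u n - l) (u n - l) @[n --> \oo] --> 0 -> W l.
  move=> Wu Ll ul; split=> // k zeta tz.
  have c := sh_cvg_l TH (fun n => (Wu n).1) Ll (LC k _ tz) ul.
  rewrite -(cvg_lim (@Rhausdorff R) c); apply: cvg_lim => //.
  by under eq_fun do rewrite (Wu _).2//; exact: cvg_cst.
have [p Wp pm] := sh_proj TH (fun v (w : W v) => w.1) W0 WL Wcl Lm.
have Lp := Wp.1; have LN := sh_memN TH Lp.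
have pp : L2dot setT m p = L2dot setT p p.
  by have := pm p Wp; rewrite (sh_Bl TH)// => ?; lra.
have hh : L2dot setT (- p) (- p) = L2dot setT p p.
  by rewrite -scaleN1r (sh_Zl TH)// ?(sh_Zr TH)//; [ring|rewrite scaleN1r].
have mh : L2dot setT m (- p) = - L2dot setT m p by rewrite -scaleN1r (sh_Zr TH)// mulN1r.
exists (- p); split => //.
- move=> eta te; rewrite div_epsE//; last exact: (sh_memB TH).
  rewrite pm ?oppr0//; split; first exact: scaled_grad_L2.
  by move=> k zeta tz; exact: curl_grad.
- move=> k zeta tz; rewrite curl_epsE// -scaleN1r (sh_Zl TH)//; last exact: LC.
  by rewrite Wp.2// mulr0.
- by rewrite hh mh opprK pp.
- rewrite hh; have := sh_ge0 TH (sh_memB TH Lm Lp).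
  by rewrite (sh_sqB TH)// pp => ?; lra.
Qed.

End StrayField.

Section Gamma.
Context {R : realType} (omega : set (R * R)) (alpha ms : R) (phi : R3 R -> R).
Context (homega : unit_domain omega) (halpha : 0 < alpha) (hms : 0 < ms).
Context (phi_ge0 : forall v, 0 <= phi v) (phi_cont : continuous phi).
Local Notation mu := (@leb3 R).
Local Notation Om := (Omega1 omega).
Local Notation TH := (semi_hilbert_L2vec (@measurableT _ (T3 R))).
Local Notation Fe := (F_eps omega alpha ms phi).
Local Notation F0 := (F_0 omega alpha ms phi).
Implicit Types (m h : R3 R -> R3 R).

Lemma F_0_le_frequently (eps_ : nat -> R) (m_ h_ : nat -> R3 R -> R3 R) m h C :
  to_zero_pos eps_ -> weakly_cvg_pair omega m_ h_ m h ->
  (forall N, exists2 n, (N <= n)%N & (Fe (eps_ n) (m_ n) (h_ n) <= C%:E)%E) ->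
  (F0 m h <= C%:E)%E.
Proof.
move=> te [cm ch] /subseq_of_frequently[k hk le].
apply: (F_0_le homega halpha hms phi_ge0 phi_cont (to_zero_pos_subseq hk te) _ le).
by split; [exact: (weakly_cvg_subseq hk cm) | exact: (weakly_cvg_subseq hk ch)].
Qed.

(** A real number above the lower limit bounds the energy along a subsequence. *)
Lemma liminf_inequality (eps_ : nat -> R) (m_ h_ : nat -> R3 R -> R3 R) m h :
  to_zero_pos eps_ -> weakly_cvg_pair omega m_ h_ m h ->
  (F0 m h <= limn_einf (fun j => Fe (eps_ j) (m_ j) (h_ j)))%E.
Proof.
move=> te wc; set u := fun j => _.
have key (C : R) : (limn_einf u < C%:E)%E -> (F0 m h <= C%:E)%E.
  move=> lC; apply: (F_0_le_frequently te wc) => N.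
  have : (einfs u N < C%:E)%E.
    by apply: le_lt_trans lC; rewrite limn_einfE; apply: ereal_sup_ubound; exists N.
  by move=> /ereal_inf_lt[_ [n /= Nn <-] /ltW un]; exists n.
case E : (limn_einf u) key => [r| |] key; [|by rewrite leey|].
  by apply/lee_addgt0Pr => e e0; rewrite -EFinD; apply: key; rewrite lte_fin ltrDl.
by rewrite (@eq_ninfty _ (F0 m h))// => r; apply: key; rewrite ltNyr.
Qed.

Lemma weakly_cvg_cst (X : lmodType R) (V : set X) N x : V x ->
  weakly_cvg V N (fun=> x) x.
Proof. by move=> Vx; split=> // ell _ _; exact: cvg_cst. Qed.

(** The stray fields are bounded by [m], and each of their weak limits solves the
    limit equations, which determine it. Their norms converge because they are
    given by pairings with [m]. *)
Lemma U_0_recovery (eps_ : nat -> R) m h : to_zero_pos eps_ -> U_0 omega ms m h ->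
  exists h_ : nat -> R3 R -> R3 R, [/\ forall j, U_eps omega ms (eps_ j) m (h_ j),
    weakly_cvg (L2vec setT) (L2norm setT) h_ h &
    L2dot setT (h_ j) (h_ j) @[j --> \oo] --> L2dot setT h h].
Proof.
move=> te [[Wm Lh] eqs _ sm]; have LM := L2vec_patch Wm.1; set M := m \_ Om in LM eqs.
have /choice[h_ hP] : forall j, exists h, [/\ L2vec setT h,
    eq_distr setT (div_eps (eps_ j) (M + h)) (fun=> 0),
    forall k, eq_distr setT (curl_eps (eps_ j) h k) (fun=> 0),
    L2dot setT h h = - L2dot setT M h & L2dot setT h h <= L2dot setT M M].
  by move=> j; exact: stray_field.
have Ln j : L2vec setT (h_ j) by have [] := hP j.
have bd j : L2dot setT (h_ j) (h_ j) <= L2dot setT M M by have [] := hP j.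
have wc y : L2vec setT y -> L2dot setT (h_ j) y @[j --> \oo] --> L2dot setT h y.
  move=> Ly; apply: contrapT => /cvgrPdist_le/existsNP[e /not_implyP[e0 nfar]].
  have /subseq_of_frequently[k hk far] : forall N, exists2 n, (N <= n)%N &
      ~ `|L2dot setT h y - L2dot setT (h_ n) y| <= e.
    move=> N; apply: contrapT => /forall2NP H; apply: nfar; exists N => // n /= Nn.
    by have [//|/contrapT] := H n.
  have [k' [l [hk' Ll cl]]] := sh_weak_compact TH (fun j => Ln (k j)) (fun j => bd (k j)).
  have tk := to_zero_pos_subseq hk' (to_zero_pos_subseq hk te).
  have leq : limit_equations M l.
    apply: (limit_equations_cvg (m_ := fun=> M) (h_ := fun n => h_ (k (k' n))) tk) => //.
    - by move=> *; exact: cvg_cst.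
    (* pairing the [i]-th component with [g] is pairing with the field [g e_i] *)
    - move=> i g sg; pose y' : R3 R -> R3 R := fun x => g x *: evec i.
      have cE j : component y' j = fun x => (j == i)%:R * g x.
        by apply/funext => x; rewrite /component coordZ coord_evec mulrC.
      have Ly' : L2vec setT y'.
        by apply: sqint_L2vec => j; rewrite cE; exact: sqintZ.
      have dE v : L2vec setT v -> L2dot setT v y' = dot mu (component v i) g.
        move=> Lv; rewrite L2dotT (bigD1 i)//= big1 ?addr0.
          by rewrite cE eqxx; under [X in dot mu _ X]eq_fun do rewrite mul1r.
        move=> j /negPf ji; rewrite cE ji.
        by under [X in dot mu _ X]eq_fun do rewrite mul0r; rewrite dot0r.
      by rewrite -dE//; have := cl _ Ly'; under eq_fun do rewrite dE//.
    - by move=> n; have [] := hP (k (k' n)).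
    - by move=> n; have [] := hP (k (k' n)).
  have ly : L2dot setT l y = L2dot setT h y.
    by rewrite (limit_equations_dot LM Ll Ly leq) (limit_equations_dot LM Lh Ly eqs).
  have /cvgrPdist_le/(_ e e0)[N _ /(_ N (leqnn N))] := cl y Ly.
  by rewrite ly; exact: far.
exists h_; split.
- by move=> j; have [L d c _ _] := hP j; split.
- by apply/weakly_cvg_L2P; split.
- have hh : L2dot setT h h = - L2dot setT h M.
    rewrite (limit_equations_dot LM Lh LM eqs) (limit_equations_dot LM Lh Lh eqs) opprK.
    have sM := L2vec_sqint i3 LM; have sh := L2vec_sqint i3 Lh.
    have [_ _ a3] := limit_equations_field LM Lh eqs.
    rewrite dotC (dot_ae_eq sh.1 (sqintN sM).1 sM.1 a3) dotC dotNr// opprK //.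
  rewrite hh; have : - L2dot setT (h_ j) M @[j --> \oo] --> - L2dot setT h M.
    by apply: cvgN; exact: wc.
  apply: cvg_trans; apply: near_eq_cvg; apply: nearW => j.
  by have [L _ _ -> _] := hP j; rewrite (sh_sym TH).
Qed.

Lemma recovery_sequence (eps_ : nat -> R) m h :
  to_zero_pos eps_ -> in_W12_L2 omega m h ->
  exists m_ h_ : nat -> R3 R -> R3 R, weakly_cvg_pair omega m_ h_ m h /\
    Fe (eps_ j) (m_ j) (h_ j) @[j --> \oo] --> F0 m h.
Proof.
move=> te [Wm Lh]; have [U|U] := pselect (U_0 omega ms m h); last first.
  exists (fun=> m), (fun=> h).
  have wc : weakly_cvg_pair omega (fun=> m) (fun=> h) m h.
    by split; exact: weakly_cvg_cst.
  split => //; have F0y : F0 m h = +oo%E by rewrite /F_0 asboolF.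
  (* bounded energies along a subsequence would give a finite limit energy *)
  rewrite F0y; apply/cvgeyPge => A; apply: contrapT => nA.
  suff : (F0 m h <= A%:E)%E by rewrite F0y.
  apply: (F_0_le_frequently te wc) => N; apply: contrapT => /forall2NP H.
  apply: nA; exists N => // n /= Nn; have [//|/negP] := H n.
  by rewrite -ltNge => /ltW.
have [h_ [Un wc ch]] := U_0_recovery te U.
exists (fun=> m), h_; split; first by split => //; exact: weakly_cvg_cst.
have [_ _ d3 sm] := U.
have g3 k : partial_energy omega m i3 k = 0 by exact: eq0_partial_energy.
have gE j : graddot (scale (eps_ j)) Om m m = graddot (fun i => (i != i3)%:R) Om m m.
  rewrite !graddotE; apply: eq_bigr => i _; apply: eq_bigr => k _.
  rewrite scale_sq; have [->|_] := eqVneq i i3; first by rewrite g3 !mulr0.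
  by rewrite expr1n.
rewrite /F_0 asboolT// (energyE homega phi_ge0 phi_cont _ (ltW halpha) (conj Wm Lh) sm).
rewrite (_ : (fun j => _) = fun j => (alpha * graddot (fun i => (i != i3)%:R) Om m m +
    anisotropy omega phi m + 2^-1 * L2dot setT (h_ j) (h_ j))%:E); last first.
  apply/funext => j; rewrite /F_eps asboolT//.
  have [in_ _ _ _] := Un j.
  by rewrite (energyE homega phi_ge0 phi_cont _ (ltW halpha) in_ sm) gE.
apply: cvg_EFin; first exact: nearW.
by apply: cvgD; [exact: cvg_cst|apply: cvgM => //; exact: cvg_cst].
Qed.

End Gamma.

Theorem theorem2p1 (R : realType) (omega : set (R * R)) (alpha ms : R)
    (phi : R3 R -> R)
    (homega : unit_domain omega) (halpha : 0 < alpha) (hms : 0 < ms)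
    (phi_ge0 : forall v, 0 <= phi v) (phi_cont : continuous phi)
    (phi_even : forall v, phi (- v) = phi v) :
  is_gamma_limit omega (F_eps omega alpha ms phi) (F_0 omega alpha ms phi) /\
  forall (eps_ : nat -> R) (m_ h_ : nat -> R3 R -> R3 R) (C : R),
    to_zero_pos eps_ ->
    (forall j, in_W12_L2 omega (m_ j) (h_ j)) ->
    (forall j, (F_eps omega alpha ms phi (eps_ j) (m_ j) (h_ j) <= C%:E)%E) ->
    exists (k : nat -> nat) (m h : R3 R -> R3 R),
      {homo k : i j / (i < j)%N} /\
      weakly_cvg_pair omega (m_ \o k) (h_ \o k) m h.
Proof.
split=> [eps_ m h te inn|eps_ m_ h_ C te inn le].
  split=> [m_ h_ wc|]; first exact: liminf_inequality.
  exact: recovery_sequence.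
exact: (film_compactness homega halpha phi_ge0 phi_cont te inn le).
Qed.
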